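(* Fix $d\in\{3,5\}$, $\kappa\in\{-1,1\}$ and $S>d+1$. There are infinitely many stationary weak singular solutions $u$ on $\mathbb T^2$ (for the equation $(-1)^{(d+1)/2}\partial_x^du+\kappa\partial_x^{-1}\partial_y^2u+\partial_x(u^2)=0$) depending nontrivially on $y$ such that $$u\in\bigcap_{1\le p<2}L^p(\mathbb T^2)\cap\bigcap_{\sigma>0}\bigl(H^{-\sigma,0}(\mathbb T^2)\cap H^{-\sigma}(\mathbb T^2)\bigr),\qquad \operatorname{AF}^x_S(u)<\infty.$$
   Context: $\mathbb T^2=(\mathbb R/\mathbb Z)_x\times(\mathbb R/\mathbb Z)_y$ with normalized Haar measure, $\widehat f(n,m)=\int_{\mathbb T^2}f e^{-2\pi i(nx+my)}\,dx\,dy$, $k=(n,m)$, $k_x=n$, $\langle k\rangle=(1+n^2+m^2)^{1/2}$. $\mathbb P_{x\ne0}$ is the Fourier projection onto modes with $n\ne0$; $\widehat{\partial_x^{-1}f}(n,m)=(2\pi i n)^{-1}\widehat f(n,m)$ for $n\neq0$ and $0$ for $n=0$. $H^s$ is the isotropic Sobolev space; $H^{s,0}$ has weight $(1+n^2)^{s/2}$ on the $x$-frequency only. For a distribution $u$ on $\mathbb T^2$ and $S>0$, $\operatorname{AF}^x_S(u)=\sum_{(k_1+k_2)_x\ne0}\langle k_1+k_2\rangle^{-S}|\widehat u(k_1)\widehat u(k_2)|$ (sum over $(k_1,k_2)\in(\mathbb Z^2)^2$). If it is finite, $\mathbb P_{x\ne0}(u^2)$ is the distribution with $\widehat{\mathbb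 P_{x\ne0}(u^2)}(k)=\sum_{k_1+k_2=k}\widehat u(k_1)\widehat u(k_2)$ for $k_x\ne0$ and $0$ for $k_x=0$. A real distribution $u$ on $\mathbb T^2$ is a stationary weak singular solution if $\mathbb P_{x\ne0}u=u$, $\operatorname{AF}^x_{S'}(u)<\infty$ for some $S'>0$, and for every $\phi\in C^\infty(\mathbb T^2)$ $$\bigl\langle u,(-1)^{(d+1)/2}\partial_x^d\phi+\kappa\partial_x^{-1}\partial_y^2\phi\bigr\rangle+\bigl\langle\mathbb P_{x\ne0}(u^2),\partial_x\phi\bigr\rangle=0.$$ *)

(* Defs.v *)
From HB Require Import structures.
From mathcomp Require Import all_boot all_order all_algebra.
From mathcomp Require Import all_classical all_reals all_analysis.
From mathcomp Require Import complex.
Import Order.TTheory GRing.Theory Num.Theory numFieldNormedType.Exports.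
Set Implicit Arguments.
Unset Strict Implicit.
Unset Printing Implicit Defensive.
Local Open Scope classical_set_scope.
Local Open Scope ring_scope.
Local Open Scope complex_scope.

Local Notation Re := complex.Re.
Local Notation Im := complex.Im.
Notation normc := ComplexField.Normc.normc.

(* Functions on the torus are functions on the plane; smooth ones are required
   to be 1-periodic in each variable, and integrals over the torus are taken
   over the fundamental domain [0,1) x [0,1). *)
Definition square {R : realType} : set (R * R) := `[0, 1[ `*` `[0, 1[.

Notation plane_measure := (lebesgue_measure \x lebesgue_measure)%E.

Definition torus_int {R : realType} (f : R * R -> R[i]) : R[i] :=
  (\int[plane_measure]_(z in square) Re (f z))
    +i* (\int[plane_measure]_(z in square) Im (f z)).

(* A frequency k = (n, m) is a pair of integers: n is k.1, m is k.2. *)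
Notation freq := (int * int)%type.

Definition character {R : realType} (k : freq) (z : R * R) : R[i] :=
  let t := 2 * pi * (k.1%:~R * z.1 + k.2%:~R * z.2) in cos t +i* sin t.

Definition fun_coef {R : realType} (f : R * R -> R[i]) (k : freq) : R[i] :=
  torus_int (fun z => f z * character (- k) z).

Definition dx {R : realType} (f : R * R -> R[i]) (z : R * R) : R[i] :=
  derive1 (fun s => Re (f (s, z.2))) z.1
    +i* derive1 (fun s => Im (f (s, z.2))) z.1.

Definition dy {R : realType} (f : R * R -> R[i]) (z : R * R) : R[i] :=
  derive1 (fun s => Re (f (z.1, s))) z.2
    +i* derive1 (fun s => Im (f (z.1, s))) z.2.

(* The iterated partial derivative along a word: true is x, false is y. *)
Definition dword {R : realType} (w : seq bool) (f : R * R -> R[i]) :=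
  foldr (fun b g => if b then dx g else dy g) f w.

Definition partially_derivable {R : realType} (f : R * R -> R[i]) : Prop :=
  forall z : R * R,
    [/\ derivable (fun s => Re (f (s, z.2))) z.1 1,
        derivable (fun s => Im (f (s, z.2))) z.1 1,
        derivable (fun s => Re (f (z.1, s))) z.2 1 &
        derivable (fun s => Im (f (z.1, s))) z.2 1].

Record smooth {R : realType} (f : R * R -> R[i]) : Prop := Smooth {
  smooth_periodic_x : forall x y, f (x + 1, y) = f (x, y);
  smooth_periodic_y : forall x y, f (x, y + 1) = f (x, y);
  smooth_cont_Re : forall w, continuous (fun z => Re (dword w f z));
  smooth_cont_Im : forall w, continuous (fun z => Im (dword w f z));
  smooth_derivable : forall w, partially_derivable (dword w f)
}.

(* A distribution is a linear functional on smooth functions that is bounded by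
   some C^N norm.  It is applied to arbitrary functions, with the value 0 at
   those that are not smooth, so that two distributions are equal exactly when
   they agree on smooth functions. *)
Record torus_distribution (R : realType) := TorusDistribution {
  dist_fun :> (R * R -> R[i]) -> R[i];
  dist_out : forall f, ~ smooth f -> dist_fun f = 0;
  dist_linear : forall (c : R[i]) f g, smooth f -> smooth g ->
    dist_fun (fun z => c * f z + g z) = c * dist_fun f + dist_fun g;
  dist_bounded : exists (N : nat) (A : R), forall f (M : R), smooth f ->
    (forall w z, (size w <= N)%N -> normc (dword w f z) <= M) ->
    normc (dist_fun f) <= A * M
}.

Lemma distribution_ext (R : realType) (u v : torus_distribution R) :
  (forall f, smooth f -> u f = v f) -> u = v.
Proof.
case: u => u u0 uL uB; case: v => v v0 vL vB /= uv.
have e : u = v.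
  apply/funext => f; have [/uv //|nf] := pselect (smooth f).
  by rewrite u0 // v0.
by case: _ / e in v0 vL vB uv *; congr TorusDistribution; exact: Prop_irrelevance.
Qed.

HB.instance Definition _ (R : realType) := gen_eqMixin (torus_distribution R).
HB.instance Definition _ (R : realType) := gen_choiceMixin (torus_distribution R).

Lemma zero_dist_linear (R : realType) (c : R[i]) (f g : R * R -> R[i]) :
  smooth f -> smooth g -> 0 = c * 0 + 0 :> R[i].
Proof. by rewrite mulr0 addr0. Qed.

Lemma zero_dist_bounded (R : realType) :
  exists (N : nat) (A : R), forall (f : R * R -> R[i]) (M : R), smooth f ->
    (forall w z, (size w <= N)%N -> normc (dword w f z) <= M) ->
    normc (0 : R[i]) <= A * M.
Proof.
by exists 0%N, 0 => f M _ _; rewrite mul0r ComplexField.Normc.normc0.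
Qed.

Definition zero_dist {R : realType} : torus_distribution R :=
  @TorusDistribution R (fun=> 0) (fun _ _ => erefl)
    (@zero_dist_linear R) (zero_dist_bounded R).

Definition real_dist {R : realType} (u : torus_distribution R) : Prop :=
  forall f, smooth f -> (forall z, Im (f z) = 0) -> Im (u f) = 0.

Definition coef {R : realType} (u : torus_distribution R) (k : freq) : R[i] :=
  u (character (- k)).

(* The distribution, respectively the smooth function, with prescribed Fourier
   coefficients.  It is unique when it exists; otherwise the value is 0. *)
Definition dist_of_coef {R : realType} (c : freq -> R[i]) : torus_distribution R :=
  xget zero_dist [set w : torus_distribution R | forall k, coef w k = c k].

Definition smooth_of_coef {R : realType} (c : freq -> R[i]) : R * R -> R[i] :=
  xget (fun=> 0)
    [set f : R * R -> R[i] | smooth f /\ forall k, fun_coef f k = c k].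

Definition dx_inv {R : realType} (f : R * R -> R[i]) : R * R -> R[i] :=
  smooth_of_coef (fun k => if k.1 == 0 then 0 else
    (2 * pi * k.1%:~R)*i^-1 * fun_coef f k).

Definition xne0_proj {R : realType} (u : torus_distribution R) : torus_distribution R :=
  dist_of_coef (fun k => if k.1 == 0 then 0 else coef u k).

(* Sums of absolutely summable families. *)
Definition rsum {R : realType} {I : choiceType} (a : I -> R) : R :=
  fine (\esum_(i in [set: I]) (a^\+ i)%:E)
    - fine (\esum_(i in [set: I]) (a^\- i)%:E).

Definition csum {R : realType} {I : choiceType} (a : I -> R[i]) : R[i] :=
  rsum (fun i => Re (a i)) +i* rsum (fun i => Im (a i)).

Definition bracket {R : realType} (k : freq) : R :=
  Num.sqrt (1 + k.1%:~R ^+ 2 + k.2%:~R ^+ 2).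

Definition AFx {R : realType} (S : R) (u : torus_distribution R) : \bar R :=
  \esum_(k in [set k : freq * freq | (k.1 + k.2).1 != 0])
    (bracket (k.1 + k.2) `^ (- S) * normc (coef u k.1 * coef u k.2))%:E.

Definition xne0_square {R : realType} (u : torus_distribution R) : torus_distribution R :=
  dist_of_coef (fun k => if k.1 == 0 then 0 else
    csum (fun k1 : freq => coef u k1 * coef u (k - k1))).

Definition weak_singular_solution {R : realType} (d : nat) (kappa : R)
    (u : torus_distribution R) : Prop :=
  [/\ real_dist u,
      xne0_proj u = u,
      exists2 S' : R, 0 < S' & (AFx S' u < +oo)%E &
      forall phi, smooth phi ->
        u (fun z => (-1) ^+ (d.+1)./2 * iter d dx phi z
                      + kappa%:C * dx_inv (dy (dy phi)) z)
          + xne0_square u (dx phi) = 0].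

(* The distribution u is a function in L^p. *)
Definition in_Lp {R : realType} (p : R) (u : torus_distribution R) : Prop :=
  exists f : R * R -> R[i],
    [/\ measurable_fun square (fun z => Re (f z)),
        measurable_fun square (fun z => Im (f z)),
        (\int[plane_measure]_(z in square) (normc (f z) `^ p)%:E < +oo)%E &
        forall phi, smooth phi -> u phi = torus_int (fun z => f z * phi z)].

Definition in_Hs {R : realType} (s : R) (u : torus_distribution R) : Prop :=
  (\esum_(k in [set: freq])
     ((1 + k.1%:~R ^+ 2 + k.2%:~R ^+ 2) `^ s * normc (coef u k) ^+ 2)%:E
   < +oo)%E.

Definition in_Hs0 {R : realType} (s : R) (u : torus_distribution R) : Prop :=
  (\esum_(k in [set: freq])
     ((1 + k.1%:~R ^+ 2) `^ s * normc (coef u k) ^+ 2)%:E < +oo)%E.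

(* The distributional derivative of u in y does not vanish. *)
Definition depends_on_y {R : realType} (u : torus_distribution R) : Prop :=
  exists2 phi, smooth phi & u (dy phi) != 0.

(* Main.v *)
Require Import Defs.
From mathcomp Require Import all_boot all_order all_algebra.
From mathcomp Require Import all_classical all_reals all_analysis.
From mathcomp Require Import measurable_realfun complex ring lra zify.
Import Order.TTheory GRing.Theory Num.Theory numFieldNormedType.Exports.
Set Implicit Arguments.
Unset Strict Implicit.
Unset Printing Implicit Defensive.
Local Open Scope classical_set_scope.
Local Open Scope ring_scope.
Local Open Scope complex_scope.

Local Notation Re := complex.Re.
Local Notation Im := complex.Im.
Local Notation normc := ComplexField.Normc.normc.
Local Notation plane_measure := (lebesgue_measure \x lebesgue_measure)%E.

(** The solutions are travelling waves u(x, y) = F(a x + y), one for each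
    positive integer a. Write F(t) = sum_{n >= 1} 2 c_n cos(2 pi n t). Then u has
    the Fourier coefficient c_n at the frequencies (n a, n) and (- n a, - n) and
    no other, so that u satisfies the equation exactly when, for all n >= 1,
      lambda_n c_n = (n-th Fourier coefficient of F^2),
      lambda_n = (2 pi n a)^(d-1) - kappa / a^2.
    Whatever the sign of kappa, lambda_n >= n (n + 1). In particular a sequence
    of finite energy sum lambda_n c_n^2 is absolutely summable: its wave is a
    bounded continuous function, hence in every L^p and every H^(-sigma), and
    AF is at most the square of the sum of the absolute values of the
    coefficients.

    A nonzero solution of this system is found by maximizing the cubic
    functional, the mean of F^3, over the sequences of energy at most 1. This set
    is compact for pointwise convergence ([energy_ball_compact]), and the
    functional is continuous on it because the tails of the series are uniformly
    small there ([energy_le_tail], [cubic_continuous]). The maximum M is positive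
    since (cos t + cos 2t)^3 has a positive mean ([cubic_pos]). Moving one
    coefficient at a time gives the Euler-Lagrange equation
    (F^2)^(n) = (M / 2) lambda_n c_n ([euler_lagrange]), and multiplying c by
    2 / M removes the factor ([exists_profile]). The mean is taken over the torus
    throughout, so that no integral in one variable is needed for F.

    The projections, the square and the inverse derivative in the definition of
    a weak solution are chosen among the objects with prescribed Fourier
    coefficients, so uniqueness of Fourier coefficients has to be proved. The
    convolutions of a smooth function with the normalized powers of
    2 + cos 2 pi x + cos 2 pi y are trigonometric polynomials, and they converge
    uniformly to the function, together with all derivatives ([approxim_unif],
    [approxim_smooth]). Hence a distribution, and a smooth function, is
    determined by its coefficients ([dist_coef_inj], [smooth_coef_inj]). The
    inverse derivative of f turns out to be the integral over 0 <= t <= 1 of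
    (t - 1/2) f(x + t, y) ([dx_invE]).

    Finally the defect in the weak equation is a distribution of the test
    function, whose coefficients vanish by the equation for c; so it is zero
    ([weak_equation]). Waves with different a are different, because the
    frequencies of u lie on the line through (a, 1). *)

(** * Continuous real functions *)

Section ContinuousOps.
Context {R : realType} {T : topologicalType}.
Implicit Types f g : T -> R.

Lemma ctsD f g : continuous f -> continuous g -> continuous (fun x => f x + g x).
Proof. by move=> cf cg x; exact: (cvgD (cf x) (cg x)). Qed.

Lemma ctsM f g : continuous f -> continuous g -> continuous (fun x => f x * g x).
Proof. by move=> cf cg x; exact: (cvgM (cf x) (cg x)). Qed.

Lemma ctsN f : continuous f -> continuous (fun x => - f x).
Proof. by move=> cf x; exact: (cvgN (cf x)). Qed.

Lemma ctsB f g : continuous f -> continuous g -> continuous (fun x => f x - g x).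
Proof. by move=> cf cg x; exact: (cvgB (cf x) (cg x)). Qed.

Lemma cts_cst (r : R) : continuous (fun _ : T => r).
Proof. by move=> x; exact: cvg_cst. Qed.

Lemma ctsZ (r : R) f : continuous f -> continuous (fun x => r * f x).
Proof. by move=> cf; apply: ctsM => //; exact: cts_cst. Qed.

Lemma cts_norm f : continuous f -> continuous (fun x => `|f x|).
Proof. by move=> cf x; exact: (cvg_norm (cf x)). Qed.

Lemma ctsX f n : continuous f -> continuous (fun x => f x ^+ n).
Proof.
move=> cf x; apply: (@continuous_comp _ _ _ f (fun x => x ^+ n)); first exact: cf.
exact: exprn_continuous.
Qed.

End ContinuousOps.

(** * Integration of continuous functions over the torus *)

Section TorusIntegral.
Context {R : realType}.
Implicit Types f g : R * R -> R.

(** The product sigma-algebra contains the open sets of the plane: an open set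
    is the union of the squares with rational centre and radius 1/(n+1) that it
    contains. *)
Lemma open_plane_measurable (U : set (R * R)) : open U -> measurable U.
Proof.
move=> oU.
pose F (i : rat * rat * nat) : set (R * R) :=
  let B := ball (ratr i.1.1 : R) (i.2.+1%:R^-1) `*`
           ball (ratr i.1.2 : R) (i.2.+1%:R^-1) in
  if `[< B `<=` U >] then B else set0.
have -> : U = \bigcup_i F i.
  apply/seteqP; split => [z Uz|z [i _]]; last first.
    by rewrite /F; case: asboolP => // BU /BU.
  have [e /= e0 eU] : exists2 e : R, 0 < e & ball z e `<=` U.
    by rewrite openE in oU; have /nbhs_ballP[e e0] := oU _ Uz; exists e.
  have [n ne] : exists n : nat, n.+1%:R^-1 < e / 2.
    exists (Num.truncn (e / 2)^-1).
    rewrite invf_plt ?posrE ?divr_gt0//.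
    exact: truncnS_gt.
  have n0 : 0 < n.+1%:R^-1 :> R by rewrite invr_gt0.
  have := @dense_rat R (ball z.1 n.+1%:R^-1)
     (ex_intro _ z.1 (ballxx _ n0)) (@ball_open _ R^o _ _).
  move=> -[p /= [pz [p0 _ p0p]]]; subst.
  have := @dense_rat R (ball z.2 n.+1%:R^-1)
     (ex_intro _ z.2 (ballxx _ n0)) (@ball_open _ R^o _ _).
  move=> -[q /= [qz [q0 _ q0q]]]; subst.
  have BU : ball (ratr p0 : R) n.+1%:R^-1 `*` ball (ratr q0 : R) n.+1%:R^-1
      `<=` U.
    move=> t [t1 t2]; apply: eU; split => /=.
    - apply: (@le_ball _ _ _ (n.+1%:R^-1 + n.+1%:R^-1)).
        by rewrite (splitr e) lerD// ltW.
      exact: ball_triangle pz t1.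
    - apply: (@le_ball _ _ _ (n.+1%:R^-1 + n.+1%:R^-1)).
        by rewrite (splitr e) lerD// ltW.
      exact: ball_triangle qz t2.
  exists (p0, q0, n) => //; rewrite /F /=; case: asboolP => // _.
  by split; apply: ball_sym.
apply: countable_bigcupT_measurable => // i.
rewrite /F; case: asboolP => // _.
by apply: measurableX; exact: measurable_ball.
Qed.

Lemma continuous_plane_measurable f (D : set (R * R)) :
  measurable D -> continuous f -> measurable_fun D f.
Proof.
move=> mD cf; apply: (measurable_funS measurableT) => //.
apply: (measurability _ (RGenOpens.measurableE R)).
move=> _ [_ [a [b ->] <-]]; apply: measurableI => //.
apply: open_plane_measurable.
by move/continuousP: cf; apply; exact: interval_open.
Qed.

Lemma measurable_square : measurable (square : set (measurableTypeR R * measurableTypeR R)).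
Proof. exact: measurableX. Qed.

Lemma measure_square : plane_measure (square : set (R * R)) = 1%E.
Proof.
rewrite /square product_measure1E//= !lebesgue_measure_itv/= lte01 -!EFinD.
by rewrite subr0 mule1.
Qed.

Lemma continuous_bounded_square f : continuous f ->
  exists2 M : R, 0 <= M & forall z, square z -> `|f z| <= M.
Proof.
move=> cf.
have cK : compact (`[0, 1]%classic `*` `[0, 1]%classic : set (R * R)).
  by apply: compact_setX; exact: segment_compact.
have K0 : (`[0, 1]%classic `*` `[0, 1]%classic : set (R * R)) !=set0.
  by exists (0, 0); split; rewrite /= in_itv /= lexx ler01.
have cnf : continuous (fun z => `|f z|).
  by move=> z; apply: cvg_norm; exact: cf.
have [c _ cmax] := compact_EVT_max K0 cK (continuous_subspaceT cnf).
exists `|f c| => // z [z1 z2]; apply: cmax; rewrite inE; split.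
- by move: z1; rewrite /= !in_itv /= => /andP[-> /ltW ->].
- by move: z2; rewrite /= !in_itv /= => /andP[-> /ltW ->].
Qed.

Lemma continuous_integrable_square f : continuous f ->
  plane_measure.-integrable square (EFin \o f).
Proof.
move=> cf; apply: measurable_bounded_integrable.
- exact: measurable_square.
- by change (plane_measure (square : set (R * R)) < +oo)%E;
    rewrite measure_square ltry.
- exact: continuous_plane_measurable measurable_square cf.
- have [M M0 fM] := continuous_bounded_square cf.
  exists M; split; first exact: num_real.
  by move=> x Mx z /= /fM /le_trans; apply; exact: ltW.
Qed.

(** The mean of a real function over the torus. *)
Definition tint f : R := \int[plane_measure]_(z in square) f z.

Lemma eq_tint f g : f =1 g -> tint f = tint g.
Proof. by move=> fg; apply: eq_Rintegral => z _; exact: fg. Qed.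

Lemma tintD f g : continuous f -> continuous g ->
  tint (fun z => f z + g z) = tint f + tint g.
Proof.
by move=> cf cg; apply: RintegralD; first exact: measurable_square;
  exact: continuous_integrable_square.
Qed.

Lemma tintZ (r : R) f : continuous f -> tint (fun z => r * f z) = r * tint f.
Proof.
by move=> cf; apply: RintegralZl; first exact: measurable_square;
  exact: continuous_integrable_square.
Qed.

Lemma tintN f : continuous f -> tint (fun z => - f z) = - tint f.
Proof.
by move=> cf; rewrite -mulN1r -tintZ//; apply: eq_tint => z; rewrite mulN1r.
Qed.

Lemma tintB f g : continuous f -> continuous g ->
  tint (fun z => f z - g z) = tint f - tint g.
Proof.
by move=> cf cg; apply: RintegralB; first exact: measurable_square;
  exact: continuous_integrable_square.
Qed.

Lemma tint_cst (r : R) : tint (fun=> r) = r.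
Proof.
rewrite /tint Rintegral_cst; last exact: measurable_square.
by have := measure_square => /= ->; rewrite mulr1.
Qed.

Lemma le_tint f g : continuous f -> continuous g ->
  (forall z, square z -> f z <= g z) -> tint f <= tint g.
Proof.
by move=> cf cg fg; apply: le_Rintegral => //; first exact: measurable_square;
  exact: continuous_integrable_square.
Qed.

Lemma normr_tint f (M : R) : continuous f ->
  (forall z, square z -> `|f z| <= M) -> `|tint f| <= M.
Proof.
move=> cf fM; rewrite ler_norml -[X in - X]tint_cst -[M in _ && (_ <= M)]tint_cst.
rewrite -tintN; last by move=> z; exact: cvg_cst.
by apply/andP; split; apply: le_tint => //;
  (try by move=> z; exact: cvg_cst) => z /fM; rewrite ler_norml => /andP[].
Qed.

Lemma tint_fubini f : continuous f ->
  tint f = fine (\int[lebesgue_measure]_(y in `[0%R, 1%R[)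
             \int[lebesgue_measure]_(x in `[0%R, 1%R[) (f (x, y))%:E)%E /\
  tint f = fine (\int[lebesgue_measure]_(x in `[0%R, 1%R[)
             \int[lebesgue_measure]_(y in `[0%R, 1%R[) (f (x, y))%:E)%E.
Proof.
move=> cf; have fi := continuous_integrable_square cf.
have fi' : plane_measure.-integrable setT ((EFin \o f) \_ square).
  have H := (iffLR (integrable_mkcond _ measurable_square) fi). done.
rewrite /tint /Rintegral integral_mkcond; split; congr fine.
- rewrite -(integral21_prod_meas1 fi') [RHS]integral_mkcond.
  apply: eq_integral => y _; rewrite /fubini_G patchE.
  case: ifPn => yI.
    rewrite [RHS]integral_mkcond; apply: eq_integral => x _.
    rewrite !patchE; congr (if _ then _ else _).
    apply/idP/idP => [/set_mem [? _]|/set_mem ?]; apply/mem_set => //.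
    by split => //; exact: set_mem yI.
  rewrite integral0_eq// => x _; rewrite patchE; case: ifPn => //.
  by rewrite inE => -[_ /=]; rewrite notin_setE in yI.
- rewrite -(integral12_prod_meas1 fi') [RHS]integral_mkcond.
  apply: eq_integral => x _; rewrite /fubini_F patchE.
  case: ifPn => xI.
    rewrite [RHS]integral_mkcond; apply: eq_integral => y _.
    rewrite !patchE; congr (if _ then _ else _).
    apply/idP/idP => [/set_mem [_ ?]|/set_mem ?]; apply/mem_set => //.
    by split => //; exact: set_mem xI.
  rewrite integral0_eq// => y _; rewrite patchE; case: ifPn => //.
  by rewrite inE => -[/= xI' _]; rewrite notin_setE in xI.
Qed.

Lemma integral_derive1_unit (h H : R -> R) : continuous h ->
  (forall x, derivable H x 1) -> (forall x, derive1 H x = h x) ->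
  (\int[lebesgue_measure]_(x in `[0%R, 1%R[) (h x)%:E = (H 1 - H 0)%:E)%E.
Proof.
move=> ch dH Hh; rewrite integral_itv_bndo_bndc; last first.
  by apply/measurable_EFinP; apply: (measurable_funS measurableT) => //;
    exact: continuous_measurable_fun.
rewrite (@continuous_FTC2 _ h H) ?EFinB//.
- exact: continuous_subspaceT.
- split => //.
  + by apply: cvg_at_right_filter; apply: differentiable_continuous;
      exact/derivable1_diffP.
  + by apply: cvg_at_left_filter; apply: differentiable_continuous;
      exact/derivable1_diffP.
Qed.

Lemma continuous_fst_slice f y : continuous f -> continuous (fun x => f (x, y)).
Proof.
move=> cf x; apply: (@cvg_comp _ _ _ (fun x => (x, y)) f); last exact: cf.
exact: (cvg_pair cvg_id (cvg_cst _)).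
Qed.

Lemma continuous_snd_slice f x : continuous f -> continuous (fun y => f (x, y)).
Proof.
move=> cf y; apply: (@cvg_comp _ _ _ (fun y => (x, y)) f); last exact: cf.
exact: (cvg_pair (cvg_cst _) cvg_id).
Qed.

Lemma continuous_of_fst (h : R -> R) :
  continuous h -> continuous (fun z : R * R => h z.1).
Proof.
by move=> ch z; apply: (@continuous_comp _ _ _ fst h); [exact: cvg_fst|exact: ch].
Qed.

Lemma continuous_of_snd (h : R -> R) :
  continuous h -> continuous (fun z : R * R => h z.2).
Proof.
by move=> ch z; apply: (@continuous_comp _ _ _ snd h); [exact: cvg_snd|exact: ch].
Qed.

(** The fundamental theorem of calculus in the first variable, under the
    integral. The function [g] need not be periodic. *)
Lemma tint_dx f g : continuous f -> continuous g ->
  (forall z, derivable (fun s => g (s, z.2)) z.1 1) ->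
  (forall z, derive1 (fun s => g (s, z.2)) z.1 = f z) ->
  tint f = tint (fun z => g (1, z.2) - g (0, z.2)).
Proof.
move=> cf cg dg gf.
have cb : continuous (fun z : R * R => g (1, z.2) - g (0, z.2)).
  have cb1 : continuous (fun y => g (1, y) - g (0, y)).
    by move=> y; apply: cvgB; exact: continuous_snd_slice.
  exact: continuous_of_snd cb1.
rewrite (tint_fubini cf).1 (tint_fubini cb).1; congr fine.
apply: eq_integral => y _.
rewrite (@integral_derive1_unit _ (fun x => g (x, y)))/=.
- rewrite integral_cst//= lebesgue_measure_itv/= lte01 -EFinD subr0 mule1.
  by [].
- exact: continuous_fst_slice.
- by move=> x; exact: (dg (x, y)).
- by move=> x; exact: (gf (x, y)).
Qed.

Lemma tint_dy f g : continuous f -> continuous g ->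
  (forall z, derivable (fun s => g (z.1, s)) z.2 1) ->
  (forall z, derive1 (fun s => g (z.1, s)) z.2 = f z) ->
  tint f = tint (fun z => g (z.1, 1) - g (z.1, 0)).
Proof.
move=> cf cg dg gf.
have cb : continuous (fun z : R * R => g (z.1, 1) - g (z.1, 0)).
  have cb1 : continuous (fun x => g (x, 1) - g (x, 0)).
    by move=> x; apply: cvgB; exact: continuous_fst_slice.
  exact: continuous_of_fst cb1.
rewrite (tint_fubini cf).2 (tint_fubini cb).2; congr fine.
apply: eq_integral => x _.
rewrite (@integral_derive1_unit _ (fun y => g (x, y)))/=.
- rewrite integral_cst//= lebesgue_measure_itv/= lte01 -EFinD subr0 mule1.
  by [].
- exact: continuous_snd_slice.
- by move=> y; exact: (dg (x, y)).
- by move=> y; exact: (gf (x, y)).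
Qed.

End TorusIntegral.

(** * Smooth real functions on the torus *)

Section RealSmooth.
Context {R : realType}.
Implicit Types (f g : R * R -> R) (w : seq bool) (x y s t : R).

(** Partial derivatives of a real function, and iterated ones along a word. *)
Definition pdx g (z : R * R) : R := derive1 (fun s => g (s, z.2)) z.1.
Definition pdy g (z : R * R) : R := derive1 (fun s => g (z.1, s)) z.2.

Definition pdw w g : R * R -> R :=
  foldr (fun b h => if b then pdx h else pdy h) g w.

Definition derivable_xy g := forall z : R * R,
  derivable (fun s => g (s, z.2)) z.1 1 /\ derivable (fun s => g (z.1, s)) z.2 1.

(** Smooth periodic real functions. A complex function is smooth exactly when
    its real and imaginary parts are ([smoothP]). *)
Record rsmooth g : Prop := RSmooth {
  rsmooth_px : forall x y, g (x + 1, y) = g (x, y);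
  rsmooth_py : forall x y, g (x, y + 1) = g (x, y);
  rsmooth_cont : forall w, continuous (pdw w g);
  rsmooth_der : forall w, derivable_xy (pdw w g)
}.

Lemma Re_dword w (f : R * R -> R[i]) :
  (fun z => Re (dword w f z)) = pdw w (fun z => Re (f z)).
Proof.
elim: w => //= b w IH; case: b; apply/funext => z /=.
- by rewrite -IH.
- by rewrite -IH.
Qed.

Lemma Im_dword w (f : R * R -> R[i]) :
  (fun z => Im (dword w f z)) = pdw w (fun z => Im (f z)).
Proof.
elim: w => //= b w IH; case: b; apply/funext => z /=.
- by rewrite -IH.
- by rewrite -IH.
Qed.

Lemma smoothP (f : R * R -> R[i]) :
  smooth f <-> rsmooth (fun z => Re (f z)) /\ rsmooth (fun z => Im (f z)).
Proof.
split=> [[px py cR cI df]|[[pxR pyR cR dR] [pxI pyI cI dI]]].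
- split; split=> [x y|x y|w|w].
  + by rewrite px.
  + by rewrite py.
  + by rewrite -Re_dword.
  + by rewrite -Re_dword => z; case: (df w z) => d1 _ d2 _; exact (conj d1 d2).
  + by rewrite px.
  + by rewrite py.
  + by rewrite -Im_dword.
  + by rewrite -Im_dword => z; case: (df w z) => _ d1 _ d2; exact (conj d1 d2).
- split=> [x y|x y|w|w|w z].
  + by apply/eqP; rewrite eq_complex pxR pxI !eqxx.
  + by apply/eqP; rewrite eq_complex pyR pyI !eqxx.
  + by rewrite Re_dword.
  + by rewrite Im_dword.
  + have [/= x1 y1] := dR w z; have [/= x2 y2] := dI w z.
    move: x1 y1 x2 y2; rewrite -!Re_dword -!Im_dword => ? ? ? ?.
    by split.
Qed.

Lemma pdw_cat w1 w2 g : pdw (w1 ++ w2) g = pdw w1 (pdw w2 g).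
Proof. by rewrite /pdw foldr_cat. Qed.

Lemma rsmooth_continuous g : rsmooth g -> continuous g.
Proof. by move=> sg; exact: (@rsmooth_cont g sg [::]). Qed.

Lemma rsmooth_derx g x y : rsmooth g -> is_derive x 1 (fun s => g (s, y)) (pdx g (x, y)).
Proof.
move=> sg; have [d1 _] := rsmooth_der sg [::] (x, y).
by rewrite /pdx derive1E; exact: DeriveDef.
Qed.

Lemma rsmooth_dery g x y : rsmooth g -> is_derive y 1 (fun s => g (x, s)) (pdy g (x, y)).
Proof.
move=> sg; have [_ d1] := rsmooth_der sg [::] (x, y).
by rewrite /pdy derive1E; exact: DeriveDef.
Qed.

Lemma is_derive_derivable (h : R -> R) x (d : R) :
  is_derive x 1 h d -> derivable h x 1.
Proof. by case. Qed.

Lemma is_derive_derive1 (h : R -> R) x (d : R) :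
  is_derive x 1 h d -> derive1 h x = d.
Proof. by move=> H; rewrite derive1E; exact: derive_val. Qed.

Lemma pdx_is_derive g x y (d : R) :
  is_derive x 1 (fun s => g (s, y)) d -> pdx g (x, y) = d.
Proof. by move=> h; rewrite /pdx derive1E; exact: derive_val. Qed.

Lemma pdy_is_derive g x y (d : R) :
  is_derive y 1 (fun s => g (x, s)) d -> pdy g (x, y) = d.
Proof. by move=> h; rewrite /pdy derive1E; exact: derive_val. Qed.

Lemma derive1_periodic (h : R -> R) :
  (forall s, derivable h s 1) -> (forall s, h (s + 1) = h s) ->
  forall s, derive1 h (s + 1) = derive1 h s.
Proof.
move=> dh ph s; rewrite !derive1E.
have dI : is_derive s 1 (fun s : R => s + 1) 1.
  by apply: is_derive_eq; rewrite addr0.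
have dh1 : is_derive (s + 1) 1 h ('D_1 h (s + 1)) by exact: DeriveDef.
have := @is_derive1_comp _ h (fun s => s + 1) s _ _ dh1 dI.
have -> : h \o (fun s => s + 1) = h by apply/funext => t /=; exact: ph.
by move=> dd; rewrite -[LHS]mulr1; apply/esym; exact: derive_val.
Qed.

Lemma pdw_periodic w g : rsmooth g ->
  (forall x y, pdw w g (x + 1, y) = pdw w g (x, y)) /\
  (forall x y, pdw w g (x, y + 1) = pdw w g (x, y)).
Proof.
move=> sg; elim: w => [|[] w [IHx IHy]] /=.
- by split; [exact: rsmooth_px|exact: rsmooth_py].
- split=> x y; rewrite /pdx /=.
  + apply: derive1_periodic => s.
    * exact (proj1 (rsmooth_der sg w (s, y))).
    * exact: IHx.
  + by congr (derive1 _ _); apply/funext => s; exact: IHy.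
- split=> x y; rewrite /pdy /=.
  + by congr (derive1 _ _); apply/funext => s; exact: IHx.
  + apply: derive1_periodic => s.
    * exact (proj2 (rsmooth_der sg w (x, s))).
    * exact: IHy.
Qed.

Lemma rsmooth_pdw w g : rsmooth g -> rsmooth (pdw w g).
Proof.
move=> sg; have [px py] := pdw_periodic w sg; split=> // v; rewrite -pdw_cat.
- exact: rsmooth_cont.
- exact: rsmooth_der.
Qed.

Lemma rsmooth_pdx g : rsmooth g -> rsmooth (pdx g).
Proof. exact: (@rsmooth_pdw [:: true]). Qed.

Lemma rsmooth_pdy g : rsmooth g -> rsmooth (pdy g).
Proof. exact: (@rsmooth_pdw [:: false]). Qed.

(** A function is smooth as soon as each word of derivatives is taken from a
    family of continuous functions closed under both partial derivatives. *)
Lemma rsmooth_class (P : (R * R -> R) -> Prop) g :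
  (forall h, P h -> [/\ continuous h, derivable_xy h, P (pdx h) & P (pdy h)]) ->
  (forall x y, g (x + 1, y) = g (x, y)) ->
  (forall x y, g (x, y + 1) = g (x, y)) -> P g -> rsmooth g.
Proof.
move=> HP px py Pg.
have Pw w : P (pdw w g).
  by elim: w => //= b w /HP[_ _ ? ?]; case: b.
by split=> // w; have [] := HP _ (Pw w).
Qed.

Lemma is_derive_lin (h k : R -> R) (a b x dh dk : R) :
  is_derive x 1 h dh -> is_derive x 1 k dk ->
  is_derive x 1 (fun s => a * h s + b * k s) (a * dh + b * dk).
Proof.
by move=> ? ?; apply: (@is_derive_eq _ _ _ _ _ _ (a *: dh + b *: dk)).
Qed.

Lemma pdw_lin w g h (a b : R) : rsmooth g -> rsmooth h ->
  pdw w (fun z => a * g z + b * h z) =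
  (fun z => a * pdw w g z + b * pdw w h z).
Proof.
move=> sg sh; elim: w => //= c w ->.
have sg' := rsmooth_pdw w sg; have sh' := rsmooth_pdw w sh.
case: c; apply/funext => -[x y].
- by apply: pdx_is_derive; apply: is_derive_lin; exact: rsmooth_derx.
- by apply: pdy_is_derive; apply: is_derive_lin; exact: rsmooth_dery.
Qed.

Lemma continuous_lin g h (a b : R) : continuous g -> continuous h ->
  continuous (fun z => a * g z + b * h z).
Proof.
move=> cg ch z; apply: cvgD; apply: cvgM; (try exact: cvg_cst).
- exact: cg.
- exact: ch.
Qed.

Lemma rsmooth_lin g h (a b : R) : rsmooth g -> rsmooth h ->
  rsmooth (fun z => a * g z + b * h z).
Proof.
move=> sg sh; split=> [x y|x y|w|w].
- by rewrite (rsmooth_px sg) (rsmooth_px sh).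
- by rewrite (rsmooth_py sg) (rsmooth_py sh).
- by rewrite pdw_lin//; apply: continuous_lin; exact: rsmooth_cont.
- rewrite pdw_lin// => -[x y]; split; apply: is_derive_derivable; apply: is_derive_lin;
    by [apply: rsmooth_derx; exact: rsmooth_pdw
       |apply: rsmooth_dery; exact: rsmooth_pdw].
Qed.

Lemma rsmooth_cst (c : R) : rsmooth (fun=> c).
Proof.
apply: (@rsmooth_class (fun h => exists c, h = fun=> c)) => //; last by exists c.
move=> _ [{}c ->]; split.
- by move=> z; exact: cvg_cst.
- by move=> z; split; exact: derivable_cst.
- by exists 0; apply/funext => z; rewrite /pdx derive1_cst.
- by exists 0; apply/funext => z; rewrite /pdy derive1_cst.
Qed.

(** The argument of the character of frequency [k], and the real trigonometric
    monomials of that frequency. *)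
Definition phase (k : freq) (z : R * R) : R :=
  2 * pi * (k.1%:~R * z.1 + k.2%:~R * z.2).

Definition trig (k : freq) (a b : R) (z : R * R) : R :=
  a * cos (phase k z) + b * sin (phase k z).

Lemma continuous_phase k : continuous (phase k).
Proof.
move=> z; apply: cvgM; first exact: cvg_cst.
apply: cvgD; (apply: cvgM; first exact: cvg_cst).
- exact: cvg_fst.
- exact: cvg_snd.
Qed.

Lemma continuous_cos_phase k : continuous (fun z => cos (phase k z)).
Proof.
move=> z; apply: (@continuous_comp _ _ _ (phase k) cos).
- exact: continuous_phase.
- exact: continuous_cos.
Qed.

Lemma continuous_sin_phase k : continuous (fun z => sin (phase k z)).
Proof.
move=> z; apply: (@continuous_comp _ _ _ (phase k) sin).
- exact: continuous_phase.
- exact: continuous_sin.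
Qed.

Lemma continuous_trig k a b : continuous (trig k a b).
Proof.
by apply: continuous_lin; [exact: continuous_cos_phase|exact: continuous_sin_phase].
Qed.

Lemma is_derive_trig (a b p q x : R) :
  is_derive x 1 (fun s => a * cos (p * s + q) + b * sin (p * s + q))
    (p * b * cos (p * x + q) + - (p * a) * sin (p * x + q)).
Proof.
have dI : is_derive x 1 (fun s : R => p * s + q) p.
  by apply: is_derive_eq; rewrite addr0 /GRing.scale /= mulr1.
have dc := @is_derive1_comp _ cos (fun s => p * s + q) _ _ _ (is_derive_cos (p * x + q)) dI.
have ds := @is_derive1_comp _ sin (fun s => p * s + q) _ _ _ (is_derive_sin (p * x + q)) dI.
apply: is_derive_eq (is_derive_lin a b dc ds) _.
ring.
Qed.

Lemma is_derivex_trig k a b x y :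
  is_derive x 1 (fun s => trig k a b (s, y))
    (trig k (2 * pi * k.1%:~R * b) (- (2 * pi * k.1%:~R * a)) (x, y)).
Proof.
have H t : phase k (t, y) = 2 * pi * k.1%:~R * t + 2 * pi * k.2%:~R * y.
  by rewrite /phase /=; ring.
rewrite /trig H; under eq_fun do rewrite H.
exact: is_derive_trig.
Qed.

Lemma is_derivey_trig k a b x y :
  is_derive y 1 (fun s => trig k a b (x, s))
    (trig k (2 * pi * k.2%:~R * b) (- (2 * pi * k.2%:~R * a)) (x, y)).
Proof.
have H t : phase k (x, t) = 2 * pi * k.2%:~R * t + 2 * pi * k.1%:~R * x.
  by rewrite /phase /=; ring.
rewrite /trig H; under eq_fun do rewrite H.
exact: is_derive_trig.
Qed.

Lemma pdx_trig k a b : pdx (trig k a b) =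
  trig k (2 * pi * k.1%:~R * b) (- (2 * pi * k.1%:~R * a)).
Proof. by apply/funext => -[x y]; exact: pdx_is_derive (is_derivex_trig _ _ _ _ _). Qed.

Lemma pdy_trig k a b : pdy (trig k a b) =
  trig k (2 * pi * k.2%:~R * b) (- (2 * pi * k.2%:~R * a)).
Proof. by apply/funext => -[x y]; exact: pdy_is_derive (is_derivey_trig _ _ _ _ _). Qed.

Lemma periodic_int (T : Type) (h : R -> T) (P : R) :
  (forall t, h (t + P) = h t) -> forall t (n : int), h (t + P * n%:~R) = h t.
Proof.
move=> hP; have H (m : nat) s : h (s + P * m%:R) = h s.
  elim: m s => [|m IH] s; first by rewrite mulr0 addr0.
  by rewrite -(IH s) -[RHS]hP; congr h; rewrite -natr1; ring.
move=> t [n|n]; first exact: H.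
by rewrite NegzE mulrNz mulrN -[in RHS](subrK (P * n.+1%:R) t) H.
Qed.

Lemma cosD2piZ (t : R) (n : int) : cos (t + 2 * pi * n%:~R) = cos t.
Proof.
apply: periodic_int => s; rewrite -[RHS]cosD2pi; congr cos.
by rewrite mulr2n; ring.
Qed.

Lemma sinD2piZ (t : R) (n : int) : sin (t + 2 * pi * n%:~R) = sin t.
Proof.
apply: periodic_int => s; rewrite -[RHS]sinD2pi; congr sin.
by rewrite mulr2n; ring.
Qed.

Lemma rsmooth_trig k a b : rsmooth (trig k a b).
Proof.
apply: (@rsmooth_class (fun h => exists a b, h = trig k a b)); last by exists a, b.
- move=> _ [{}a [{}b ->]]; split.
  + exact: continuous_trig.
  + move=> -[x y]; split => /=.
    * exact: is_derive_derivable (is_derivex_trig _ _ _ _ _).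
    * exact: is_derive_derivable (is_derivey_trig _ _ _ _ _).
  + by rewrite pdx_trig; do 2 eexists.
  + by rewrite pdy_trig; do 2 eexists.
- move=> x y; rewrite /trig.
  have -> : phase k (x + 1, y) = phase k (x, y) + 2 * pi * k.1%:~R.
    by rewrite /phase /=; ring.
  by rewrite cosD2piZ sinD2piZ.
- move=> x y; rewrite /trig.
  have -> : phase k (x, y + 1) = phase k (x, y) + 2 * pi * k.2%:~R.
    by rewrite /phase /=; ring.
  by rewrite cosD2piZ sinD2piZ.
Qed.

(** Periodic functions attain all their values on the square. *)
Lemma periodic_square (T : Type) (h : R * R -> T) :
  (forall x y, h (x + 1, y) = h (x, y)) ->
  (forall x y, h (x, y + 1) = h (x, y)) ->
  forall z, exists2 z', square z' & h z = h z' /\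
    exists n : int * int, z = (z'.1 + n.1%:~R, z'.2 + n.2%:~R).
Proof.
move=> px py [x y].
pose fr (t : R) := t - (Num.floor t)%:~R.
have frI t : `[0%R, 1%R[%classic (fr t).
  rewrite /= in_itv /= /fr subr_ge0 floor_le ltrBlDr.
  by have := floorD1_gt t; rewrite intrD addrC.
have E t : t = fr t + (Num.floor t)%:~R by rewrite subrK.
exists (fr x, fr y); first by split; exact: frI.
split; last by exists (Num.floor x, Num.floor y); rewrite -!E.
have := @periodic_int _ (fun s => h (s, y)) 1 (fun s => px s y) (fr x) (Num.floor x).
rewrite mul1r -E => ->.
have := @periodic_int _ (fun s => h (fr x, s)) 1 (fun s => py (fr x) s) (fr y) (Num.floor y).
by rewrite mul1r -E => ->.
Qed.

Lemma rsmooth_bounded g : rsmooth g -> exists2 M : R, 0 <= M & forall z, `|g z| <= M.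
Proof.
move=> sg; have [M M0 gM] := continuous_bounded_square (rsmooth_continuous sg).
exists M => // z.
have [z' sz [-> _]] := periodic_square (rsmooth_px sg) (rsmooth_py sg) z.
exact: gM.
Qed.

Lemma lipschitz_of_derive (h dh : R -> R) (L : R) :
  (forall x, is_derive x 1 h (dh x)) -> (forall x, `|dh x| <= L) ->
  forall x y, `|h x - h y| <= L * `|x - y|.
Proof.
move=> dh1 dL.
have H x y : y < x -> `|h x - h y| <= L * `|x - y|.
  move=> yx.
  have ch : {within `[y, x], continuous h}.
    apply: continuous_subspaceT => t; apply: differentiable_continuous.
    apply/derivable1_diffP; exact: is_derive_derivable (dh1 t).
  have [c _ ->] := MVT yx (fun t _ => dh1 t) ch.
  by rewrite normrM ler_wpM2r.
move=> x y; have [/H //|/H|->] := ltgtP y x.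
- by rewrite distrC [X in _ * X]distrC.
- by rewrite !subrr normr0 mulr0.
Qed.

Lemma rsmooth_lipschitz g : rsmooth g -> exists2 L : R, 0 <= L &
  (forall x x' y, `|g (x, y) - g (x', y)| <= L * `|x - x'|) /\
  (forall x y y', `|g (x, y) - g (x, y')| <= L * `|y - y'|).
Proof.
move=> sg.
have [L1 L10 b1] := rsmooth_bounded (rsmooth_pdx sg).
have [L2 L20 b2] := rsmooth_bounded (rsmooth_pdy sg).
exists (L1 + L2); first exact: addr_ge0.
split=> [x x' y|x y y'].
- apply: (@le_trans _ _ (L1 * `|x - x'|)); last by rewrite ler_wpM2r// lerDl.
  apply: (@lipschitz_of_derive (fun s => g (s, y)) (fun s => pdx g (s, y))) => // s.
  exact: rsmooth_derx.
- apply: (@le_trans _ _ (L2 * `|y - y'|)); last by rewrite ler_wpM2r// lerDr.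
  apply: (@lipschitz_of_derive (fun s => g (x, s)) (fun s => pdy g (x, s))) => // s.
  exact: rsmooth_dery.
Qed.

(** Integration by parts on the torus. *)
Lemma tint_ibpx g h : rsmooth g -> rsmooth h ->
  tint (fun z => pdx g z * h z) = - tint (fun z => g z * pdx h z).
Proof.
move=> sg sh.
have cM p q : rsmooth p -> rsmooth q -> continuous (fun z => p z * q z).
  by move=> sp sq z; apply: cvgM; exact: rsmooth_continuous.
have sg' := rsmooth_pdx sg; have sh' := rsmooth_pdx sh.
apply/eqP; rewrite -addr_eq0 -tintD; try exact: cM.
have D x y : is_derive x 1 (fun s => g (s, y) * h (s, y))
    (pdx g (x, y) * h (x, y) + g (x, y) * pdx h (x, y)).
  have H : is_derive x 1 (fun s => g (s, y) * h (s, y))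
      (g (x, y) *: pdx h (x, y) + h (x, y) *: pdx g (x, y)) :=
    is_deriveM (rsmooth_derx x y sg) (rsmooth_derx x y sh).
  by apply: (is_derive_eq H); rewrite /GRing.scale /= addrC [pdx g _ * _]mulrC.
rewrite (@tint_dx _ _ (fun z => g z * h z)).
- rewrite (@eq_tint _ _ (fun=> 0)) ?tint_cst// => z.
  by rewrite -[1]add0r (rsmooth_px sg) (rsmooth_px sh) subrr.
- by move=> z; apply: cvgD; exact: cM.
- exact: cM.
- by move=> [x y]; exact: is_derive_derivable (D x y).
- by move=> [x y]; exact: is_derive_derive1 (D x y).
Qed.

Lemma tint_ibpy g h : rsmooth g -> rsmooth h ->
  tint (fun z => pdy g z * h z) = - tint (fun z => g z * pdy h z).
Proof.
move=> sg sh.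
have cM p q : rsmooth p -> rsmooth q -> continuous (fun z => p z * q z).
  by move=> sp sq z; apply: cvgM; exact: rsmooth_continuous.
have sg' := rsmooth_pdy sg; have sh' := rsmooth_pdy sh.
apply/eqP; rewrite -addr_eq0 -tintD; try exact: cM.
have D x y : is_derive y 1 (fun s => g (x, s) * h (x, s))
    (pdy g (x, y) * h (x, y) + g (x, y) * pdy h (x, y)).
  have H : is_derive y 1 (fun s => g (x, s) * h (x, s))
      (g (x, y) *: pdy h (x, y) + h (x, y) *: pdy g (x, y)) :=
    is_deriveM (rsmooth_dery x y sg) (rsmooth_dery x y sh).
  by apply: (is_derive_eq H); rewrite /GRing.scale /= addrC [pdy g _ * _]mulrC.
rewrite (@tint_dy _ _ (fun z => g z * h z)).
- rewrite (@eq_tint _ _ (fun=> 0)) ?tint_cst// => z.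
  by rewrite -[1]add0r (rsmooth_py sg) (rsmooth_py sh) subrr.
- by move=> z; apply: cvgD; exact: cM.
- exact: cM.
- by move=> [x y]; exact: is_derive_derivable (D x y).
- by move=> [x y]; exact: is_derive_derive1 (D x y).
Qed.

End RealSmooth.

(** * Orthogonality of the trigonometric monomials *)

Section Orthogonality.
Context {R : realType}.

Lemma phaseD (k l : freq) (z : R * R) : phase (k + l) z = phase k z + phase l z.
Proof. by rewrite /phase /= !intrD; ring. Qed.

Lemma phaseN (k : freq) (z : R * R) : phase (- k) z = - phase k z.
Proof. by rewrite /phase /= !intrN; ring. Qed.

Lemma phase0 (z : R * R) : phase 0 z = 0.
Proof. by rewrite /phase /= !mul0r addr0 mulr0. Qed.

Lemma tint_pdx (g : R * R -> R) : rsmooth g -> tint (pdx g) = 0.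
Proof.
move=> sg; have := tint_ibpx sg (rsmooth_cst 1).
rewrite (@eq_tint _ _ (pdx g)) => [->|z]; last by rewrite mulr1.
rewrite (@eq_tint _ _ (fun=> 0)) ?tint_cst ?oppr0// => z.
by rewrite /pdx derive1_cst mulr0.
Qed.

Lemma tint_pdy (g : R * R -> R) : rsmooth g -> tint (pdy g) = 0.
Proof.
move=> sg; have := tint_ibpy sg (rsmooth_cst 1).
rewrite (@eq_tint _ _ (pdy g)) => [->|z]; last by rewrite mulr1.
rewrite (@eq_tint _ _ (fun=> 0)) ?tint_cst ?oppr0// => z.
by rewrite /pdy derive1_cst mulr0.
Qed.

Lemma tint_trig (k : freq) (a b : R) :
  tint (trig k a b) = if k == 0 then a else 0.
Proof.
have pi0 : pi != 0 :> R by rewrite gt_eqF// pi_gt0.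
have [->|k0] := eqVneq k 0.
  rewrite (@eq_tint _ _ (fun=> a)) ?tint_cst// => z.
  by rewrite /trig phase0 cos0 sin0 mulr1 mulr0 addr0.
have [k10|k10] := eqVneq k.1 0.
  have k20 : 2 * pi * k.2%:~R != 0 :> R.
    rewrite mulf_neq0 ?mulf_neq0// intr_eq0; apply: contra k0 => /eqP k20.
    by rewrite (surjective_pairing k) k10 k20.
  rewrite -(tint_pdy (@rsmooth_trig _ k (- b / (2 * pi * k.2%:~R)) (a / (2 * pi * k.2%:~R)))).
  by apply: eq_tint => z; rewrite pdy_trig; rewrite ?mulNr mulrN opprK ![_ * (_ / _)]mulrC !divfK.
have k20 : 2 * pi * k.1%:~R != 0 :> R by rewrite mulf_neq0 ?mulf_neq0// intr_eq0.
rewrite -(tint_pdx (@rsmooth_trig _ k (- b / (2 * pi * k.1%:~R)) (a / (2 * pi * k.1%:~R)))).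
by apply: eq_tint => z; rewrite pdx_trig; rewrite ?mulNr mulrN opprK ![_ * (_ / _)]mulrC !divfK.
Qed.

Lemma tint_cos (k : freq) : tint (fun z : R * R => cos (phase k z)) = (k == 0)%:R.
Proof.
rewrite (@eq_tint _ _ (trig k 1 0)) ?tint_trig; first by case: eqP.
by move=> z; rewrite /trig mul1r mul0r addr0.
Qed.

Lemma tint_sin (k : freq) : tint (fun z : R * R => sin (phase k z)) = 0.
Proof.
rewrite (@eq_tint _ _ (trig k 0 1)) ?tint_trig; first by case: eqP.
by move=> z; rewrite /trig mul1r mul0r add0r.
Qed.

End Orthogonality.

(** * Cosine series of finite energy *)

Section Series.
Context {R : realType} (e : freq).
Implicit Types (c : nat -> R) (r : R) (z : R * R).

(** The multiples of the direction [e]. *)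
Definition harm (n : int) : freq := (e.1 * n, e.2 * n).

(** The [j]-th cosine has frequency [j + 1]: the constant mode is excluded. *)
Definition cosj (j : nat) (z : R * R) : R := cos (phase (harm j.+1) z).

Definition csum_part c (n : nat) z : R := \sum_(0 <= j < n) 2 * c j * cosj j z.

(** The wave with coefficients [c]. The limit is meaningful for the sequences of
    finite energy ([cseries_cvg]). *)
Definition cseries c z : R := limn (fun n => csum_part c n z).

(** The energy of [c] with the weights [lam] is at most [r]. *)
Definition energy_le (lam : nat -> R) r c :=
  forall n, \sum_(0 <= j < n) lam j * c j ^+ 2 <= r.

(** The rate at which the tails of sequences of bounded energy decrease. *)
Definition tailb (n : nat) : R := (Num.sqrt n.+1%:R)^-1.

Lemma tailb_gt0 n : 0 < tailb n.
Proof. by rewrite invr_gt0 sqrtr_gt0 ltr0n. Qed.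

Lemma tailb_le (eps : R) : 0 < eps ->
  exists N, forall n, (N <= n)%N -> tailb n <= eps.
Proof.
move=> e0; exists (Num.truncn (eps ^- 2)) => n Nn.
rewrite /tailb invf_ple ?posrE ?sqrtr_gt0 ?ltr0n//.
have e1 : 0 <= eps^-1 by rewrite invr_ge0 ltW.
rewrite -[leLHS](ger0_norm e1) -sqrtr_sqr.
apply: ler_wsqrtr; rewrite exprVn.
apply: le_trans (ltW (truncnS_gt _)) _.
by rewrite ler_nat ltnS.
Qed.

Lemma tailb_eq0 (x A : R) N : (forall n, (N <= n)%N -> `|x| <= A * tailb n) -> x = 0.
Proof.
move=> H; apply/eqP; rewrite -normr_le0; apply/ler_addgt0Pr => eps eps0.
rewrite add0r.
have A1 : 0 < `|A| + 1 by rewrite ltr_wpDl.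
have [M HM] := tailb_le (divr_gt0 eps0 A1).
apply: le_trans (H (maxn N M) (leq_maxl _ _)) _.
apply: (@le_trans _ _ ((`|A| + 1) * tailb (maxn N M))).
  by rewrite ler_wpM2r ?(ltW (tailb_gt0 _))// (le_trans (ler_norm _))// lerDl.
by rewrite -ler_pdivlMl// mulrC HM// leq_maxr.
Qed.

Variable lam : nat -> R.
Hypothesis lam_ge : forall j, (j.+1 * j.+2)%:R <= lam j.

Let lam_gt0 j : 0 < lam j.
Proof. by apply: lt_le_trans (lam_ge j); rewrite ltr0n. Qed.

(** By the lower bound on [lam] the sum is dominated by the telescoping sum of
    1/((j+1)(j+2)). *)
Lemma inv_tail N n : (N <= n)%N ->
  \sum_(N <= j < n) (lam j)^-1 <= N.+1%:R^-1 - n.+1%:R^-1 :> R.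
Proof.
elim: n => [|n IH]; first by rewrite leqn0 => /eqP ->; rewrite big_geq// subrr.
rewrite leq_eqVlt ltnS => /predU1P[->|Nn]; first by rewrite big_geq// subrr.
rewrite big_nat_recr//=.
have H : (lam n)^-1 <= n.+1%:R^-1 - n.+2%:R^-1 :> R.
  have -> : n.+1%:R^-1 - n.+2%:R^-1 = ((n.+1 * n.+2)%:R)^-1 :> R.
    have n1 : n.+1%:R != 0 :> R by rewrite pnatr_eq0.
    have n2 : n.+2%:R != 0 :> R by rewrite pnatr_eq0.
    rewrite natrM invfM.
    rewrite -[n.+2%:R]natr1 in n2 *; move: (n.+1%:R : R) n1 n2 => x n1 n2.
    by field; rewrite n1 n2.
  by rewrite lef_pV2 ?posrE// ltr0n.
by apply: le_trans (lerD (IH Nn) H) _; rewrite addrA subrK.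
Qed.

(** Sequences of bounded energy are absolutely summable, uniformly, by the
    inequality between the arithmetic and geometric means. *)
Lemma energy_le_tail r c N n : 1 <= r -> energy_le lam r c -> (N <= n)%N ->
  \sum_(N <= j < n) `|c j| <= r * tailb N.
Proof.
move=> r1 Kc Nn; set d := tailb N.
have d0 : 0 < d := tailb_gt0 N.
have B j : `|c j| <= d / 2 * (lam j * c j ^+ 2) + (2 * d)^-1 * (lam j)^-1.
  have l0 := lam_gt0 j.
  rewrite -[c j ^+ 2]real_normK ?num_real//; set x := `|c j|.
  rewrite -subr_ge0.
  have -> : d / 2 * (lam j * x ^+ 2) + (2 * d)^-1 * (lam j)^-1 - x =
     (d * lam j * x - 1) ^+ 2 / (2 * d * lam j).
    by field; rewrite !gt_eqF.
  by rewrite divr_ge0 ?sqr_ge0// !mulr_ge0// ltW.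
apply: le_trans (ler_sum _ (fun j _ => B j)) _.
rewrite big_split /= -!mulr_sumr.
have S1 : \sum_(N <= j < n) lam j * c j ^+ 2 <= r.
  apply: le_trans (Kc n).
  rewrite (@big_cat_nat _ _ _ N 0 n)//= lerDr sumr_ge0// => j _.
  by rewrite mulr_ge0 ?sqr_ge0// ltW.
have S2 : \sum_(N <= j < n) (lam j)^-1 <= d ^+ 2.
  apply: le_trans (inv_tail Nn) _.
  by rewrite /d /tailb exprVn sqr_sqrtr// lerBlDr lerDl invr_ge0.
have d2 : 0 <= d / 2 by rewrite divr_ge0// ltW.
have d3 : 0 <= (2 * d)^-1 by rewrite invr_ge0 mulr_ge0// ltW.
apply: (@le_trans _ _ (d / 2 * r + (2 * d)^-1 * d ^+ 2)).
  by apply: lerD; apply: ler_wpM2l.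
have -> : (2 * d)^-1 * d ^+ 2 = d / 2 by field; rewrite gt_eqF.
have : d <= r * d by rewrite ler_peMl// ltW.
lra.
Qed.

Lemma cosj_le1 j z : `|cosj j z| <= 1.
Proof. by rewrite ler_norml cos_geN1 cos_le1. Qed.

Lemma cpart_diff c N n z : (N <= n)%N ->
  `|csum_part c n z - csum_part c N z| <= 2 * \sum_(N <= j < n) `|c j|.
Proof.
move=> Nn; rewrite /csum_part (@big_cat_nat _ _ _ N 0 n)//= addrAC subrr add0r.
apply: le_trans (ler_norm_sum _ _ _) _; rewrite mulr_sumr.
apply: ler_sum => j _; rewrite !normrM ger0_norm//.
by rewrite ler_piMr ?mulr_ge0// cosj_le1.
Qed.

Lemma cseries_cvg r c z : 1 <= r -> energy_le lam r c ->
  (fun n => csum_part c n z) @ \oo --> cseries c z.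
Proof.
move=> r1 Kc; apply: cauchy_cvg; apply/cauchyP => eps eps0.
have r0 : 0 < 2 * r by rewrite mulr_gt0// (lt_le_trans _ r1).
have [N HN] := tailb_le (divr_gt0 eps0 (mulr_gt0 (ltr0n R 2) r0)).
exists (csum_part c N z); exists N => // n /= Nn.
rewrite /ball /= distrC; apply: le_lt_trans (cpart_diff c z Nn) _.
apply: le_lt_trans (_ : 2 * (r * tailb N) < eps).
  by rewrite ler_pM2l//; exact: energy_le_tail.
rewrite mulrA; apply: le_lt_trans (_ : _ <= 2 * r * (eps / (2 * (2 * r)))) _.
  by rewrite ler_pM2l// HN.
have -> : 2 * r * (eps / (2 * (2 * r))) = eps / 2.
  by field; rewrite gt_eqF// (lt_le_trans _ r1).
by rewrite ltr_pdivrMr// ltr_pMr// ltr1n.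
Qed.

Lemma cseries_approx r c N z : 1 <= r -> energy_le lam r c ->
  `|cseries c z - csum_part c N z| <= 2 * r * tailb N.
Proof.
move=> r1 Kc.
have H : (fun n => `|csum_part c n z - csum_part c N z|) @ \oo -->
    `|cseries c z - csum_part c N z|.
  by apply: cvg_norm; apply: cvgB; [exact: cseries_cvg r1 Kc|exact: cvg_cst].
rewrite -(cvg_lim (@Rhausdorff R) H); apply: limr_le.
  by apply/cvg_ex; eexists; exact: H.
exists N => // n /= Nn; apply: le_trans (cpart_diff c z Nn) _.
by rewrite -mulrA ler_pM2l//; exact: energy_le_tail.
Qed.

Lemma continuous_cosj j : continuous (cosj j).
Proof. exact: continuous_cos_phase. Qed.

Lemma continuous_cpart c n : continuous (csum_part c n).
Proof.
elim: n => [|n IH].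
  have -> : csum_part c 0 = fun=> 0 by apply/funext => z; rewrite /csum_part big_geq.
  by move=> z; exact: cvg_cst.
have -> : csum_part c n.+1 = fun z => csum_part c n z + 2 * c n * cosj n z.
  by apply/funext => z; rewrite /csum_part big_nat_recr.
move=> z; apply: cvgD; first exact: IH.
by apply: cvgM; [exact: cvg_cst|exact: continuous_cosj].
Qed.

Lemma cseries_le r c z : 1 <= r -> energy_le lam r c -> `|cseries c z| <= 2 * r.
Proof.
move=> r1 Kc; have := cseries_approx 0 z r1 Kc.
by rewrite /csum_part big_geq// subr0 /tailb sqrtr1 invr1 mulr1.
Qed.

Lemma continuous_cseries r c : 1 <= r -> energy_le lam r c ->
  continuous (cseries c).
Proof.
move=> r1 Kc z; apply/cvgrPdist_lt => eps eps0.
have r0 : 0 < 2 * r by rewrite mulr_gt0// (lt_le_trans _ r1).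
have [N HN] := tailb_le (divr_gt0 eps0 (mulr_gt0 (ltr0n R 3) r0)).
have {}HN : 2 * r * tailb N <= eps / 3.
  apply: (@le_trans _ _ (2 * r * (eps / (3 * (2 * r))))).
    by rewrite ler_pM2l// HN.
  by rewrite le_eqVlt; apply/orP; left; apply/eqP; field;
     rewrite gt_eqF// (lt_le_trans _ r1).
have := @continuous_cpart c N z.
move/cvgrPdist_lt => /(_ (eps / 3)); rewrite divr_gt0// => /(_ isT).
apply: filterS => z' /= H.
have A1 := cseries_approx N z r1 Kc; have A2 := cseries_approx N z' r1 Kc.
have -> : cseries c z - cseries c z' = (cseries c z - csum_part c N z)
  + (csum_part c N z - csum_part c N z') + - (cseries c z' - csum_part c N z').
  by ring.
apply: le_lt_trans (ler_normD _ _) _.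
have := ler_normD (cseries c z - csum_part c N z) (csum_part c N z - csum_part c N z').
rewrite normrN.
lra.
Qed.

Lemma energy_leW r r' c : r <= r' -> energy_le lam r c -> energy_le lam r' c.
Proof. by move=> rr' Kc n; exact: le_trans (Kc n) rr'. Qed.

Lemma energy_leZ r c (s : R) : energy_le lam r c ->
  energy_le lam (s ^+ 2 * r) (fun j => s * c j).
Proof.
move=> Kc n; apply: le_trans (ler_wpM2l (sqr_ge0 s) (Kc n)).
by rewrite mulr_sumr le_eqVlt; apply/orP; left; apply/eqP/eq_bigr => j _; ring.
Qed.

Lemma cseriesZ r c (s : R) z : 1 <= r -> energy_le lam r c ->
  cseries (fun j => s * c j) z = s * cseries c z.
Proof.
move=> r1 Kc; apply: cvg_lim => //.
have -> : (fun n => csum_part (fun j => s * c j) n z) =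
    (fun n => s * csum_part c n z).
  by apply/funext => n; rewrite /csum_part mulr_sumr; apply: eq_bigr => j _; ring.
by apply: cvgM; [exact: cvg_cst|exact: cseries_cvg r1 Kc].
Qed.

(** The sequence [c] with [t] added to its [j]-th term. *)
Definition bump c (j : nat) (t : R) : nat -> R :=
  fun i => if i == j then c i + t else c i.

Lemma cseries_bump r c j t z : 1 <= r -> energy_le lam r c ->
  cseries (bump c j t) z = cseries c z + 2 * t * cosj j z.
Proof.
move=> r1 Kc; apply: cvg_lim => //.
apply: (@cvg_trans _ ((fun n => csum_part c n z + 2 * t * cosj j z) @ \oo)); last first.
  by apply: cvgD; [exact: cseries_cvg r1 Kc|exact: cvg_cst].
apply: near_eq_cvg; exists j.+1 => // n /= jn.
rewrite /csum_part !big_mkord (bigD1 (Ordinal jn))//= [in RHS](bigD1 (Ordinal jn))//=.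
rewrite /bump eqxx.
rewrite [in RHS](eq_bigr (fun i : 'I_n => 2 * c i * cosj i z)); first by ring.
by move=> i; rewrite -val_eqE /= => /negbTE ->.
Qed.

Lemma energy_bump c j t : energy_le lam 1 c ->
  energy_le lam (1 + 2 * t * lam j * c j + t ^+ 2 * lam j) (bump c j t).
Proof.
move=> Kc n.
have P m : 0 <= \sum_(0 <= i < m) lam i * c i ^+ 2.
  by apply: sumr_ge0 => i _; rewrite mulr_ge0 ?sqr_ge0// ltW.
have E : (j < n)%N -> \sum_(0 <= i < n) lam i * bump c j t i ^+ 2 =
    \sum_(0 <= i < n) lam i * c i ^+ 2 + (2 * t * lam j * c j + t ^+ 2 * lam j).
  move=> jn; rewrite !big_mkord (bigD1 (Ordinal jn))//= [in RHS](bigD1 (Ordinal jn))//=.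
  rewrite /bump eqxx (eq_bigr (fun i : 'I_n => lam i * c i ^+ 2)); first by ring.
  by move=> i; rewrite -val_eqE /= => /negbTE ->.
have [jn|nj] := ltnP j n.
  by rewrite E// -addrA lerD2r.
have -> : \sum_(0 <= i < n) lam i * bump c j t i ^+ 2 = \sum_(0 <= i < n) lam i * c i ^+ 2.
  apply: eq_big_nat => i /andP[_ i_n]; rewrite /bump ltn_eqF//.
  exact: leq_trans i_n nj.
have := Kc j.+1; rewrite big_nat_recr//=.
rewrite (@big_cat_nat _ _ _ n 0 j)//= => K1.
have P2 : 0 <= \sum_(n <= i < j) lam i * c i ^+ 2.
  by apply: sumr_ge0 => i _; rewrite mulr_ge0 ?sqr_ge0// ltW.
have : 0 <= lam j * (c j + t) ^+ 2 by rewrite mulr_ge0 ?sqr_ge0// ltW.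
nra.
Qed.

(** The functional to be maximized. *)
Definition cubic c : R := tint (fun z => cseries c z ^+ 3).

End Series.

(** * A maximizer of the cubic functional *)

Lemma continuous_bigsum (R : realType) (T : topologicalType)
    (h : nat -> T -> R) n :
  (forall j, continuous (h j)) ->
  continuous (fun c => \sum_(0 <= j < n) h j c).
Proof.
move=> ch; elim: n => [|n IH].
  have -> : (fun c => \sum_(0 <= j < 0) h j c) = fun=> 0.
    by apply/funext => c; rewrite big_geq.
  by move=> c; exact: cvg_cst.
have -> : (fun c => \sum_(0 <= j < n.+1) h j c) =
    fun c => \sum_(0 <= j < n) h j c + h n c.
  by apply/funext => c; rewrite big_nat_recr.
by move=> c; apply: cvgD; [exact: IH|exact: ch].
Qed.

Section Maximizer.
Context {R : realType} (e : freq).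
Hypothesis e1 : e.1 != 0.
Variable lam : nat -> R.
Hypothesis lam_ge : forall j, (j.+1 * j.+2)%:R <= lam j.
Implicit Types (c : nat -> R).

Let lam_ge2 j : 2 <= lam j.
Proof.
by apply: le_trans (lam_ge j); rewrite ler_nat mulSn -{1}[2%N]addn0 leq_add.
Qed.

Let lam_gt0 j : 0 < lam j.
Proof. by apply: lt_le_trans (lam_ge2 j). Qed.

(** Sequences of coefficients, with the topology of pointwise convergence. *)
Let seqs := prod_topology (fun _ : nat => R).

Definition energy_ball : set seqs := [set c | energy_le lam 1 c].

Lemma continuous_coord j : continuous (fun c : seqs => c j).
Proof. exact: (@proj_continuous _ (fun _ : nat => R) j). Qed.

Lemma energy_ball_compact : compact energy_ball.
Proof.
have cbox : compact [set c : seqs | forall j : nat, `[-1, 1]%classic (c j)].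
  exact: (@tychonoff _ (fun _ : nat => R) (fun=> `[-1, 1]%classic)
            (fun=> @segment_compact _ _ _)).
apply: (subclosed_compact _ cbox).
  have -> : energy_ball = \bigcap_n
      ((fun c : seqs => \sum_(0 <= j < n) lam j * c j ^+ 2) @^-1` [set x | x <= 1]).
    by apply/seteqP; split=> [c Kc n _|c Kc n]; [exact: Kc|exact: Kc].
  apply: closed_bigI => n _; apply: preimage_closed; last exact: closed_le.
  move=> c _; apply: continuous_bigsum => j {}c.
  apply: (@continuous_comp _ _ _ (fun c : seqs => c j) (fun x => lam j * x ^+ 2)).
    exact: continuous_coord.
  by apply: cvgM; [exact: cvg_cst|exact: exprn_continuous].
move=> c Kc j; rewrite /= in_itv /= -ler_norml.
have := Kc j.+1; rewrite big_nat_recr//= => H.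
have S0 : 0 <= \sum_(0 <= i < j) lam i * c i ^+ 2.
  by apply: sumr_ge0 => i _; rewrite mulr_ge0 ?sqr_ge0// ltW.
have H2 : 2 * c j ^+ 2 <= lam j * c j ^+ 2 by rewrite ler_wpM2r ?sqr_ge0.
have : `|c j| ^+ 2 <= 1 by rewrite real_normK ?num_real//; lra.
by rewrite expr_le1.
Qed.

Local Notation F := (cseries e).

(** The cubic functional depends on finitely many coefficients, up to a small
    error that is uniform on the energy ball. *)
Lemma cubic_dist c c' N : energy_le lam 1 c -> energy_le lam 1 c' ->
  `|cubic e c - cubic e c'| <=
    48 * tailb N + 24 * \sum_(0 <= j < N) `|c j - c' j|.
Proof.
move=> Kc Kc'.
have cF c0 : energy_le lam 1 c0 -> continuous (F c0).
  exact: (continuous_cseries lam_ge (lexx 1)).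
have cF3 c0 : energy_le lam 1 c0 -> continuous (fun z => F c0 z ^+ 3).
  move=> K0 z; apply: (@continuous_comp _ _ _ (F c0) (fun x => x ^+ 3)).
    exact: cF.
  exact: exprn_continuous.
rewrite /cubic -tintB; [|exact: cF3|exact: cF3].
apply: normr_tint => [z|z _]; first by apply: cvgB; exact: cF3.
have A1 := cseries_approx e lam_ge N z (lexx 1) Kc.
have A2 := cseries_approx e lam_ge N z (lexx 1) Kc'.
have B1 := cseries_le e lam_ge z (lexx 1) Kc.
have B2 := cseries_le e lam_ge z (lexx 1) Kc'.
have D : `|csum_part e c N z - csum_part e c' N z| <=
    2 * \sum_(0 <= j < N) `|c j - c' j|.
  rewrite /csum_part -sumrB; apply: le_trans (ler_norm_sum _ _ _) _.
  rewrite mulr_sumr; apply: ler_sum => j _.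
  have -> : 2 * c j * cosj e j z - 2 * c' j * cosj e j z =
    2 * (c j - c' j) * cosj e j z by ring.
  by rewrite !normrM ger0_norm// ler_piMr ?mulr_ge0// cosj_le1.
move: A1 A2 B1 B2 D; set x := F c z; set y := F c' z.
set p := csum_part e c N z; set q := csum_part e c' N z.
set S := \sum_(_ <= _ < _) _; set tau := tailb N => A1 A2 B1 B2 D.
have xy : `|x - y| <= 4 * tau + 2 * S.
  have -> : x - y = (x - p) + (p - q) - (y - q) by ring.
  have := ler_normB ((x - p) + (p - q)) (y - q).
  have := ler_normD (x - p) (p - q).
  lra.
have -> : x ^+ 3 - y ^+ 3 = (x - y) * (x ^+ 2 + x * y + y ^+ 2) by ring.
rewrite normrM.
have Q : `|x ^+ 2 + x * y + y ^+ 2| <= 12.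
  move: B1 B2; rewrite mulr1 !ler_norml => /andP[a1 a2] /andP[b1 b2].
  by apply/andP; split; nra.
apply: le_trans (ler_pM (normr_ge0 _) (normr_ge0 _) xy Q) _.
lra.
Qed.

Lemma cubic_continuous : {within energy_ball, continuous (cubic e : seqs -> R)}.
Proof.
apply/subspace_continuousP => c Kc; apply/cvgrPdist_lt => eps eps0.
have [N /(_ N (leqnn N)) HN] := tailb_le (divr_gt0 eps0 (ltr0n R 96)).
pose dist (c' : seqs) : R := \sum_(0 <= j < N) `|c j - c' j|.
have cd : continuous dist.
  apply: continuous_bigsum => j c'.
  apply: (@continuous_comp _ _ _ (fun c : seqs => c j) (fun x => `|c j - x|)).
    exact: continuous_coord.
  by apply: cvg_norm; apply: cvgB; [exact: cvg_cst|exact: cvg_id].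
have d0 : dist c = 0.
  by rewrite /dist big1_seq// => j _; rewrite subrr normr0.
have := cd c; rewrite /continuous_at d0 => /cvgrPdist_lt /(_ (eps / 48)).
rewrite divr_gt0// => /(_ isT) Hd.
apply: filterS Hd => c' /=; rewrite sub0r normrN => Hd Kc'.
apply: le_lt_trans (cubic_dist N Kc Kc') _.
have := ler_norm (dist c'); rewrite -/(dist c').
lra.
Qed.

Lemma cubic_max : exists2 c, energy_le lam 1 c &
  forall c', energy_le lam 1 c' -> cubic e c' <= cubic e c.
Proof.
have K0 : energy_ball !=set0.
  by exists (fun=> 0) => n; rewrite big1 // => j _; rewrite expr0n mulr0.
have [c /set_mem Kc cmax] := compact_EVT_max K0 energy_ball_compact cubic_continuous.
by exists c => // c' Kc'; apply: cmax; exact/mem_set.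
Qed.

Lemma cos_mulphase n z : cosj e n z = cos (n.+1%:R * phase e z) :> R.
Proof. by rewrite /cosj; congr cos; rewrite /phase /harm /= !intrM; ring. Qed.

Lemma tint_cosj n : tint (cosj e n : R * R -> R) = 0.
Proof.
rewrite /cosj tint_cos; case: eqP => // /(congr1 fst) /= /eqP.
by rewrite mulf_eq0 (negbTE e1).
Qed.

(** The cube of a sum of two cosines has a positive mean: it is 3/4 plus a
    combination of nonconstant cosines. *)
Lemma tint_cube_two_cos :
  tint (fun z => (cosj e 0 z + cosj e 1 z) ^+ 3 : R) = 3 / 4.
Proof.
have E z : (cosj e 0 z + cosj e 1 z) ^+ 3 = 3 / 4 + (9 / 4 * cosj e 0 z
  + (9 / 4 * cosj e 1 z + (1 * cosj e 2 z + (3 / 4 * cosj e 3 z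
  + (3 / 4 * cosj e 4 z + 1 / 4 * cosj e 5 z))))) :> R.
  rewrite !cos_mulphase !mul1r; set t := phase e z; set x := cos t.
  have c2 : cos (2 * t) = 2 * x ^+ 2 - 1.
    rewrite mulr_natl mulr2n cosD -!expr2 -/x.
    have := cos2Dsin2 t; rewrite -/x.
    by move: (x ^+ 2) (sin t ^+ 2) => a b; lra.
  have rec n : cos (n.+3%:R * t) = 2 * x * cos (n.+2%:R * t) - cos (n.+1%:R * t).
    have -> : n.+3%:R * t = n.+2%:R * t + t by rewrite -[n.+3%:R]natr1 mulrDl mul1r.
    have -> : n.+1%:R * t = n.+2%:R * t - t by rewrite -[n.+2%:R]natr1 mulrDl mul1r addrK.
    by rewrite cosD cosB -/x; move: x {c2} (cos _) (sin _) (sin _) => *; ring.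
  have c3 := rec 0%N; have c4 := rec 1%N; have c5 := rec 2%N; have c6 := rec 3%N.
  rewrite mul1r -/x in c3.
  rewrite c6 c5 c4 c3 c2; move: x {c2 c3 c4 c5 c6 rec} => x.
  by field.
have cc n : continuous (fun z => cosj e n z : R) by exact: continuous_cosj.
have cz (a : R) n : continuous (fun z => a * cosj e n z).
  by move=> z; apply: cvgM; [exact: cvg_cst|apply: cc].
rewrite (eq_tint E).
have cD (f g : R * R -> R) : continuous f -> continuous g ->
  continuous (fun z => f z + g z) by move=> cf cg z; exact: (cvgD (cf z) (cg z)).
have cst0 : continuous (fun _ : R * R => 3 / 4 : R) by move=> z; exact: cvg_cst.
do 6! (rewrite tintD; [|by auto|by auto 10]).
by rewrite tint_cst !tintZ// !tint_cosj !mulr0 !addr0.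
Qed.

Lemma energy_le_r1 (r : R) c : energy_le lam r c -> energy_le lam (Num.max 1 r) c.
Proof. by apply: energy_leW; rewrite le_max lexx orbT. Qed.

Lemma cubicZ r c s : energy_le lam r c ->
  cubic e (fun j => s * c j) = s ^+ 3 * cubic e c.
Proof.
move=> /energy_le_r1 Kc; have r1 : 1 <= Num.max 1 r by rewrite le_max lexx.
rewrite /cubic -tintZ; last first.
  move=> z; apply: (@continuous_comp _ _ _ (F c) (fun x => x ^+ 3)).
    exact: (continuous_cseries lam_ge r1 Kc).
  exact: exprn_continuous.
by apply: eq_tint => z; rewrite (cseriesZ _ lam_ge _ _ r1 Kc) exprMn.
Qed.

(** The functional is homogeneous of degree 3 and odd, and the energy is
    homogeneous of degree 2. Squares avoid the exponent 3/2. *)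
Lemma cubic_scaled (M q : R) c' :
  (forall c'', energy_le lam 1 c'' -> cubic e c'' <= M) ->
  0 < q -> energy_le lam q c' -> cubic e c' ^+ 2 <= M ^+ 2 * q ^+ 3.
Proof.
move=> HM q0 Kc'; set s := Num.sqrt q.
have s0 : 0 < s by rewrite sqrtr_gt0.
have sq : s ^+ 2 = q by rewrite sqr_sqrtr// ltW.
have Ks (a : R) : a ^+ 2 = 1 -> energy_le lam 1 (fun j => (a / s) * c' j).
  move=> a1; have := energy_leZ (a / s) Kc'.
  by rewrite expr_div_n a1 sq mul1r mulVf// gt_eqF.
have U (a : R) : a ^+ 2 = 1 -> a * cubic e c' <= M * s ^+ 3.
  move=> a1; have := HM _ (Ks a a1); rewrite (cubicZ _ Kc').
  rewrite expr_div_n [a ^+ 3]exprS a1 mulr1 mulrAC.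
  by rewrite ler_pdivrMr// exprn_gt0.
have U1 := U 1 (expr1n _ _).
have U2 : (-1) * cubic e c' <= M * s ^+ 3 by apply: U; rewrite sqrrN expr1n.
have -> : M ^+ 2 * q ^+ 3 = (M * s ^+ 3) ^+ 2.
  by rewrite exprMn -sq -!exprM.
by rewrite -[cubic e c' ^+ 2]real_normK ?num_real// ler_sqr ?nnegrE//
  ?(le_trans (normr_ge0 (cubic e c'))) // ler_norml; lra.
Qed.

End Maximizer.

(** * The Euler-Lagrange equation *)

Lemma continuous_ge0_right {R : realType} (g : R -> R) (a d : R) :
  continuous g -> 0 < d -> (forall t, 0 < t < d -> 0 <= a * g (a * t)) ->
  a != 0 -> 0 <= a * g 0.
Proof.
move=> cg d0 H a0; rewrite leNgt; apply/negP => neg.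
have ch : continuous (fun t => a * g (a * t)).
  move=> t; apply: cvgM; first exact: cvg_cst.
  apply: (@continuous_comp _ _ _ (fun t => a * t) g); last exact: cg.
  by apply: cvgM; [exact: cvg_cst|exact: cvg_id].
have := ch 0; move/cvgrPdist_lt => /(_ (- (a * g 0))).
rewrite oppr_gt0 => /(_ neg) /nbhs_ballP[r /= r0 Hr].
have m0 : 0 < Num.min d r by rewrite lt_min d0.
pose t := Num.min d r / 2.
have t0 : 0 < t by rewrite divr_gt0.
have tm : t < Num.min d r by rewrite ltr_pdivrMr// ltr_pMr// ltr1n.
have [td tr] : t < d /\ t < r by move: tm; rewrite lt_min => /andP.
have := Hr t; rewrite /ball /= sub0r normrN (gtr0_norm t0) mulr0 => /(_ tr).
have := H t; rewrite t0 td => /(_ isT) h1.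
rewrite ltr_norml => /andP[h2 _].
lra.
Qed.

Section Profile.
Context {R : realType} (e : freq).
Hypothesis e1 : e.1 != 0.
Variable lam : nat -> R.
Hypothesis lam_ge : forall j, (j.+1 * j.+2)%:R <= lam j.
Implicit Types (c : nat -> R).

Let lam_ge2 j : 2 <= lam j.
Proof.
by apply: le_trans (lam_ge j); rewrite ler_nat mulSn -{1}[2%N]addn0 leq_add.
Qed.

Let lam_gt0 j : 0 < lam j.
Proof. by apply: lt_le_trans (lam_ge2 j). Qed.

Local Notation F := (cseries e).

Lemma cseries0 z : F (fun=> 0 : R) z = 0.
Proof.
have K0 : energy_le lam 1 (fun=> 0) by move=> n; rewrite big1 // => j _; rewrite expr0n mulr0.
have H : F (fun j => 0 * 0) z = 0 * F (fun=> 0) z := cseriesZ e lam_ge 0 z (lexx 1) K0.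
by rewrite -[RHS](mul0r (F (fun=> 0) z)) -H mul0r.
Qed.

Lemma cubic_pos : exists2 c, energy_le lam 1 c & 0 < cubic e c.
Proof.
(* a multiple of the sum of the first two cosines, small enough to have energy
   at most 1 *)
set d := (1 + lam 0%N + lam 1%N)^-1.
have l0 := lam_gt0 0; have l1 := lam_gt0 1.
have D0 : 0 < 1 + lam 0%N + lam 1%N by rewrite !addr_gt0.
have d0 : 0 < d by rewrite invr_gt0.
have d1 : (1 + lam 0%N + lam 1%N) * d = 1 by rewrite mulfV// gt_eqF.
pose c := bump (bump (fun=> 0) 0 d) 1 d.
have E : lam 0%N * d ^+ 2 + lam 1%N * d ^+ 2 <= 1.
  have : d <= 1 by rewrite invf_le1// -addrA lerDl addr_ge0// ltW.
  nra.
have Kz : energy_le lam 1 (fun=> 0) by move=> n; rewrite big1 // => j _; rewrite expr0n mulr0.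
have pd j : 0 <= lam j * d ^+ 2 by rewrite mulr_ge0 ?sqr_ge0// ltW.
have K0 : energy_le lam 1 (bump (fun=> 0) 0 d).
  have := energy_bump lam_ge 0 d Kz; rewrite mulr0 addr0 => K n.
  case: n => [|n]; first by rewrite big_geq.
  rewrite big_nat_recl// big1 => [|i _]; last by rewrite /bump /= expr0n mulr0.
  rewrite /bump /= add0r addr0; have := pd 1%N; lra.
have Kc : energy_le lam 1 c.
  move=> [|[|n]]; first by rewrite big_geq.
    rewrite big_nat_recl// big_geq// /c /bump /= add0r addr0.
    have := pd 1%N; lra.
  rewrite big_nat_recl// big_nat_recl// big1 => [|i _]; last by rewrite /c /bump /= expr0n mulr0.
  by rewrite /c /bump /= !add0r addr0.
exists c => //.
have Fc z : F c z = 2 * d * (cosj e 0 z + cosj e 1 z).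
  rewrite (cseries_bump e lam_ge 1 d z (lexx 1) K0).
  rewrite (cseries_bump e lam_ge 0 d z (lexx 1) Kz) cseries0 add0r.
  by rewrite -mulrDr.
rewrite /cubic (@eq_tint _ _ (fun z => (2 * d) ^+ 3 * (cosj e 0 z + cosj e 1 z) ^+ 3)); last first.
  by move=> z; rewrite Fc exprMn.
rewrite tintZ; last first.
  move=> z; apply: (@continuous_comp _ _ _ (fun z => cosj e 0 z + cosj e 1 z) (fun x => x ^+ 3)).
    exact: (cvgD (@continuous_cosj _ e 0 z) (@continuous_cosj _ e 1 z)).
  exact: exprn_continuous.
rewrite tint_cube_two_cos// mulr_gt0// ?divr_gt0//.
by rewrite exprn_gt0// mulr_gt0.
Qed.

Lemma cubic_bump c j t : energy_le lam 1 c ->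
  cubic e (bump c j t) = cubic e c + t * (6 * tint (fun z => F c z ^+ 2 * cosj e j z)
    + t * (12 * tint (fun z => F c z * cosj e j z ^+ 2)
    + t * (8 * tint (fun z => cosj e j z ^+ 3)))).
Proof.
move=> Kc; rewrite /cubic.
have cF : continuous (F c) := continuous_cseries lam_ge (lexx 1) Kc.
have cC : continuous (cosj e j : R * R -> R) by exact: continuous_cosj.
rewrite (@eq_tint _ _ (fun z => F c z ^+ 3 + ((t * 6) * (F c z ^+ 2 * cosj e j z)
    + ((t * t * 12) * (F c z * cosj e j z ^+ 2)
    + (t * t * t * 8) * cosj e j z ^+ 3)))); last first.
  move=> z; rewrite (cseries_bump e lam_ge j t z (lexx 1) Kc).
  by move: (F c z) (cosj e j z) => x y; ring.
have c3 : continuous (fun z => F c z ^+ 3) by exact: ctsX.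
have c2 : continuous (fun z => F c z ^+ 2 * cosj e j z) by apply: ctsM => //; exact: ctsX.
have c1 : continuous (fun z => F c z * cosj e j z ^+ 2) by apply: ctsM => //; exact: ctsX.
have c0 : continuous (fun z : R * R => cosj e j z ^+ 3 : R) by exact: ctsX.
rewrite tintD//; last by apply: ctsD; [|apply: ctsD]; exact: ctsZ.
rewrite tintD; [|exact: ctsZ|by apply: ctsD; exact: ctsZ].
rewrite tintD; [|exact: ctsZ|exact: ctsZ].
rewrite !tintZ//.
move: (tint _) (tint _) (tint _) (tint _) => *; ring.
Qed.

(** A maximizer is not assumed to have energy exactly 1: an upper bound [q] on
    the energy of the perturbed sequence, equal to 1 at [t = 0], is enough. *)
Lemma euler_lagrange c : energy_le lam 1 c ->
  (forall c', energy_le lam 1 c' -> cubic e c' <= cubic e c) ->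
  0 < cubic e c ->
  forall j, tint (fun z => F c z ^+ 2 * cosj e j z) = cubic e c / 2 * (lam j * c j).
Proof.
move=> Kc cmax M0 j; set M := cubic e c in M0 *.
have EB t := cubic_bump j t Kc.
set A := tint _ in EB *; set B := tint _ in EB; set C := tint _ in EB.
(* [M ^+ 2 * q ^+ 3] minus the square of the functional is [t * g t], with [g] a
   polynomial; it is nonnegative for small [t] of either sign, so [g 0 = 0] *)
pose a t := 2 * lam j * c j + t * lam j.
pose b t := 6 * A + t * (12 * B + t * (8 * C)).
pose g t := M ^+ 2 * a t * (3 + 3 * t * a t + t ^+ 2 * a t ^+ 2)
             - b t * (2 * M + t * b t).
have ci : continuous (fun t : R => t) by move=> z; exact: cvg_id.
have cc (x : R) : continuous (fun t : R => x) by exact: cts_cst.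
have ca : continuous a by apply: ctsD => //; exact: ctsM.
have cb : continuous b.
  by apply: ctsD => //; apply: ctsM => //; apply: ctsD => //; exact: ctsM.
have cg : continuous g.
  apply: ctsD; first apply: ctsM; first exact: ctsM.
  - apply: ctsD; first by apply: ctsD => //; apply: ctsM => //; apply: ctsM.
    by apply: ctsM; apply: ctsM.
  - by apply: ctsN; apply: ctsM => //; apply: ctsD => //; exact: ctsM.
pose d := (1 + `|2 * lam j * c j| + lam j)^-1.
have D0 : 0 < 1 + `|2 * lam j * c j| + lam j by rewrite addr_gt0// ltr_pwDl.
have d0 : 0 < d by rewrite invr_gt0.
have pos t : `|t| < d -> 0 <= t * g t.
  move=> td.
  have td1 : `|t| * (1 + `|2 * lam j * c j| + lam j) < 1 by rewrite -ltr_pdivlMr// mul1r.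
  have q0 : 0 < 1 + 2 * t * lam j * c j + t ^+ 2 * lam j.
    have h1 : - (`|t| * `|2 * lam j * c j|) <= 2 * t * lam j * c j.
      have := ler_norm (- (t * (2 * lam j * c j))); rewrite normrN normrM; lra.
    have h2 : 0 <= t ^+ 2 * lam j by rewrite mulr_ge0 ?sqr_ge0// ltW.
    have h3 : 0 <= `|t| * lam j by rewrite mulr_ge0// ltW.
    have h4 := normr_ge0 t.
    lra.
  have := cubic_scaled lam_ge cmax q0 (energy_bump lam_ge j t Kc).
  rewrite EB -/M -subr_ge0; congr (0 <= _).
  by rewrite /g /a /b; move: (M) (A) (B) (C) (lam j) (c j) => *; ring.
have n1 : (-1 : R) != 0 by rewrite oppr_eq0 oner_neq0.
have u1 : 0 <= 1 * g 0.
  apply: (@continuous_ge0_right _ g 1 d) => // t /andP[t0 td].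
  rewrite !mul1r -(pmulr_rge0 _ t0); apply: pos; by rewrite gtr0_norm.
have u2 : 0 <= -1 * g 0.
  apply: (@continuous_ge0_right _ g (-1) d) => // t /andP[t0 td].
  rewrite -(pmulr_rge0 _ t0).
  have := pos (-1 * t); rewrite normrM normrN normr1 mul1r gtr0_norm// => /(_ td).
  by rewrite !mulN1r mulNr mulrN.
have : g 0 = 0 by lra.
rewrite /g /a /b !mul0r !addr0 expr0n /= => /eqP G.
have {}G : 6 * M * (M * (lam j * c j) - 2 * A) = 0.
  by rewrite -(eqP G); ring.
move/eqP: G; rewrite mulf_eq0 mulf_eq0 pnatr_eq0 (gt_eqF M0)/= subr_eq0 => /eqP G.
by rewrite mulrAC G; field.
Qed.

(** Existence of a nonzero solution of the stationary equation for the
    Fourier coefficients. *)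
Lemma exists_profile : exists c (r : R), [/\ 1 <= r, energy_le lam r c,
  (exists j, c j != 0) &
  forall j, tint (fun z => F c z ^+ 2 * cosj e j z) = lam j * c j].
Proof.
have [c Kc cmax] := cubic_max e lam_ge.
have M0 : 0 < cubic e c.
  by have [c0 K0 p0] := cubic_pos; exact: lt_le_trans p0 (cmax _ K0).
set M := cubic e c in M0 *.
exists (fun j => 2 / M * c j), (Num.max 1 ((2 / M) ^+ 2 * 1)).
have M2 : 2 / M != 0 by rewrite mulf_neq0// invr_neq0// gt_eqF.
split.
- by rewrite le_max lexx.
- by apply: energy_le_r1; exact: energy_leZ.
- apply: contrapT => /forallNP c0.
  have cz : c = fun=> 0.
    apply/funext => j; apply/eqP; have /negP := c0 j.
    by rewrite negbK mulf_eq0 (negbTE M2).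
  move: M0; rewrite /M cz /cubic (@eq_tint _ _ (fun=> 0)) ?tint_cst ?ltxx// => z.
  by rewrite cseries0 expr0n.
- move=> j; rewrite (@eq_tint _ _ (fun z => (2 / M) ^+ 2 * (F c z ^+ 2 * cosj e j z))).
    rewrite tintZ.
      by rewrite (euler_lagrange Kc cmax M0) -/M; field; rewrite gt_eqF.
    have cF : continuous (F c) := continuous_cseries lam_ge (lexx 1) Kc.
    by apply: ctsM; [exact: ctsX|exact: continuous_cosj].
  by move=> z; rewrite (cseriesZ _ lam_ge _ _ (lexx 1) Kc) exprMn -mulrA.
Qed.

End Profile.

(** * Complex functions and their Fourier coefficients *)

Section ComplexTools.
Context {R : realType}.
Implicit Types (f g : R * R -> R[i]) (k l : freq) (w : seq bool) (c : R[i]).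

(** Continuity of a complex function, by its real and imaginary parts. *)
Definition ccont f :=
  continuous (fun z => Re (f z)) /\ continuous (fun z => Im (f z)).

Lemma ReM c c' : Re (c * c') = Re c * Re c' - Im c * Im c'.
Proof. by case: c; case: c'. Qed.

Lemma ImM c c' : Im (c * c') = Re c * Im c' + Im c * Re c'.
Proof. by case: c => a b; case: c' => a' b'. Qed.

Lemma ReD c c' : Re (c + c') = Re c + Re c'.
Proof. by case: c; case: c'. Qed.

Lemma ImD c c' : Im (c + c') = Im c + Im c'.
Proof. by case: c; case: c'. Qed.

Lemma complexP c c' : Re c = Re c' -> Im c = Im c' -> c = c'.
Proof. by case: c => a b; case: c' => a' b' /= -> ->. Qed.

Lemma smooth_ccont f : smooth f -> ccont f.
Proof. by move=> /smoothP[sr si]; split; exact: rsmooth_continuous. Qed.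

Lemma ccontM f g : ccont f -> ccont g -> ccont (fun z => f z * g z).
Proof.
move=> [fr fi] [gr gi]; split.
- under [X in continuous X]eq_fun do rewrite ReM.
  by apply: ctsB; exact: ctsM.
- under [X in continuous X]eq_fun do rewrite ImM.
  by apply: ctsD; exact: ctsM.
Qed.

Lemma ccontD f g : ccont f -> ccont g -> ccont (fun z => f z + g z).
Proof.
move=> [fr fi] [gr gi]; split.
- by under [X in continuous X]eq_fun do rewrite ReD; exact: ctsD.
- by under [X in continuous X]eq_fun do rewrite ImD; exact: ctsD.
Qed.

Lemma ccont_cst c : ccont (fun=> c).
Proof. by split; exact: cts_cst. Qed.

Lemma ccont_real (h : R * R -> R) : continuous h -> ccont (fun z => (h z)%:C).
Proof. by move=> ch; split => //; exact: cts_cst. Qed.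

Lemma ccont_character k : ccont (character k).
Proof. by split; [exact: continuous_cos_phase|exact: continuous_sin_phase]. Qed.

Lemma eq_torus_int f g : f =1 g -> torus_int f = torus_int g.
Proof. by move=> fg; congr torus_int; exact/funext. Qed.

Lemma torus_intD f g : ccont f -> ccont g ->
  torus_int (fun z => f z + g z) = torus_int f + torus_int g.
Proof.
move=> [fr fi] [gr gi]; apply: complexP; rewrite ?ReD ?ImD.
- rewrite -[RHS]tintD//; apply: eq_tint => z; exact: ReD.
- rewrite -[RHS]tintD//; apply: eq_tint => z; exact: ImD.
Qed.

Lemma torus_intZ c f : ccont f -> torus_int (fun z => c * f z) = c * torus_int f.
Proof.
move=> [fr fi]; apply: complexP; rewrite ?ReM ?ImM.
- have -> : Re c * Re (torus_int f) - Im c * Im (torus_int f) =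
      tint (fun z => Re c * Re (f z) - Im c * Im (f z)).
    by rewrite tintB ?tintZ//; exact: ctsZ.
  by apply: eq_tint => z; exact: ReM.
- have -> : Re c * Im (torus_int f) + Im c * Re (torus_int f) =
      tint (fun z => Re c * Im (f z) + Im c * Re (f z)).
    by rewrite tintD ?tintZ//; exact: ctsZ.
  by apply: eq_tint => z; exact: ImM.
Qed.

Lemma torus_int0 : torus_int (fun _ : R * R => 0 : R[i]) = 0.
Proof. by apply: complexP => /=; exact: tint_cst. Qed.

Lemma normcE c : normc c = Num.sqrt (Re c ^+ 2 + Im c ^+ 2).
Proof. by case: c. Qed.

Lemma Re_le_normc c : `|Re c| <= normc c.
Proof.
by rewrite normcE -sqrtr_sqr ler_wsqrtr// lerDl sqr_ge0.
Qed.

Lemma Im_le_normc c : `|Im c| <= normc c.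
Proof.
by rewrite normcE -sqrtr_sqr ler_wsqrtr// lerDr sqr_ge0.
Qed.

Lemma normc_le c : normc c <= `|Re c| + `|Im c|.
Proof.
have n0 : 0 <= `|Re c| + `|Im c| by rewrite addr_ge0.
rewrite normcE -[leRHS](ger0_norm n0) -sqrtr_sqr ler_wsqrtr//.
rewrite sqrrD !real_normK ?num_real// -addrA lerD2l lerDr mulrn_wge0// mulr_ge0//.
Qed.

Lemma normc_ge0 c : 0 <= normc c.
Proof. exact: le_trans (normr_ge0 _) (Re_le_normc c). Qed.

Lemma normc_eq0 c : normc c <= 0 -> c = 0.
Proof.
move=> c0; apply: complexP => /=; apply/eqP; rewrite -normr_le0.
- exact: le_trans (Re_le_normc c) c0.
- exact: le_trans (Im_le_normc c) c0.
Qed.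

Lemma normc_opp c : normc (- c) = normc c.
Proof. by case: c => a b /=; rewrite !sqrrN. Qed.

Lemma normcD c c' : normc (c + c') <= normc c + normc c'.
Proof. exact: (@le_normcD R c c'). Qed.

Lemma normc_torus_int f (M : R) : ccont f ->
  (forall z, square z -> normc (f z) <= M) -> normc (torus_int f) <= 2 * M.
Proof.
move=> [fr fi] fM; apply: le_trans (normc_le _) _.
rewrite mulr_natl mulr2n; apply: lerD; apply: normr_tint => // z sz.
- exact: le_trans (Re_le_normc _) (fM _ sz).
- exact: le_trans (Im_le_normc _) (fM _ sz).
Qed.

Lemma characterE k z : character k z = cos (phase k z) +i* sin (phase k z) :> R[i].
Proof. by []. Qed.

Lemma characterD k l z : character (k + l) z = character k z * character l z :> R[i].
Proof.
rewrite !characterE phaseD cosD sinD; apply: complexP; rewrite ?ReM ?ImM//=.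
by rewrite addrC.
Qed.

Lemma character0 z : character 0 z = 1 :> R[i].
Proof. by rewrite characterE phase0 cos0 sin0. Qed.

Lemma normc_character k z : normc (character k z : R[i]) = 1.
Proof. by rewrite normcE /= cos2Dsin2 sqrtr1. Qed.

Lemma torus_int_character k : torus_int (character k) = (k == 0)%:R :> R[i].
Proof.
apply: complexP; rewrite /torus_int /=.
- by rewrite -[LHS]/(tint (fun z => cos (phase k z))) tint_cos; case: (k == 0).
- by rewrite -[LHS]/(tint (fun z => sin (phase k z))) tint_sin; case: (k == 0).
Qed.

Lemma fun_coef_lin c f g k : ccont f -> ccont g ->
  fun_coef (fun z => c * f z + g z) k = c * fun_coef f k + fun_coef g k.
Proof.
move=> cf cg; rewrite /fun_coef -torus_intZ; last exact: ccontM (ccont_character _).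
rewrite -torus_intD; [|by apply: ccontM; [exact: ccont_cst|exact: ccontM (ccont_character _)]
  |exact: ccontM (ccont_character _)].
by apply: eq_torus_int => z; rewrite mulrDl mulrA.
Qed.

Lemma fun_coef_character k l : fun_coef (character k : R * R -> R[i]) l = (k == l)%:R.
Proof.
rewrite /fun_coef -subr_eq0 -torus_int_character; apply: eq_torus_int => z.
by rewrite -characterD.
Qed.

(** The factor by which a derivative, or a word of derivatives, multiplies the
    Fourier coefficients; in a word, [true] stands for the first variable. *)
Definition symb (b : bool) k : R[i] := 0 +i* (2 * pi * (if b then k.1 else k.2)%:~R).
Definition symbw w k : R[i] := \prod_(b <- w) symb b k.
Definition dd (b : bool) f := if b then dx f else dy f.

Lemma dword_cons b w f : dword (b :: w) f = dd b (dword w f).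
Proof. by []. Qed.

Lemma smooth_dword w f : smooth f -> smooth (dword w f).
Proof.
by move=> /smoothP[sr si]; apply/smoothP; rewrite Re_dword Im_dword; split;
  exact: rsmooth_pdw.
Qed.

Lemma smooth_dx f : smooth f -> smooth (dx f).
Proof. exact: (@smooth_dword [:: true]). Qed.

Lemma smooth_dy f : smooth f -> smooth (dy f).
Proof. exact: (@smooth_dword [:: false]). Qed.

Lemma Re_lin c f g : (fun z => Re (c * f z + g z)) =
  (fun z => 1 * (Re c * Re (f z) + (- Im c) * Im (f z)) + 1 * Re (g z)).
Proof. by apply/funext => z; rewrite ReD ReM !mul1r mulNr. Qed.

Lemma Im_lin c f g : (fun z => Im (c * f z + g z)) =
  (fun z => 1 * (Re c * Im (f z) + Im c * Re (f z)) + 1 * Im (g z)).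
Proof. by apply/funext => z; rewrite ImD ImM !mul1r. Qed.

Lemma smooth_lin c f g : smooth f -> smooth g -> smooth (fun z => c * f z + g z).
Proof.
move=> /smoothP[fr fi] /smoothP[gr gi]; apply/smoothP; rewrite Re_lin Im_lin.
by split; apply: rsmooth_lin => //; exact: rsmooth_lin.
Qed.

Lemma dword_lin w c f g : smooth f -> smooth g ->
  dword w (fun z => c * f z + g z) = (fun z => c * dword w f z + dword w g z).
Proof.
move=> /smoothP[fr fi] /smoothP[gr gi]; apply/funext => z.
apply: complexP; [rewrite ReD ReM|rewrite ImD ImM].
- rewrite -[LHS]/((fun z => Re (dword w (fun z => c * f z + g z) z)) z).
  rewrite Re_dword Re_lin (pdw_lin _ _ _ (rsmooth_lin _ _ fr fi) gr) (pdw_lin _ _ _ fr fi).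
  by rewrite -!Re_dword -!Im_dword !mul1r mulNr.
- rewrite -[LHS]/((fun z => Im (dword w (fun z => c * f z + g z) z)) z).
  rewrite Im_dword Im_lin (pdw_lin _ _ _ (rsmooth_lin _ _ fi fr) gi) (pdw_lin _ _ _ fi fr).
  by rewrite -!Re_dword -!Im_dword !mul1r.
Qed.

Lemma smooth0 : smooth (fun _ : R * R => 0 : R[i]).
Proof. by apply/smoothP; split; exact: rsmooth_cst. Qed.

Lemma smoothZ c f : smooth f -> smooth (fun z => c * f z).
Proof.
move=> sf; have -> : (fun z => c * f z) = (fun z => c * f z + 0).
  by apply/funext => z; rewrite addr0.
exact: smooth_lin sf smooth0.
Qed.

Lemma dword0 w : dword w (fun _ : R * R => 0 : R[i]) = fun=> 0.
Proof.
have := dword_lin w (-1) smooth0 smooth0.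
have -> : (fun _ : R * R => -1 * 0 + 0 : R[i]) = fun=> 0.
  by apply/funext => z; rewrite mulr0 addr0.
move=> H; apply/funext => z; have := congr1 (@^~ z) H => /=.
by rewrite mulN1r addNr.
Qed.

Lemma dwordZ w c f : smooth f -> dword w (fun z => c * f z) = (fun z => c * dword w f z).
Proof.
move=> sf.
have -> : (fun z => c * f z) = (fun z => c * f z + 0).
  by apply/funext => z; rewrite addr0.
by rewrite (dword_lin _ _ sf smooth0) dword0; apply/funext => z; rewrite addr0.
Qed.

Lemma smooth_character k : smooth (character k : R * R -> R[i]).
Proof.
apply/smoothP; split.
- have -> : (fun z => Re (character k z : R[i])) = trig k 1 0.
    by apply/funext => z; rewrite /trig mul1r mul0r addr0.
  exact: rsmooth_trig.
- have -> : (fun z => Im (character k z : R[i])) = trig k 0 1.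
    by apply/funext => z; rewrite /trig mul1r mul0r add0r.
  exact: rsmooth_trig.
Qed.

Lemma dd_character b k : dd b (character k) = (fun z => symb b k * character k z).
Proof.
have Er : (fun z => Re (character k z : R[i])) = trig k 1 0.
  by apply/funext => z; rewrite /trig mul1r mul0r addr0.
have Ei : (fun z => Im (character k z : R[i])) = trig k 0 1.
  by apply/funext => z; rewrite /trig mul1r mul0r add0r.
case: b; apply/funext => z; apply: complexP; rewrite ?ReM ?ImM /=.
- rewrite -[LHS]/(pdx (fun z => Re (character k z : R[i])) z) Er pdx_trig /trig.
  by rewrite mulr0 !mul0r !add0r mulr1 mulNr.
- rewrite -[LHS]/(pdx (fun z => Im (character k z : R[i])) z) Ei pdx_trig /trig.
  by rewrite mulr0 oppr0 !mul0r add0r addr0 mulr1.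
- rewrite -[LHS]/(pdy (fun z => Re (character k z : R[i])) z) Er pdy_trig /trig.
  by rewrite mulr0 !mul0r !add0r mulr1 mulNr.
- rewrite -[LHS]/(pdy (fun z => Im (character k z : R[i])) z) Ei pdy_trig /trig.
  by rewrite mulr0 oppr0 !mul0r add0r addr0 mulr1.
Qed.

Lemma dword_character w k :
  dword w (character k) = (fun z => symbw w k * character k z).
Proof.
elim: w => [|b w IH].
  by apply/funext => z; rewrite /symbw big_nil mul1r.
rewrite dword_cons IH -[dd b _]/(dword [:: b] _) (dwordZ _ _ (smooth_character k)).
rewrite -[dword [:: b] _]/(dd b _) dd_character.
apply/funext => z; rewrite /symbw big_cons.
by rewrite -mulrA mulrCA.
Qed.

Lemma torus_int_ibp b f g : smooth f -> smooth g ->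
  torus_int (fun z => dd b f z * g z) = - torus_int (fun z => f z * dd b g z).
Proof.
move=> /smoothP[fr fi] /smoothP[gr gi].
pose dr (h : R * R -> R) := if b then pdx h else pdy h.
have sdr h : rsmooth h -> rsmooth (dr h).
  by rewrite /dr; case: (b); [exact: rsmooth_pdx|exact: rsmooth_pdy].
have I h h' : rsmooth h -> rsmooth h' ->
    tint (fun z => dr h z * h' z) = - tint (fun z => h z * dr h' z).
  by rewrite /dr; case: (b); [exact: tint_ibpx|exact: tint_ibpy].
have cM h h' : rsmooth h -> rsmooth h' -> continuous (fun z => h z * h' z).
  by move=> sh sh'; apply: ctsM; exact: rsmooth_continuous.
have Rdd (h : R * R -> R[i]) z : Re (dd b h z) = dr (fun z => Re (h z)) z.
  by rewrite /dd /dr; case: (b).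
have Idd (h : R * R -> R[i]) z : Im (dd b h z) = dr (fun z => Im (h z)) z.
  by rewrite /dd /dr; case: (b).
have dfr := sdr _ fr; have dfi := sdr _ fi.
have dgr := sdr _ gr; have dgi := sdr _ gi.
apply: complexP; rewrite /torus_int /= -!/(tint _).
- under eq_tint do rewrite ReM Rdd Idd.
  under [in RHS]eq_tint do rewrite ReM Rdd Idd.
  rewrite !tintB ?I//; do ?exact: cM.
  by rewrite opprD.
- under eq_tint do rewrite ImM Rdd Idd.
  under [in RHS]eq_tint do rewrite ImM Rdd Idd.
  rewrite !tintD ?I//; do ?exact: cM.
  by rewrite opprD.
Qed.

Lemma symbN b k : symb b (- k) = - symb b k.
Proof.
by apply: complexP; rewrite /symb /= ?oppr0//; case: b; rewrite /= intrN mulrN.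
Qed.

Lemma fun_coef_dd b f k : smooth f -> fun_coef (dd b f) k = symb b k * fun_coef f k.
Proof.
move=> sf; rewrite /fun_coef (torus_int_ibp b sf (smooth_character _)).
rewrite dd_character symbN -mulN1r -!torus_intZ.
- by apply: eq_torus_int => z; ring.
- apply: ccontM; first exact: smooth_ccont.
  by apply: ccontM; [exact: ccont_cst|exact: ccont_character].
- by apply: ccontM; [exact: smooth_ccont|exact: ccont_character].
Qed.

Lemma fun_coef_dword w f k : smooth f ->
  fun_coef (dword w f) k = symbw w k * fun_coef f k.
Proof.
move=> sf; elim: w => [|b w IH]; first by rewrite /symbw big_nil mul1r.
rewrite dword_cons fun_coef_dd; last exact: smooth_dword.
by rewrite IH /symbw big_cons mulrA.
Qed.

End ComplexTools.

(** * A kernel of trigonometric polynomials *)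

Section Kernel.
Context {R : realType}.
Implicit Types (z : R * R) (w : seq bool) (k : freq).

(** The kernel, whose maximum 4 is attained at the pairs of points that agree
    modulo integers. *)
Definition kern z z' : R :=
  2 + cos (2 * pi * (z.1 - z'.1)) + cos (2 * pi * (z.2 - z'.2)).

Lemma kern_ge0 z z' : 0 <= kern z z'.
Proof.
have := cos_geN1 (2 * pi * (z.1 - z'.1)); have := cos_geN1 (2 * pi * (z.2 - z'.2)).
by rewrite /kern; lra.
Qed.

Lemma cos_turn_lt1 (t : R) : 0 < `|t| < 1 -> cos (2 * pi * t) < 1.
Proof.
have H s : 0 < s < 1 -> cos (2 * pi * s) < 1 :> R.
  move=> /andP[s0 s1]; rewrite -mulrA mulr_natl mulr2n cosD -!expr2.
  have sp : 0 < sin (pi * s).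
    by apply: sin_gt0_pi; rewrite ?mulr_gt0 ?pi_gt0//= gtr_pMr ?pi_gt0.
  have s2 : 0 < sin (pi * s) ^+ 2 by rewrite exprn_gt0.
  by have := cos2Dsin2 (pi * s); lra.
case: (ler0P t) => t0 ti; last exact: H.
by rewrite -[t]opprK mulrN cosN; exact: H.
Qed.

Lemma cts_kern (T : topologicalType) (p q : T -> R * R) :
  continuous p -> continuous q -> continuous (fun x => kern (p x) (q x)).
Proof.
move=> cp cq.
have cfst (u : T -> R * R) : continuous u -> continuous (fun x => (u x).1).
  by move=> cu x; apply: (@continuous_comp _ _ _ u fst); [exact: cu|exact: cvg_fst].
have csnd (u : T -> R * R) : continuous u -> continuous (fun x => (u x).2).
  by move=> cu x; apply: (@continuous_comp _ _ _ u snd); [exact: cu|exact: cvg_snd].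
have ccos (h : T -> R) : continuous h -> continuous (fun x => cos (h x)).
  by move=> ch x; apply: (@continuous_comp _ _ _ h cos); [exact: ch|exact: continuous_cos].
by apply: ctsD; [apply: ctsD; [exact: cts_cst|]|]; apply: (ccos); apply: ctsZ;
  apply: ctsB; (try exact: cfst); exact: csnd.
Qed.

Lemma kern_int z z' (n m : int * int) :
  kern (z.1 + n.1%:~R, z.2 + n.2%:~R) (z'.1 + m.1%:~R, z'.2 + m.2%:~R) = kern z z'.
Proof.
have E (a b : R) (p q : int) : cos (2 * pi * (a + p%:~R - (b + q%:~R))) = cos (2 * pi * (a - b)).
  rewrite -[RHS](@cosD2piZ _ _ (p - q)); congr cos.
  by rewrite intrD intrN; ring.
by rewrite /kern /= !E.
Qed.

(** The kernel is bounded away from its maximum 4 on the pairs that a given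
    periodic function separates. *)
Lemma kern_far (g : R * R -> R) (eps : R) : continuous g ->
  (forall x y, g (x + 1, y) = g (x, y)) ->
  (forall x y, g (x, y + 1) = g (x, y)) -> 0 < eps ->
  exists A : R, [/\ 0 <= A, A < 4 &
    forall z z', eps <= `|g z - g z'| -> kern z z' <= A].
Proof.
move=> cg px py eps0.
pose K1 : set (R * R) := `[0, 1]%classic `*` `[0, 1]%classic.
have cK1 : compact K1 by apply: compact_setX; exact: segment_compact.
pose K : set ((R * R) * (R * R)) := K1 `*` K1.
have cK : compact K by exact: compact_setX.
pose dg (u : (R * R) * (R * R)) : R := `|g u.1 - g u.2|.
have cfst : continuous (fun u : (R * R) * (R * R) => u.1) by move=> u; exact: cvg_fst.
have csnd : continuous (fun u : (R * R) * (R * R) => u.2) by move=> u; exact: cvg_snd.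
have cdg : continuous dg.
  apply: cts_norm; apply: ctsB => u.
  - by apply: (@continuous_comp _ _ _ fst g); [exact: cfst|exact: cg].
  - by apply: (@continuous_comp _ _ _ snd g); [exact: csnd|exact: cg].
pose D : set ((R * R) * (R * R)) := K `&` [set u | eps <= dg u].
have cD : compact D.
  apply: (subclosed_compact _ cK); last by move=> u [].
  apply: closedI; first by apply: compact_closed => //; exact: norm_hausdorff.
  apply: (@preimage_closed _ _ dg [set x | eps <= x]); last exact: closed_ge.
  by move=> u _; exact: cdg.
have sq z : square z -> K1 z.
  by move=> [z1 z2]; split; [move: z1|move: z2]; rewrite /= !in_itv /=
    => /andP[-> /ltW].
have red z z' : eps <= `|g z - g z'| -> exists2 u, D u & kern z z' = kern u.1 u.2.
  have [y sy [gy [n ny]]] := periodic_square px py z.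
  have [y' sy' [gy' [n' ny']]] := periodic_square px py z'.
  move=> H; exists (y, y'); last by rewrite ny ny' kern_int.
  by split; [split; exact: sq|rewrite /= /dg /= -gy -gy'].
have [D0|D0] := pselect (D !=set0); last first.
  exists 0; split => // z z' /red [u Du _]; exfalso; apply: D0; by exists u.
have ck : continuous (fun u : (R * R) * (R * R) => kern u.1 u.2) by exact: cts_kern.
have [u /set_mem Du umax] := compact_EVT_max D0 cD (continuous_subspaceT ck).
exists (kern u.1 u.2); split; [exact: kern_ge0| |]; last first.
  by move=> z z' /red[v Dv ->]; apply: umax; exact/mem_set.
(* equality with 4 would force the two points to agree modulo integers *)
rewrite ltNge; apply/negP => k4.
case: u Du {umax} k4 => -[a b] [a' b'] [[[/= ai bi] [/= ai' bi']] /= gu] k4.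
have per (h : R -> R) t t' : (forall s, h (s + 1) = h s) ->
    t \in `[0, 1] -> t' \in `[0, 1] -> 1 <= cos (2 * pi * (t - t')) -> h t = h t'.
  move=> ph; rewrite !in_itv /= => /andP[t0 t1] /andP[t0' t1'] c1.
  have [tt'|/eqP tt'] := eqVneq t t'; first by rewrite tt'.
  have n0 : 0 < `|t - t'| by rewrite normr_gt0 subr_eq0; apply/eqP.
  have n1 : 1 <= `|t - t'|.
    rewrite leNgt; apply/negP => n1.
    by have := @cos_turn_lt1 (t - t'); rewrite n0 n1 => /(_ isT); rewrite ltNge c1.
  move: n1; rewrite ler_normr => /orP[n1|n1].
  - have -> : t = t' + 1 by lra.
    exact: ph.
  - have -> : t' = t + 1 by lra.
    by rewrite ph.
have c1 := cos_le1 (2 * pi * (a - a')); have c2 := cos_le1 (2 * pi * (b - b')).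
rewrite /kern /= in k4.
have e1 : g (a, b) = g (a', b).
  by apply: (per (fun s => g (s, b))) => //; lra.
have e2 : g (a', b) = g (a', b').
  by apply: (per (fun s => g (a', s))) => //; lra.
by move: gu; rewrite /dg /= e1 e2 subrr normr0 leNgt eps0.
Qed.

(** Finite trigonometric sums. *)
Definition trigsum (s : seq (R[i] * freq)) z : R[i] :=
  \sum_(p <- s) p.1 * character p.2 z.

Lemma trigsumM s t : exists u, forall z, trigsum u z = trigsum s z * trigsum t z.
Proof.
exists [seq (p.1 * q.1, p.2 + q.2) | p <- s, q <- t] => z.
rewrite /trigsum big_allpairs_dep /= mulr_suml; apply: eq_bigr => p _.
by rewrite mulr_sumr; apply: eq_bigr => q _; rewrite characterD; ring.
Qed.

Lemma kern_trigsum (r : nat) : exists s, forall z z',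
  (kern z z' ^+ r)%:C = trigsum s (z.1 - z'.1, z.2 - z'.2).
Proof.
elim: r => [|r [s IH]].
  exists [:: (1, 0)] => z z'.
  by rewrite /trigsum big_seq1 /= mul1r character0.
pose s1 : seq (R[i] * freq) := [:: (2, 0); (2^-1, (1, 0)); (2^-1, (-1, 0));
  (2^-1, (0, 1)); (2^-1, (0, -1))].
have E z z' : (kern z z')%:C = trigsum s1 (z.1 - z'.1, z.2 - z'.2).
  rewrite /trigsum /s1 !big_cons big_nil /= addr0 character0 mulr1.
  have -> : (-1, 0) = - (1, 0) :> freq by [].
  have -> : (0, -1) = - (0, 1) :> freq by [].
  rewrite !characterE !phaseN !cosN !sinN /kern.
  have -> : phase (1, 0) (z.1 - z'.1, z.2 - z'.2) = 2 * pi * (z.1 - z'.1).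
    by rewrite /phase /= mul1r mul0r addr0.
  have -> : phase (0, 1) (z.1 - z'.1, z.2 - z'.2) = 2 * pi * (z.2 - z'.2).
    by rewrite /phase /= mul1r mul0r add0r.
  have h2 : 2^-1 = (2^-1 : R)%:C :> R[i] by rewrite rmorphV ?unitfE ?pnatr_eq0// rmorph_nat.
  rewrite h2; apply: complexP; rewrite ?ReD ?ImD ?ReM ?ImM /=.
  - by rewrite !mul0r !subr0; lra.
  - by rewrite !mul0r; lra.
have [u Hu] := trigsumM s1 s; exists u => z z'.
by rewrite exprS rmorphM /= IH E Hu.
Qed.

(** The convolution with a power of the kernel, not normalised. *)
Definition kconv (r : nat) (f : R * R -> R[i]) z : R[i] :=
  torus_int (fun z' => f z' * (kern z z' ^+ r)%:C).

Lemma trigsum_shift s z z' : trigsum s (z.1 - z'.1, z.2 - z'.2) =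
  \sum_(p <- s) p.1 * character p.2 z * character (- p.2) z'.
Proof.
apply: eq_bigr => p _; rewrite -mulrA; congr (_ * _).
rewrite !characterE.
have -> : phase p.2 (z.1 - z'.1, z.2 - z'.2) = phase p.2 z + phase (- p.2) z'.
  by rewrite phaseN /phase /=; ring.
by rewrite cosD sinD; apply: complexP; rewrite ?ReM ?ImM //= addrC.
Qed.

Lemma torus_int_bigsum (I : Type) (s : seq I) (h : I -> R * R -> R[i]) :
  (forall i, ccont (h i)) ->
  ccont (fun z => \sum_(i <- s) h i z) /\
  torus_int (fun z => \sum_(i <- s) h i z) = \sum_(i <- s) torus_int (h i).
Proof.
move=> ch; elim: s => [|i s [IHc IH]].
  have -> : (fun z => \sum_(i <- [::]) h i z) = fun=> 0.
    by apply/funext => z; rewrite big_nil.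
  by rewrite big_nil torus_int0; split => //; exact: ccont_cst.
have -> : (fun z => \sum_(j <- i :: s) h j z) = fun z => h i z + \sum_(j <- s) h j z.
  by apply/funext => z; rewrite big_cons.
by rewrite big_cons torus_intD// IH; split => //; exact: ccontD.
Qed.

Lemma kconvE (r : nat) : exists s, forall f, ccont f -> forall z,
  kconv r f z = \sum_(p <- s) p.1 * fun_coef f p.2 * character p.2 z.
Proof.
have [s Hs] := kern_trigsum r; exists s => f cf z.
have cc k : ccont (fun z' => f z' * character (- k) z').
  by apply: ccontM => //; exact: ccont_character.
rewrite /kconv (@eq_torus_int _ _ (fun z' => \sum_(p <- s)
   (p.1 * character p.2 z) * (f z' * character (- p.2) z'))); last first.
  move=> z'; rewrite Hs trigsum_shift mulr_sumr; apply: eq_bigr => p _; ring.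
have [_ ->] := @torus_int_bigsum _ s (fun p z' =>
   (p.1 * character p.2 z) * (f z' * character (- p.2) z'))
   (fun p => ccontM (ccont_cst _) (cc _)).
apply: eq_bigr => p _; rewrite torus_intZ//.
by rewrite -/(fun_coef f p.2); ring.
Qed.

(** The mass of a power of the kernel; it does not depend on the base point
    ([tint_kern]). *)
Definition kmass (r : nat) : R := tint (fun z' => kern 0 z' ^+ r).

Lemma tint_kern r z : tint (fun z' => kern z z' ^+ r) = kmass r.
Proof.
have [s Hs] := kconvE r.
have c1 : ccont (fun _ : R * R => 1 : R[i]) by exact: ccont_cst.
have fc1 k : fun_coef (fun _ : R * R => 1 : R[i]) k = (k == 0)%:R.
  rewrite /fun_coef -oppr_eq0 -torus_int_character.
  by apply: eq_torus_int => z'; rewrite mul1r.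
have E z0 : tint (fun z' => kern z0 z' ^+ r) =
    Re (\sum_(p <- s) p.1 * (p.2 == 0)%:R).
  have := Hs _ c1 z0 => /(congr1 (@complex.Re R)).
  rewrite /kconv /= => H.
  transitivity (Re (torus_int (fun z' => (fun=> 1) z' * (kern z0 z' ^+ r)%:C))).
    by apply: eq_tint => z'; rewrite mul1r.
  rewrite -[LHS]/(_ (kconv r (fun=> 1) z0)) Hs//; congr Re.
  apply: eq_bigr => p _; rewrite fc1; case: eqP => [->|_].
    by rewrite character0 mulr1.
  by rewrite mulr0 mul0r.
by rewrite E /kmass E.
Qed.

Lemma cts_kern_r z r : continuous (fun z' => kern z z' ^+ r).
Proof. by apply: ctsX; apply: cts_kern; [move=> ?; exact: cvg_cst|move=> ?; exact: cvg_id]. Qed.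

(** The mass of the powers of the kernel decreases more slowly than any
    geometric sequence of ratio less than 4. *)
Lemma kmass_ge (B : R) : 0 <= B -> B < 4 ->
  exists2 d : R, 0 < d & forall r, B ^+ r * d <= kmass r.
Proof.
move=> B0 B4.
have ch : cos (2 * pi * t) @[t --> (0 : R)] --> cos (2 * pi * 0 : R).
  apply: (@continuous_comp _ _ _ (fun t => 2 * pi * t) cos).
    by apply: cvgM; [exact: cvg_cst|exact: cvg_id].
  exact: continuous_cos.
have v1 : cos (2 * pi * 0) = 1 :> R by rewrite mulr0 cos0.
move: ch; rewrite v1 => /cvgrPdist_lt /(_ ((4 - B) / 2)).
have e0 : 0 < (4 - B) / 2 by rewrite divr_gt0// subr_gt0.
move=> /(_ e0) /nbhs_ballP[r0 /= r00 Hr].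
pose dl := Num.min r0 1.
have dl0 : 0 < dl by rewrite lt_min r00 ltr01.
have dl1 : dl <= 1 by rewrite ge_min lexx orbT.
have dlr : dl <= r0 by rewrite ge_min lexx.
have near0 t : `[0, dl[%classic t -> 1 - (4 - B) / 2 <= cos (2 * pi * (0 - t)).
  rewrite /= in_itv /= => /andP[t0 td]; rewrite sub0r mulrN cosN.
  have := Hr t; rewrite /ball /= sub0r normrN ger0_norm// => /(_ (lt_le_trans td dlr)).
  by rewrite ltr_norml => /andP[_ h]; lra.
exists (dl ^+ 2); first by rewrite exprn_gt0.
move=> r; rewrite /kmass /tint /Rintegral.
pose Q : set (R * R) := `[0, dl[%classic `*` `[0, dl[%classic.
have mQ : measurable (Q : set (measurableTypeR R * measurableTypeR R)) by exact: measurableX.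
have Qsq : Q `<=` square.
  move=> z [/= z1 z2]; split; [move: z1|move: z2]; rewrite /= !in_itv /= => /andP[-> h];
    exact: lt_le_trans h dl1.
have muQ : plane_measure Q = (dl ^+ 2)%:E.
  by rewrite /Q product_measure1E//= !lebesgue_measure_itv/= lte_fin dl0 -!EFinD subr0 -EFinM.
have ci := continuous_integrable_square (@cts_kern_r 0 r).
rewrite -lee_fin fineK; last first.
  exact: (integrable_fin_num measurable_square ci).
rewrite EFinM -muQ -integral_cst//.
apply: (@le_trans _ _ (\int[plane_measure]_(z in Q) (kern 0 z ^+ r)%:E)%E).
  apply: ge0_le_integral => //.
  - by move=> z _; rewrite lee_fin exprn_ge0.
  - by apply/measurable_EFinP; apply: continuous_plane_measurable => //; exact: cts_kern_r.
  - move=> z [z1 z2]; rewrite lee_fin lerXn2r// ?nnegrE ?kern_ge0//.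
    by have := near0 _ z1; have := near0 _ z2; rewrite /kern /=; lra.
apply: ge0_subset_integral => //; first exact: measurable_square.
- by apply/measurable_EFinP; apply: continuous_plane_measurable; [exact: measurable_square|exact: cts_kern_r].
- by move=> z _; rewrite lee_fin exprn_ge0// kern_ge0.
Qed.

End Kernel.

(** * Uniqueness of Fourier coefficients *)

Section Density.
Context {R : realType}.
Implicit Types (z : R * R) (w : seq bool) (k : freq) (f : R * R -> R[i]).

Lemma kmass_gt0 r : 0 < kmass r :> R.
Proof.
have [d d0 H] := @kmass_ge R 1 ler01 (ltr_nat R 1 4).
by apply: lt_le_trans (H r); rewrite expr1n mul1r.
Qed.

Lemma kernel_approx (g : R * R -> R) (eps : R) : rsmooth g -> 0 < eps ->
  \forall r \near \oo, forall z,
    `|tint (fun z' => g z' * kern z z' ^+ r) - g z * kmass r| <= eps * kmass r.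
Proof.
move=> sg eps0; have cg := rsmooth_continuous sg.
have [M M0 gM] := rsmooth_bounded sg.
have e2 : 0 < eps / 2 by rewrite divr_gt0.
have [A [A0 A4 HA]] := kern_far cg (rsmooth_px sg) (rsmooth_py sg) e2.
(* any number strictly between the bound [A] far from the diagonal and 4 *)
pose B := (A + 4) / 2.
have AB : A < B by rewrite /B; lra.
have B4 : B < 4 by rewrite /B; lra.
have B0 : 0 < B by exact: le_lt_trans AB.
have [d d0 Hd] := kmass_ge (ltW B0) B4.
have q0 : 0 <= A / B by exact: divr_ge0 A0 (ltW B0).
have q1 : `|A / B| < 1.
  by rewrite ger0_norm// ltr_pdivrMr// mul1r.
have M1 : 0 < 2 * M + 1 by rewrite ltr_wpDl// mulr_ge0.
have e3 : 0 < eps / 2 * d / (2 * M + 1) by rewrite divr_gt0// mulr_gt0.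
have /cvgrPdist_lt /(_ _ e3) := cvg_expr q1.
apply: filterS => r; rewrite sub0r normrN => qr z.
have ck := @cts_kern_r R z r.
have cgk : continuous (fun z' => g z' * kern z z' ^+ r) by exact: ctsM.
have -> : tint (fun z' => g z' * kern z z' ^+ r) - g z * kmass r =
    tint (fun z' => (g z' - g z) * kern z z' ^+ r).
  rewrite -(tint_kern r z) -tintZ// -tintB//; last exact: ctsZ.
  by apply: eq_tint => z'; rewrite mulrBl.
have cD : continuous (fun z' => (g z' - g z) * kern z z' ^+ r).
  by apply: ctsM => //; apply: ctsB => //; exact: cts_cst.
have P z' : `|(g z' - g z) * kern z z' ^+ r| <= eps / 2 * kern z z' ^+ r + 2 * M * A ^+ r.
  have k0 : 0 <= kern z z' ^+ r by rewrite exprn_ge0// kern_ge0.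
  rewrite normrM (ger0_norm k0).
  have [far|near_] := leP (eps / 2) `|g z - g z'|.
    have kA : kern z z' ^+ r <= A ^+ r by rewrite lerXn2r ?nnegrE ?kern_ge0//; exact: HA.
    have g2 : `|g z' - g z| <= 2 * M.
      by apply: le_trans (ler_normB _ _) _; have := gM z; have := gM z'; lra.
    apply: (@le_trans _ _ (2 * M * A ^+ r)); first exact: ler_pM.
    by rewrite lerDr mulr_ge0// ltW.
  rewrite distrC; apply: (@le_trans _ _ (eps / 2 * kern z z' ^+ r)).
    by rewrite ler_wpM2r// ltW.
  by rewrite lerDl !mulr_ge0// exprn_ge0.
have T : tint (fun z' => eps / 2 * kern z z' ^+ r + 2 * M * A ^+ r) =
    eps / 2 * kmass r + 2 * M * A ^+ r.
  rewrite tintD; [|exact: ctsZ|exact: cts_cst].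
  by rewrite tintZ// tint_cst tint_kern.
have tail : 2 * M * A ^+ r <= eps / 2 * kmass r.
  apply: (@le_trans _ _ (eps / 2 * (B ^+ r * d))); last by rewrite ler_pM2l.
  have AE : A ^+ r = `|(A / B) ^+ r| * B ^+ r.
    by rewrite ger0_norm ?exprn_ge0// expr_div_n divfK// expf_neq0// gt_eqF.
  have Br : 0 < B ^+ r by rewrite exprn_gt0.
  rewrite AE; move: (`|(A / B) ^+ r|) (B ^+ r) Br (normr_ge0 ((A / B) ^+ r)) qr
    => x y y0 x0 qx.
  have -> : 2 * M * (x * y) = 2 * M * x * y by ring.
  have -> : eps / 2 * (y * d) = eps / 2 * d * y by rewrite [y * d]mulrC mulrA.
  rewrite ler_pM2r//.
  apply: (@le_trans _ _ ((2 * M + 1) * x)).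
    by rewrite ler_wpM2r// lerDl.
  by rewrite -ler_pdivlMl// mulrC ltW.
have H : `|tint (fun z' => (g z' - g z) * kern z z' ^+ r)| <=
    tint (fun z' => eps / 2 * kern z z' ^+ r + 2 * M * A ^+ r).
  have cb : continuous (fun z' => eps / 2 * kern z z' ^+ r + 2 * M * A ^+ r).
    by apply: ctsD; [exact: ctsZ|exact: cts_cst].
  rewrite ler_norml; apply/andP; split.
  - rewrite -tintN//; apply: le_tint => //; first exact: ctsN.
    by move=> z' _; have := P z'; rewrite ler_norml => /andP[].
  - apply: le_tint => // z' _; by have := P z'; rewrite ler_norml => /andP[].
apply: le_trans H _; rewrite T.
have -> : eps * kmass r = eps / 2 * kmass r + eps / 2 * kmass r.
  by rewrite -mulrDl -splitr.
by rewrite lerD2l.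
Qed.

Lemma kconv_Re r f z : Re (kconv r f z) = tint (fun z' => Re (f z') * kern z z' ^+ r).
Proof. by apply: eq_tint => z'; rewrite ReM /= mulr0 subr0. Qed.

Lemma kconv_Im r f z : Im (kconv r f z) = tint (fun z' => Im (f z') * kern z z' ^+ r).
Proof. by apply: eq_tint => z'; rewrite ImM /= mulr0 add0r. Qed.

(** The trigonometric polynomials that approximate [f]. They depend on the
    Fourier coefficients of [f] alone ([approximE]). *)
Definition approxim r f z : R[i] := ((kmass r)^-1)%:C * kconv r f z.

Lemma approxim_unif f (eps : R) : smooth f -> 0 < eps ->
  \forall r \near \oo, forall z, normc (approxim r f z - f z) <= eps.
Proof.
move=> /smoothP[fr fi] eps0; have e2 : 0 < eps / 2 by rewrite divr_gt0.
near=> r; move=> z; apply: le_trans (normc_le _) _.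
have m0 := kmass_gt0 r.
have H (g : R * R -> R) (t : R) : `|t - g z * kmass r| <= eps / 2 * kmass r ->
    `|(kmass r)^-1 * t - g z| <= eps / 2.
  move=> H; rewrite -(ler_pM2r m0) -{2}(gtr0_norm m0) -normrM mulrBl.
  by rewrite mulrAC mulVf ?mul1r// gt_eqF.
rewrite [leRHS]splitr; apply: lerD.
- have -> : Re (approxim r f z - f z) =
      (kmass r)^-1 * tint (fun z' => Re (f z') * kern z z' ^+ r) - Re (f z).
    by rewrite -kconv_Re ReD ReM /= mul0r subr0; case: (f z).
  apply: (H (fun z => Re (f z))).
  by move: (z); near: r; exact: kernel_approx.
- have -> : Im (approxim r f z - f z) =
      (kmass r)^-1 * tint (fun z' => Im (f z') * kern z z' ^+ r) - Im (f z).
    by rewrite -kconv_Im ImD ImM /= mul0r addr0; case: (f z).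
  apply: (H (fun z => Im (f z))).
  by move: (z); near: r; exact: kernel_approx.
Unshelve. all: by end_near. Qed.

Lemma trigsum_smooth s : smooth (@trigsum R s) /\
  forall w, dword w (@trigsum R s) = trigsum [seq (p.1 * symbw w p.2, p.2) | p <- s].
Proof.
elim: s => [|p s [IHs IH]].
  have -> : @trigsum R [::] = fun=> 0 by apply/funext => z; rewrite /trigsum big_nil.
  split=> [|w /=]; first exact: smooth0.
  exact: dword0.
have -> : @trigsum R (p :: s) = fun z => p.1 * character p.2 z + trigsum s z.
  by apply/funext => z; rewrite /trigsum big_cons.
split; first exact: smooth_lin (smooth_character _) IHs.
move=> w; rewrite (dword_lin _ _ (smooth_character _) IHs) IH dword_character.
by apply/funext => z; rewrite /trigsum /= big_cons /= mulrA.
Qed.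

Lemma approximE (r : nat) : exists s : seq (R[i] * freq), forall f, ccont f ->
  approxim r f = trigsum [seq (p.1 * fun_coef f p.2, p.2) | p <- s].
Proof.
have [s Hs] := @kconvE R r.
exists [seq (((kmass r)^-1)%:C * p.1, p.2) | p <- s] => f cf.
apply/funext => z; rewrite /approxim Hs// /trigsum !big_map mulr_sumr.
by apply: eq_bigr => p _ /=; rewrite !mulrA.
Qed.

Lemma approxim_smooth r f : smooth f -> smooth (approxim r f) /\
  forall w, dword w (approxim r f) = approxim r (dword w f).
Proof.
move=> sf; have [s Hs] := approximE r.
rewrite Hs; last exact: smooth_ccont.
have [ss dw] := trigsum_smooth [seq (p.1 * fun_coef f p.2, p.2) | p <- s].
split=> // w; rewrite dw Hs; last exact/smooth_ccont/smooth_dword.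
rewrite -map_comp; congr trigsum; apply: eq_map => p /=.
by rewrite fun_coef_dword// -mulrA [_ * symbw w _]mulrC.
Qed.

Lemma near_words (P : seq bool -> nat -> Prop) N :
  (forall w, \forall r \near \oo, P w r) ->
  \forall r \near \oo, forall w, (size w <= N)%N -> P w r.
Proof.
elim: N P => [|N IH] P HP.
  apply: filterS (HP [::]) => r P0 w; rewrite leqn0 size_eq0 => /eqP ->; exact: P0.
have H1 := IH (fun w => P (true :: w)) (fun w => HP (true :: w)).
have H2 := IH (fun w => P (false :: w)) (fun w => HP (false :: w)).
apply: filterS3 (HP [::]) H1 H2 => r P0 P1 P2 [|[] w] //= sw; [exact: P1|exact: P2].
Qed.

Lemma dist0 (u : torus_distribution R) : u (fun=> 0) = 0.
Proof.
have := dist_linear u 1 smooth0 smooth0.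
have -> : (fun _ : R * R => 1 * 0 + 0 : R[i]) = fun=> 0.
  by apply/funext => z; rewrite mulr0 addr0.
rewrite mul1r => H; apply: (@addrI _ (u (fun=> 0))).
by rewrite addr0 -H.
Qed.

Lemma dist_trigsum (u : torus_distribution R) s :
  u (trigsum s) = \sum_(p <- s) p.1 * coef u (- p.2).
Proof.
elim: s => [|p s IH].
  have -> : @trigsum R [::] = fun=> 0 by apply/funext => z; rewrite /trigsum big_nil.
  by rewrite dist0 big_nil.
have -> : @trigsum R (p :: s) = fun z => p.1 * character p.2 z + trigsum s z.
  by apply/funext => z; rewrite /trigsum big_cons.
rewrite dist_linear; [|exact: smooth_character|by have [] := trigsum_smooth s].
by rewrite IH big_cons /coef opprK.
Qed.

(** A distribution is determined by its Fourier coefficients. *)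
Lemma dist_coef_inj (u v : torus_distribution R) :
  (forall k, coef u k = coef v k) -> u = v.
Proof.
move=> uv; apply: distribution_ext => f sf.
have [Nu [Au bu]] := dist_bounded u; have [Nv [Av bv]] := dist_bounded v.
apply/eqP; rewrite -subr_eq0; apply/eqP; apply: normc_eq0.
apply/ler_addgt0Pr => eps eps0; rewrite add0r.
(* [u] and [v] agree on the approximation, and are small on its difference
   with [f] *)
pose C := `|Au| + `|Av| + 1.
have C0 : 0 < C by rewrite ltr_wpDl// addr_ge0.
pose del := eps / C; have del0 : 0 < del by rewrite divr_gt0.
have /near_words H : forall w, \forall r \near \oo, forall z,
    normc (approxim r (dword w f) z - dword w f z) <= del.
  by move=> w; apply: approxim_unif => //; exact: smooth_dword.
have [r Hr] : exists r, forall w, (size w <= maxn Nu Nv)%N -> forall z,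
    normc (approxim r (dword w f) z - dword w f z) <= del.
  by have [r _ Hr] := H (maxn Nu Nv); exists r; exact: (Hr r (leqnn r)).
have [sp dp] := approxim_smooth r sf.
pose q := fun z => -1 * f z + approxim r f z.
have sq : smooth q by exact: smooth_lin.
have qb N : (N <= maxn Nu Nv)%N -> forall w z, (size w <= N)%N -> normc (dword w q z) <= del.
  move=> NN w z wN; rewrite /q (dword_lin _ _ sf sp) dp mulN1r addrC.
  by apply: Hr; exact: leq_trans wN NN.
have upv : u (approxim r f) = v (approxim r f).
  have [s Hs] := approximE r; rewrite Hs; last exact: smooth_ccont.
  by rewrite !dist_trigsum; apply: eq_bigr => p _; rewrite uv.
have E : u f - v f = v q - u q.
  by rewrite /q !dist_linear// upv; ring.
rewrite E.
have n1 := bu _ _ sq (qb _ (leq_maxl _ _)).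
have n2 := bv _ _ sq (qb _ (leq_maxr _ _)).
have tri : normc (v q - u q) <= normc (v q) + normc (u q).
  have := normcD (v q) (- u q).
  by rewrite normc_opp.
apply: le_trans tri _.
have -> : eps = C * del by rewrite /del mulrC divfK// gt_eqF.
have a1 : Au * del <= `|Au| * del by rewrite ler_pM2r// ler_norm.
have a2 : Av * del <= `|Av| * del by rewrite ler_pM2r// ler_norm.
rewrite /C !mulrDl mul1r; lra.
Qed.

Lemma dist_of_coef_eq (u : torus_distribution R) (c : freq -> R[i]) :
  (forall k, coef u k = c k) -> dist_of_coef c = u.
Proof.
move=> uc; apply: dist_coef_inj => k; rewrite uc.
by rewrite /dist_of_coef; case: xgetP => [w _ ->//|/(_ u)].
Qed.

(** A smooth function is determined by its Fourier coefficients. *)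
Lemma smooth_coef_inj f g : smooth f -> smooth g ->
  (forall k, fun_coef f k = fun_coef g k) -> f = g.
Proof.
move=> sf sg fg; apply/funext => z; apply/eqP; rewrite -subr_eq0; apply/eqP.
apply: normc_eq0; apply/ler_addgt0Pr => eps eps0; rewrite add0r.
have e2 : 0 < eps / 2 by rewrite divr_gt0.
have H := filterI (approxim_unif sf e2) (approxim_unif sg e2).
have [r _ Hr] := H; have [Hf Hg] := Hr r (leqnn r).
have E : approxim r f = approxim r g.
  have [s Hs] := approximE r; rewrite !Hs; try exact: smooth_ccont.
  by congr trigsum; apply: eq_map => p; rewrite fg.
have -> : f z - g z = (approxim r g z - g z) + - (approxim r f z - f z).
  by rewrite E; ring.
apply: le_trans (normcD _ _) _.
by rewrite normc_opp [leRHS]splitr lerD.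
Qed.

Lemma smooth_of_coef_eq f (c : freq -> R[i]) : smooth f ->
  (forall k, fun_coef f k = c k) -> smooth_of_coef c = f.
Proof.
move=> sf fc; rewrite /smooth_of_coef; case: xgetP => [g _ [sg gc]|/(_ f)[]//].
by apply: smooth_coef_inj => // k; rewrite gc fc.
Qed.

End Density.

(** * Weighted averages of horizontal translates *)

Section Averages.
Context {R : realType}.
Implicit Types (p : R -> R) (g : R * R -> R) (x y s t : R) (z : R * R) (w : seq bool).

Lemma is_derive_quadratic (h : R -> R) x (d K : R) :
  (forall t, `|h (x + t) - h x - t * d| <= K * t ^+ 2) -> is_derive x 1 h d.
Proof.
move=> H.
have L : (fun t => t^-1 *: (h (t *: 1 + x) - h x)) @ 0^' --> d.
  apply/cvgrPdist_le => eps eps0.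
  have K1 : 0 < `|K| + 1 by rewrite ltr_wpDl.
  have b0 : 0 < eps / (`|K| + 1) by rewrite divr_gt0.
  exists (eps / (`|K| + 1)) => //= t; rewrite /ball /= sub0r normrN => tb t0.
  rewrite /GRing.scale /= mulr1 [t + x]addrC.
  have -> : d - t^-1 * (h (x + t) - h x) = - (t^-1 * (h (x + t) - h x - t * d)).
    by field.
  rewrite normrN normrM normfV ler_pdivrMl ?normr_gt0//.
  apply: le_trans (H t) _.
  rewrite -[t ^+ 2]real_normK ?num_real// expr2 mulrA [leRHS]mulrC ler_wpM2r//.
  apply: (@le_trans _ _ ((`|K| + 1) * `|t|)).
    by rewrite ler_wpM2r// (le_trans (ler_norm _))// lerDl.
  by rewrite -ler_pdivlMl// mulrC ltW.
split; first by apply/cvg_ex; exists d.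
by rewrite /derive; apply: cvg_lim.
Qed.

(** Taylor's estimate at order one, for a Lipschitz derivative. *)
Lemma taylor_lipschitz (h dh : R -> R) (L : R) :
  (forall x, is_derive x 1 h (dh x)) ->
  (forall x y, `|dh x - dh y| <= L * `|x - y|) ->
  forall x t, `|h (x + t) - h x - t * dh x| <= L * t ^+ 2.
Proof.
move=> dh1 lip.
have ch (a b : R) : {within `[a, b], continuous h}.
  apply: continuous_subspaceT => t; apply: differentiable_continuous.
  apply/derivable1_diffP; exact: is_derive_derivable (dh1 t).
have F x t c : `|c - x| <= `|t| -> h (x + t) - h x = dh c * t ->
    `|h (x + t) - h x - t * dh x| <= L * t ^+ 2.
  move=> ct ->; rewrite [t * _]mulrC -mulrBl normrM -[t ^+ 2]real_normK ?num_real//.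
  rewrite expr2 mulrA ler_wpM2r//; apply: le_trans (lip _ _) _.
  rewrite ler_wpM2l//.
  have := lip 0 1; rewrite sub0r normrN normr1 mulr1; exact: le_trans.
move=> x t; have [t0|t0|->] := ltgtP t 0.
- have xt : x + t < x by rewrite gtrDl.
  have [c] := MVT xt (fun t _ => dh1 t) (ch _ _).
  rewrite in_itv /= => /andP[c1 c2] E; apply: (F x t c).
    by rewrite !ler0_norm ?subr_le0 ?ltW//; lra.
  by rewrite -opprB E; ring.
- have xt : x < x + t by rewrite ltrDl.
  have [c] := MVT xt (fun t _ => dh1 t) (ch _ _).
  rewrite in_itv /= => /andP[c1 c2] E; apply: (F x t c).
    by rewrite !ger0_norm ?subr_ge0 ?ltW//; lra.
  by rewrite E; ring.
- by rewrite addr0 subrr mul0r subr0 normr0 expr0n mulr0.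
Qed.

(** Averages of the horizontal translates of [g] with the weight [p]. *)
Definition wavg p g z : R := tint (fun z' => p z'.1 * g (z.1 + z'.1, z.2)).

Section Weight.
Variable p : R -> R.
Hypothesis cp : continuous p.
Variable C : R.
Hypothesis C0 : 0 <= C.
Hypothesis pC : forall t, 0 <= t <= 1 -> `|p t| <= C.

Lemma cts_translate g z : continuous g ->
  continuous (fun z' : R * R => g (z.1 + z'.1, z.2)).
Proof.
move=> cg; apply: (@continuous_of_fst _ (fun t => g (z.1 + t, z.2))).
move=> t; apply: (@continuous_comp _ _ _ (fun t => z.1 + t) (fun s => g (s, z.2))).
  by apply: cvgD; [exact: cvg_cst|exact: cvg_id].
exact: continuous_fst_slice.
Qed.

Lemma cts_wavg_integrand g z : continuous g ->
  continuous (fun z' : R * R => p z'.1 * g (z.1 + z'.1, z.2)).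
Proof.
by move=> cg; apply: ctsM; [exact: continuous_of_fst|exact: cts_translate].
Qed.

Lemma wavg_le (h : R * R -> R) (M : R) : continuous h ->
  (forall t, 0 <= t <= 1 -> `|h (t, 0)| <= M) -> (forall z, h z = h (z.1, 0)) ->
  `|tint (fun z' => p z'.1 * h z')| <= C * M.
Proof.
move=> ch hM h1.
apply: normr_tint; first by apply: ctsM => //; exact: continuous_of_fst.
move=> [t y] [/= ti _]; have {}ti : 0 <= t <= 1.
  by move: ti; rewrite in_itv /= => /andP[-> /ltW].
by rewrite normrM h1 ler_pM//; [exact: pC|exact: hM].
Qed.

Lemma wavg_diff_le g1 g2 z1 z2 (M : R) : continuous g1 -> continuous g2 ->
  (forall t, `|g1 (z1.1 + t, z1.2) - g2 (z2.1 + t, z2.2)| <= M) ->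
  `|wavg p g1 z1 - wavg p g2 z2| <= C * M.
Proof.
move=> c1 c2 H; rewrite /wavg -tintB; try exact: cts_wavg_integrand.
rewrite (@eq_tint _ _ (fun z' => p z'.1 *
   (g1 (z1.1 + z'.1, z1.2) - g2 (z2.1 + z'.1, z2.2)))); last first.
  by move=> z'; rewrite mulrBr.
apply: (@wavg_le (fun z' => g1 (z1.1 + z'.1, z1.2) - g2 (z2.1 + z'.1, z2.2))) => //.
by apply: ctsB; exact: cts_translate.
Qed.

Lemma wavg_taylor_le g1 g2 g3 z1 z2 (a M : R) :
  continuous g1 -> continuous g2 -> continuous g3 ->
  (forall t, `|g1 (z1.1 + t, z1.2) - g2 (z2.1 + t, z2.2)
     - a * g3 (z2.1 + t, z2.2)| <= M) ->
  `|wavg p g1 z1 - wavg p g2 z2 - a * wavg p g3 z2| <= C * M.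
Proof.
move=> c1 c2 c3 H.
have i1 := cts_wavg_integrand (z := z1) c1; have i2 := cts_wavg_integrand (z := z2) c2.
have i3 := cts_wavg_integrand (z := z2) c3.
rewrite /wavg -tintB// -tintZ// -tintB; [|exact: ctsB|exact: ctsZ].
rewrite (@eq_tint _ _ (fun z' => p z'.1 *
   (g1 (z1.1 + z'.1, z1.2) - g2 (z2.1 + z'.1, z2.2) - a * g3 (z2.1 + z'.1, z2.2)))); last first.
  by move=> z'; ring.
apply: (@wavg_le (fun z' => g1 (z1.1 + z'.1, z1.2) - g2 (z2.1 + z'.1, z2.2) - a * g3 (z2.1 + z'.1, z2.2))) => //.
apply: ctsB; first by apply: ctsB; exact: cts_translate.
by apply: ctsZ; exact: cts_translate.
Qed.

Lemma continuous_wavg g : rsmooth g -> continuous (wavg p g).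
Proof.
move=> sg; have cg := rsmooth_continuous sg.
have [L L0 [lx ly]] := rsmooth_lipschitz sg.
move=> z; apply/cvgrPdist_le => eps eps0.
have K0 : 0 < C * L * 2 + 1 by rewrite ltr_wpDl// !mulr_ge0.
have b0 : 0 < eps / (C * L * 2 + 1) by rewrite divr_gt0.
exists (ball z.1 (eps / (C * L * 2 + 1)), ball z.2 (eps / (C * L * 2 + 1))).
  by split; exact: nbhsx_ballx.
move=> z' [/= z1 z2].
apply: (@le_trans _ _ (C * (L * (`|z.1 - z'.1| + `|z.2 - z'.2|)))).
  apply: wavg_diff_le => // t.
  have -> : g (z.1 + t, z.2) - g (z'.1 + t, z'.2) =
     (g (z.1 + t, z.2) - g (z'.1 + t, z.2)) + (g (z'.1 + t, z.2) - g (z'.1 + t, z'.2)) by ring.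
  apply: le_trans (ler_normD _ _) _; rewrite mulrDr; apply: lerD => //.
  by apply: le_trans (lx _ _ _) _; rewrite (_ : z.1 + t - (z'.1 + t) = z.1 - z'.1)//; ring.
move: z1 z2; rewrite /ball /= => z1 z2.
have s2 : `|z.1 - z'.1| + `|z.2 - z'.2| <= 2 * (eps / (C * L * 2 + 1)) by lra.
have -> : eps = (C * L * 2 + 1) * (eps / (C * L * 2 + 1)).
  by rewrite mulrC divfK// gt_eqF.
set b := eps / _ in b0 s2 *; rewrite mulrA.
apply: (@le_trans _ _ (C * L * (2 * b))); first by rewrite ler_wpM2l// mulr_ge0.
by rewrite mulrA mulrDl mul1r lerDl ltW.
Qed.

Lemma wavg_derx g x y : rsmooth g ->
  is_derive x 1 (fun s => wavg p g (s, y)) (wavg p (pdx g) (x, y)).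
Proof.
move=> sg; have sd := rsmooth_pdx sg.
have cg := rsmooth_continuous sg; have cd := rsmooth_continuous sd.
have [L L0 [lx _]] := rsmooth_lipschitz sd.
apply: (@is_derive_quadratic _ _ _ (C * L)) => t; rewrite -mulrA.
apply: (@wavg_taylor_le g g (pdx g) (x + t, y) (x, y)) => // s /=.
rewrite [x + t + s]addrAC.
apply: (@taylor_lipschitz (fun u => g (u, y)) (fun u => pdx g (u, y)) L) => // u.
exact: rsmooth_derx.
Qed.

Lemma wavg_dery g x y : rsmooth g ->
  is_derive y 1 (fun s => wavg p g (x, s)) (wavg p (pdy g) (x, y)).
Proof.
move=> sg; have sd := rsmooth_pdy sg.
have cg := rsmooth_continuous sg; have cd := rsmooth_continuous sd.
have [L L0 [_ ly]] := rsmooth_lipschitz sd.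
apply: (@is_derive_quadratic _ _ _ (C * L)) => t; rewrite -mulrA.
apply: (@wavg_taylor_le g g (pdy g) (x, y + t) (x, y)) => // s /=.
apply: (@taylor_lipschitz (fun u => g (x + s, u)) (fun u => pdy g (x + s, u)) L) => //= u.
exact: rsmooth_dery.
Qed.

Lemma pdx_wavg g : rsmooth g -> pdx (wavg p g) = wavg p (pdx g).
Proof. by move=> sg; apply/funext => -[x y]; exact: pdx_is_derive (wavg_derx x y sg). Qed.

Lemma pdy_wavg g : rsmooth g -> pdy (wavg p g) = wavg p (pdy g).
Proof. by move=> sg; apply/funext => -[x y]; exact: pdy_is_derive (wavg_dery x y sg). Qed.

Lemma rsmooth_wavg g : rsmooth g -> rsmooth (wavg p g).
Proof.
move=> sg; apply: (@rsmooth_class _ (fun h => exists2 g, rsmooth g & h = wavg p g)).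
- move=> _ [{}g {}sg ->]; split.
  + exact: continuous_wavg.
  + move=> [x y]; split => /=.
    * exact: is_derive_derivable (wavg_derx x y sg).
    * exact: is_derive_derivable (wavg_dery x y sg).
  + by rewrite pdx_wavg//; exists (pdx g) => //; exact: rsmooth_pdx.
  + by rewrite pdy_wavg//; exists (pdy g) => //; exact: rsmooth_pdy.
- by move=> x y; apply: eq_tint => z' /=; rewrite addrAC (rsmooth_px sg).
- by move=> x y; apply: eq_tint => z' /=; rewrite (rsmooth_py sg).
- by exists g.
Qed.

(** Integration by parts in the averaging variable. *)
Lemma wavg_ibp (dp : R -> R) g : continuous dp ->
  (forall t, is_derive t 1 p (dp t)) -> rsmooth g ->
  wavg p (pdx g) = fun z => (p 1 - p 0) * g z - wavg dp g z.
Proof.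
move=> cdp dpp sg; have sd := rsmooth_pdx sg.
have cg := rsmooth_continuous sg; have cd := rsmooth_continuous sd.
apply/funext => -[x y]; apply/eqP; rewrite eq_sym subr_eq; apply/eqP.
have i1 := cts_wavg_integrand (z := (x, y)) cd.
have i2 : continuous (fun z' : R * R => dp z'.1 * g (x + z'.1, y)).
  by apply: ctsM; [exact: continuous_of_fst|exact: (cts_translate (z := (x, y)))].
rewrite /wavg /= -tintD//.
have D t : is_derive t 1 (fun t => p t * g (x + t, y))
    (p t * pdx g (x + t, y) + dp t * g (x + t, y)).
  have dI : is_derive t 1 (fun s : R => x + s) 1.
    apply: (@is_derive_quadratic _ _ _ 0) => u.
    have -> : x + (t + u) - (x + t) - u * 1 = 0 by ring.
    by rewrite normr0 mul0r.
  have dgt := @is_derive1_comp _ (fun u => g (u, y)) (fun s => x + s) _ _ _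
     (rsmooth_derx (x + t) y sg) dI.
  have H : is_derive t 1 (fun t => p t * g (x + t, y))
     (p t *: (pdx g (x + t, y) * 1) + g (x + t, y) *: dp t) := is_deriveM (dpp t) dgt.
  by apply: (is_derive_eq H); rewrite /GRing.scale /= mulr1 [g _ * _]mulrC.
rewrite (@tint_dx _ _ (fun z' => p z'.1 * g (x + z'.1, y))).
- rewrite (@eq_tint _ _ (fun=> (p 1 - p 0) * g (x, y))) ?tint_cst// => z /=.
  by rewrite addr0 (rsmooth_px sg) -mulrBl.
- exact: ctsD.
- exact: (cts_wavg_integrand (z := (x, y)) cg).
- by move=> [t s]; exact: is_derive_derivable (D t).
- by move=> [t s]; exact: is_derive_derive1 (D t).
Qed.

End Weight.

End Averages.

(** * The inverse of the horizontal derivative *)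

Section Antiderivative.
Context {R : realType}.
Implicit Types (g : R * R -> R) (f : R * R -> R[i]) (z : R * R) (k : freq) (t : R).

(** The weights of the averages used below: the derivatives of [wt1] and [wt2]
    are [wt0] and [- wt1], and [wt2] vanishes at 0 and 1. *)
Definition wt0 (t : R) : R := 1.
Definition wt1 (t : R) : R := t - 1 / 2.
Definition wt2 (t : R) : R := (t - t ^+ 2) / 2.

Let c0 : continuous wt0. Proof. exact: cts_cst. Qed.
Let cid : continuous (fun t : R => t). Proof. by move=> t; exact: cvg_id. Qed.
Let c1 : continuous wt1. Proof. by apply: ctsB => //; exact: cts_cst. Qed.
Let c2 : continuous wt2.
Proof. by apply: ctsM; [apply: ctsB => //; exact: ctsX|exact: cts_cst]. Qed.

Let b0 t : 0 <= t <= 1 -> `|wt0 t| <= 1. Proof. by rewrite normr1. Qed.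
Let b1 t : 0 <= t <= 1 -> `|wt1 t| <= 1.
Proof. by move=> /andP[? ?]; rewrite ler_norml /wt1; apply/andP; split; lra. Qed.
Let b2 t : 0 <= t <= 1 -> `|wt2 t| <= 1.
Proof. by move=> /andP[? ?]; rewrite ler_norml /wt2; apply/andP; split; nra. Qed.

Let d0 t : is_derive t 1 wt0 0.
Proof.
by apply: (@is_derive_quadratic _ _ _ _ 0) => s; rewrite /wt0 subrr mulr0 subrr normr0 mul0r.
Qed.

Let d1 t : is_derive t 1 wt1 1.
Proof.
apply: (@is_derive_quadratic _ _ _ _ 0) => s; rewrite /wt1.
have -> : t + s - 1 / 2 - (t - 1 / 2) - s * 1 = 0 by ring.
by rewrite normr0 mul0r.
Qed.

Let d2 t : is_derive t 1 wt2 (- wt1 t).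
Proof.
apply: (@is_derive_quadratic _ _ _ _ 1) => s; rewrite /wt2 /wt1.
have -> : (t + s - (t + s) ^+ 2) / 2 - (t - t ^+ 2) / 2 - s * - (t - 1 / 2) =
   - (s ^+ 2 / 2) by field.
rewrite normrN ger0_norm ?divr_ge0 ?sqr_ge0// mul1r ler_pdivrMr//.
by rewrite ler_peMr ?sqr_ge0// ler1n.
Qed.

Let s0 g : rsmooth g -> rsmooth (wavg wt0 g). Proof. exact: (rsmooth_wavg c0 ler01 b0). Qed.
Let s1 g : rsmooth g -> rsmooth (wavg wt1 g). Proof. exact: (rsmooth_wavg c1 ler01 b1). Qed.
Let s2 g : rsmooth g -> rsmooth (wavg wt2 g). Proof. exact: (rsmooth_wavg c2 ler01 b2). Qed.

Lemma pdx_wavg0 g : rsmooth g -> pdx (wavg wt0 g) = fun=> 0.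
Proof.
move=> sg; rewrite (pdx_wavg c0 b0 sg).
rewrite (wavg_ibp c0 (@cts_cst _ _ 0) d0 sg); apply/funext => z.
rewrite /wt0 subrr mul0r sub0r /wavg (@eq_tint _ _ (fun=> 0)) ?tint_cst ?oppr0//.
by move=> z'; rewrite mul0r.
Qed.

Lemma pdx_wavg1 g : rsmooth g -> pdx (wavg wt1 g) = fun z => g z - wavg wt0 g z.
Proof.
move=> sg; rewrite (pdx_wavg c1 b1 sg).
rewrite (wavg_ibp c1 c0 d1 sg); apply/funext => z; rewrite /wt1.
by congr (_ - _); rewrite -[RHS]mul1r; congr (_ * _); lra.
Qed.

Lemma wavg1_pdx g : rsmooth g -> wavg wt1 g = pdx (wavg wt2 g).
Proof.
move=> sg; rewrite (pdx_wavg c2 b2 sg).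
rewrite (wavg_ibp c2 (ctsN c1) d2 sg); apply/funext => z.
have -> : wt2 1 - wt2 0 = 0 by rewrite /wt2 expr1n expr0n /=; lra.
rewrite mul0r sub0r /wavg -tintN; last first.
  apply: ctsM; first exact: (continuous_of_fst (ctsN c1)).
  by apply: cts_translate; exact: rsmooth_continuous.
by apply: eq_tint => z'; rewrite mulNr opprK.
Qed.

(** The same average for a complex function. *)
Definition cwavg (p : R -> R) f z : R[i] :=
  wavg p (fun z => Re (f z)) z +i* wavg p (fun z => Im (f z)) z.

(** The periodic antiderivative in the first variable with no modes of
    vanishing horizontal frequency. *)
Definition antid f := cwavg wt1 f.

Lemma smooth_antid f : smooth f -> smooth (antid f).
Proof. by move=> /smoothP[fr fi]; apply/smoothP; split; exact: s1. Qed.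

Lemma normc_antid f (M : R) : smooth f -> (forall z, normc (f z) <= M) ->
  forall z, normc (antid f z) <= 2 * M.
Proof.
move=> /smoothP[fr fi] fM z; apply: le_trans (normc_le _) _.
have H g : rsmooth g -> (forall z, `|g z| <= M) -> `|wavg wt1 g z| <= M.
  move=> sg gM; rewrite -[M]mul1r.
  apply: (@wavg_le _ wt1 c1 1 b1 (fun z' => g (z.1 + z'.1, z.2))) => //.
  by apply: cts_translate; exact: rsmooth_continuous.
rewrite mulr_natl mulr2n /=; apply: lerD; apply: H => // z'.
- exact: le_trans (Re_le_normc _) (fM _).
- exact: le_trans (Im_le_normc _) (fM _).
Qed.

(** The modes with vanishing horizontal frequency are zero because the
    antiderivative is itself a derivative, by [wavg1_pdx]. *)
Lemma fun_coef_antid f k : smooth f ->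
  fun_coef (antid f) k = if k.1 == 0 then 0 else (symb true k)^-1 * fun_coef f k.
Proof.
move=> sf; have /smoothP[fr fi] := sf; have sa := smooth_antid sf.
have [k0|k0] := eqVneq k.1 0.
  have -> : antid f = dd true (cwavg wt2 f).
    apply/funext => z; apply: complexP; rewrite /= /antid /cwavg /=.
    - by rewrite wavg1_pdx.
    - by rewrite wavg1_pdx.
  rewrite fun_coef_dd; last by apply/smoothP; split; exact: s2.
  by rewrite /symb k0 mulr0 mul0r.
have sk : symb true k != 0 :> R[i].
  rewrite /symb eq_complex /= eqxx /= mulf_neq0 ?intr_eq0//.
  by rewrite mulf_neq0// gt_eqF// pi_gt0.
have sw : smooth (cwavg wt0 f) by apply/smoothP; split; exact: s0.
have w00 : fun_coef (cwavg wt0 f) k = 0.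
  have : fun_coef (dd true (cwavg wt0 f)) k = 0.
    have -> : dd true (cwavg wt0 f) = fun=> 0.
      apply/funext => z; apply: complexP => /=.
      - by rewrite -[LHS]/(pdx (wavg wt0 (fun z => Re (f z))) z) pdx_wavg0.
      - by rewrite -[LHS]/(pdx (wavg wt0 (fun z => Im (f z))) z) pdx_wavg0.
    rewrite /fun_coef -[RHS]torus_int0; apply: eq_torus_int => z; exact: mul0r.
  rewrite fun_coef_dd// => /eqP; rewrite mulf_eq0 (negbTE sk) /= => /eqP; exact.
apply: (mulfI sk); rewrite -fun_coef_dd// mulrA mulfV// mul1r.
have -> : dd true (antid f) = fun z => -1 * cwavg wt0 f z + f z.
  apply/funext => z; apply: complexP; rewrite ?ReD ?ReM ?ImD ?ImM /=.
  - rewrite -[LHS]/(pdx (wavg wt1 (fun z => Re (f z))) z) pdx_wavg1//.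
    by rewrite oppr0 mul0r subr0 mulN1r addrC.
  - rewrite -[LHS]/(pdx (wavg wt1 (fun z => Im (f z))) z) pdx_wavg1//.
    by rewrite oppr0 mul0r addr0 mulN1r addrC.
rewrite fun_coef_lin ?w00 ?mulr0 ?add0r//; exact: smooth_ccont.
Qed.

Lemma dx_invE f : smooth f -> dx_inv f = antid f.
Proof.
move=> sf; apply: smooth_of_coef_eq; first exact: smooth_antid.
by move=> k; rewrite fun_coef_antid.
Qed.

Lemma antid_lin (c : R[i]) f f' : smooth f -> smooth f' ->
  antid (fun z => c * f z + f' z) = fun z => c * antid f z + antid f' z.
Proof.
move=> sf sf'; have sl := smooth_lin c sf sf'.
have sa := smooth_antid sf; have sa' := smooth_antid sf'.
apply: smooth_coef_inj; [exact: smooth_antid|exact: smooth_lin|move=> k].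
rewrite fun_coef_lin; try exact: smooth_ccont.
rewrite !fun_coef_antid// fun_coef_lin; try exact: smooth_ccont.
by case: ifP => _; rewrite ?mulr0 ?addr0//; ring.
Qed.

Lemma antid_character k : antid (character k) =
  fun z => (if k.1 == 0 then 0 else (symb true k)^-1) * character k z.
Proof.
have sc := @smooth_character R k.
apply: smooth_coef_inj; [exact: smooth_antid|exact: smoothZ|move=> l].
have -> : (fun z => (if k.1 == 0 then 0 else (symb true k)^-1) * character k z : R[i]) =
    fun z => (if k.1 == 0 then 0 else (symb true k)^-1) * character k z + (fun=> 0) z.
  by apply/funext => z; rewrite addr0.
rewrite fun_coef_lin; [|exact: smooth_ccont|exact: ccont_cst].
rewrite fun_coef_antid// fun_coef_character.
have -> : fun_coef (fun _ : R * R => 0 : R[i]) l = 0.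
  by rewrite /fun_coef -[RHS]torus_int0; apply: eq_torus_int => z; rewrite mul0r.
rewrite addr0; have [->|kl] := eqVneq k l; first by case: ifP; rewrite ?mul0r.
by case: ifP; rewrite !mulr0.
Qed.

End Antiderivative.

(** * Absolutely convergent sums *)

Section Sums.
Context {R : realType} (T : choiceType) (iota_ : nat -> T).
Hypothesis iota_inj : injective iota_.
Implicit Types a b : T -> R.

(** A sum of nonnegative terms over a set of indices is a series when the
    nonzero terms are enumerated by an injective sequence. *)
Lemma esum_range b : (forall k, 0 <= b k) ->
  (forall k, b k != 0 -> exists n, k = iota_ n) ->
  \esum_(k in [set: T]) (b k)%:E = (\sum_(n <oo) (b (iota_ n))%:E)%E.
Proof.
move=> b0 supp.
have -> : \esum_(k in [set: T]) (b k)%:E = \esum_(k in iota_ @` [set: nat]) (b k)%:E.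
  rewrite [RHS]esum_mkcond; apply: eq_esum => k _; case: ifPn => // kn.
  have [->//|/supp [n kE]] := eqVneq (b k) 0.
  by exfalso; move: kn; rewrite notin_setE; apply; exists n.
rewrite esum_image; last by move=> m n _ _; exact: iota_inj.
by rewrite nneseries_esumT// => n; rewrite lee_fin.
Qed.

Lemma esum_range_cvg b (C : R) : (forall k, 0 <= b k) ->
  (forall k, b k != 0 -> exists n, k = iota_ n) ->
  (forall N, \sum_(0 <= n < N) b (iota_ n) <= C) ->
  (\esum_(k in [set: T]) (b k)%:E < +oo)%E /\
  (fun N => \sum_(0 <= n < N) b (iota_ n)) @ \oo -->
    fine (\esum_(k in [set: T]) (b k)%:E).
Proof.
move=> b0 supp bC; rewrite esum_range//.
have nd : nondecreasing_seq (fun N => \sum_(0 <= n < N) b (iota_ n)).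
  apply/nondecreasing_seqP => N; rewrite big_nat_recr//= lerDl; exact: b0.
have cv : cvgn (fun N => \sum_(0 <= n < N) b (iota_ n)).
  by apply: nondecreasing_is_cvgn => //; exists C => _ [N _ <-]; exact: bC.
have E : (\sum_(n <oo) (b (iota_ n))%:E)%E =
    (limn (fun N => \sum_(0 <= n < N) b (iota_ n)))%:E.
  rewrite -EFin_lim//; congr (limn _); apply/funext => N /=.
  by rewrite sumEFin.
by rewrite E ltry.
Qed.

Lemma rsum_cvg a (C : R) :
  (forall k, a k != 0 -> exists n, k = iota_ n) ->
  (forall N, \sum_(0 <= n < N) `|a (iota_ n)| <= C) ->
  (fun N => \sum_(0 <= n < N) a (iota_ n)) @ \oo --> rsum a.
Proof.
move=> supp aC.
have P k : 0 <= a^\+ k <= `|a k|.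
  by rewrite /funrpos le_max lexx orbT /= ge_max normr_ge0 ler_norm.
have N k : 0 <= a^\- k <= `|a k|.
  by rewrite /funrneg le_max lexx orbT /= ge_max normr_ge0 -normrN ler_norm.
have H b : (forall k, 0 <= b k <= `|a k|) ->
    (fun N => \sum_(0 <= n < N) b (iota_ n)) @ \oo -->
    fine (\esum_(k in [set: T]) (b k)%:E).
  move=> ba; apply: (proj2 (@esum_range_cvg _ C _ _ _)).
  - by move=> k; have /andP[] := ba k.
  - move=> k bk; apply: supp; apply: contra bk => /eqP ak.
    by have := ba k; rewrite ak normr0 -eq_le eq_sym.
  - move=> M; apply: le_trans (aC M); apply: ler_sum => n _.
    by have /andP[] := ba (iota_ n).
have -> : (fun N => \sum_(0 <= n < N) a (iota_ n)) =
    (fun N => \sum_(0 <= n < N) a^\+ (iota_ n) - \sum_(0 <= n < N) a^\- (iota_ n)).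
  apply/funext => M; rewrite -sumrB; apply: eq_bigr => n _.
  by rewrite -[in LHS](funrposBneg a).
by apply: cvgB; exact: H.
Qed.

End Sums.

(** The enumeration 1, -1, 2, -2, ... of the nonzero integers. *)
Definition altint (n : nat) : int := if odd n then - (n./2.+1)%:Z else (n./2.+1)%:Z.

Lemma altint_inj : injective altint.
Proof.
move=> m n; rewrite /altint; have := odd_double_half m; have := odd_double_half n.
by case: (odd m); case: (odd n) => /=; lia.
Qed.

Lemma altint_surj (l : int) : l != 0 -> exists n, l = altint n.
Proof.
case: l => [[//|n]|n] _.
- by exists n.*2; rewrite /altint odd_double doubleK.
- by exists n.*2.+1; rewrite /altint /= odd_double /= uphalf_double NegzE.
Qed.

Lemma big_altint (V : zmodType) (f : int -> V) N :
  \sum_(0 <= n < N.*2) f (altint n) =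
  \sum_(0 <= j < N) (f j.+1 + f (- j.+1%:Z)).
Proof.
elim: N => [|N IH]; first by rewrite !big_geq.
rewrite doubleS big_nat_recr//= big_nat_recr//= IH [RHS]big_nat_recr//= -addrA.
by rewrite /altint /= odd_double /= doubleK uphalf_double.
Qed.

Lemma esum_range_le {R : realType} (T : choiceType) (iota_ : nat -> T) (b : T -> R) (C : R) :
  injective iota_ -> (forall k, 0 <= b k) ->
  (forall k, b k != 0 -> exists n, k = iota_ n) ->
  (forall N, \sum_(0 <= n < N) b (iota_ n) <= C) ->
  (\esum_(k in [set: T]) (b k)%:E <= C%:E)%E.
Proof.
move=> inj b0 supp bC; have [fin cv] := esum_range_cvg inj b0 supp bC.
have f1 : \esum_(k in [set: T]) (b k)%:E \is a fin_num.
  by rewrite ge0_fin_numE// esum_ge0// => k _; rewrite lee_fin.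
rewrite -(fineK f1) lee_fin -(cvg_lim (@Rhausdorff R) cv).
apply: limr_le; first by apply/cvg_ex; eexists; exact: cv.
by apply: nearW => N; exact: bC.
Qed.

(** * Distributions given by continuous functions *)

Section FunctionDistributions.
Context {R : realType}.
Implicit Types (h : R * R -> R) (f : R * R -> R[i]) (k l : freq) (z : R * R).

(** Integration against [h], with the value 0 on the functions that are not
    smooth. *)
Definition mul_functional h f : R[i] :=
  if `[< smooth f >] then torus_int (fun z => (h z)%:C * f z) else 0.

Lemma mul_functionalE h f : smooth f ->
  mul_functional h f = torus_int (fun z => (h z)%:C * f z).
Proof. by move=> sf; rewrite /mul_functional asboolT. Qed.

Lemma ccont_mul h f : continuous h -> ccont f -> ccont (fun z => (h z)%:C * f z).
Proof. by move=> ch cf; apply: ccontM => //; exact: ccont_real. Qed.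

Lemma normc_mul_functional h f (H M : R) : continuous h -> smooth f ->
  (forall z, square z -> `|h z| <= H) -> (forall z, normc (f z) <= M) ->
  normc (mul_functional h f) <= 2 * (H * M).
Proof.
move=> ch sf hH fM; rewrite mul_functionalE//; apply: normc_torus_int.
  by apply: ccont_mul => //; exact: smooth_ccont.
move=> z sz; rewrite ComplexField.Normc.normcM.
apply: ler_pM => //; try exact: normc_ge0.
by rewrite normcE /= expr0n addr0 sqrtr_sqr; exact: hH.
Qed.

Lemma mul_functional_lin h (c : R[i]) f g : continuous h -> smooth f -> smooth g ->
  mul_functional h (fun z => c * f z + g z) = c * mul_functional h f + mul_functional h g.
Proof.
move=> ch sf sg; rewrite !mul_functionalE//; last exact: smooth_lin.
have cf := ccont_mul ch (smooth_ccont sf); have cg := ccont_mul ch (smooth_ccont sg).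
rewrite -torus_intZ// -torus_intD//; last by apply: ccontM => //; exact: ccont_cst.
by apply: eq_torus_int => z; ring.
Qed.

Lemma mul_functional_bounded h : continuous h ->
  exists (N : nat) (A : R), forall f (M : R), smooth f ->
    (forall w z, (size w <= N)%N -> normc (dword w f z) <= M) ->
    normc (mul_functional h f) <= A * M.
Proof.
move=> ch; have [H H0 hH] := continuous_bounded_square ch.
exists 0%N, (2 * H) => f M sf fM; rewrite -mulrA.
apply: normc_mul_functional => // z; exact: (fM [::] z).
Qed.

Lemma mul_functional_out h f : ~ smooth f -> mul_functional h f = 0.
Proof. by move=> nf; rewrite /mul_functional asboolF. Qed.

(** The distribution defined by a continuous real function. *)
Definition fdist h (ch : continuous h) : torus_distribution R :=
  TorusDistribution (@mul_functional_out h)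
    (fun c f g => @mul_functional_lin h c f g ch) (mul_functional_bounded ch).

Lemma coef_fdist h (ch : continuous h) k :
  coef (fdist ch) k = fun_coef (fun z => (h z)%:C) k.
Proof. by rewrite /coef /= mul_functionalE//; exact: smooth_character. Qed.

Lemma real_fdist h (ch : continuous h) : real_dist (fdist ch).
Proof.
move=> f sf fr; rewrite /= mul_functionalE// /torus_int /=.
rewrite -[LHS]/(tint (fun z => Im ((h z)%:C * f z))).
rewrite (@eq_tint _ _ (fun=> 0)) ?tint_cst// => z.
by rewrite ImM fr /= mulr0 mul0r addr0.
Qed.

Lemma in_Lp_fdist h (ch : continuous h) (p : R) : 0 <= p -> in_Lp p (fdist ch).
Proof.
move=> p0; exists (fun z => (h z)%:C); split.
- exact: (continuous_plane_measurable measurable_square ch).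
- exact: measurable_cst.
- have [H H0 hH] := continuous_bounded_square ch.
  have E z : normc (h z)%:C = `|h z| :> R.
    by rewrite normcE /= expr0n addr0 sqrtr_sqr.
  apply: (@le_lt_trans _ _ (\int[plane_measure]_(z in (square : set (R * R))) (H `^ p)%:E)%E).
    apply: ge0_le_integral; first exact: measurable_square.
    - by move=> z _; rewrite lee_fin powR_ge0.
    - apply/measurable_EFinP; under eq_fun do rewrite E.
      apply: (measurableT_comp (measurable_powR p)).
      exact: (continuous_plane_measurable measurable_square (cts_norm ch)).
    - exact: measurable_cst.
    - by move=> z sz; rewrite lee_fin E ge0_ler_powR ?nnegrE//; exact: hH.
  rewrite integral_cst; last exact: measurable_square.
  by rewrite [X in (_ * X)%E]measure_square mule1 ltry.
- by move=> phi sp; rewrite /= mul_functionalE.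
Qed.

End FunctionDistributions.

(** * The Fourier coefficients of a travelling wave *)

Section Wave.
Context {R : realType} (e : freq).
Hypothesis e2 : e.2 = 1.
Variable lam : nat -> R.
Hypothesis lam_ge : forall j, (j.+1 * j.+2)%:R <= lam j.
Variables (c : nat -> R) (r : R).
Hypothesis r1 : 1 <= r.
Hypothesis Kc : energy_le lam r c.
Implicit Types (k l : freq) (z : R * R) (G : R * R -> R[i]).

Local Notation F := (cseries e c).

Let cF : continuous F := continuous_cseries lam_ge r1 Kc.

(** The Fourier coefficients of the wave. *)
Definition hat k : R :=
  if (k == harm e k.2) && (k.2 != 0) then c `|k.2|.-1 else 0.

Lemma harm2 n : (harm e n).2 = n.
Proof. by rewrite /harm /= e2 mul1r. Qed.

Lemma hat_harm n : n != 0 -> hat (harm e n) = c `|n|.-1.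
Proof. by move=> n0; rewrite /hat harm2 eqxx n0. Qed.

Lemma hat_out k : hat k != 0 -> exists n, k = harm e (altint n).
Proof.
rewrite /hat; case: ifP => [/andP[/eqP kE k0] _|_]; last by rewrite eqxx.
by have [n nE] := altint_surj k0; exists n; rewrite -nE.
Qed.

Lemma iota_inj : injective (fun n => harm e (altint n)).
Proof. by move=> m n /(congr1 snd); rewrite !harm2 => /altint_inj. Qed.

Lemma harmN n : harm e (- n) = - harm e n.
Proof. by rewrite /harm !mulrN. Qed.

Lemma cosj_character j z :
  (2 * cosj e j z)%:C = character (harm e j.+1) z + character (- harm e j.+1) z :> R[i].
Proof.
rewrite !characterE phaseN cosN sinN /cosj; apply: complexP; rewrite ?ReD ?ImD /=.
- by rewrite mulr2n mulrDl mul1r.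
- by rewrite subrr.
Qed.

Lemma fun_coef_shift G k l : fun_coef (fun z => character l z * G z) k = fun_coef G (k - l).
Proof.
apply: eq_torus_int => z; rewrite mulrAC -characterD mulrC; congr (_ * character _ z).
by rewrite opprB addrC.
Qed.

(** The convolution of the coefficients [g] with those of the [N]-th partial
    sum of the wave. *)
Definition conv_part (g : freq -> R[i]) k N : R[i] :=
  \sum_(0 <= j < N) (c j)%:C * (g (k - harm e j.+1) + g (k + harm e j.+1)).

Lemma fun_coef_cpart G N k : ccont G ->
  fun_coef (fun z => (csum_part e c N z)%:C * G z) k = conv_part (fun_coef G) k N.
Proof.
move=> cG; elim: N => [|N IH].
  rewrite /conv_part big_geq// /fun_coef -[RHS]torus_int0; apply: eq_torus_int => z.
  by rewrite /csum_part big_geq// !mul0r.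
have cN : ccont (fun z => (csum_part e c N z)%:C * G z).
  by apply: ccont_mul => //; exact: continuous_cpart.
have cl l : ccont (fun z => character l z * G z).
  by apply: ccontM => //; exact: ccont_character.
rewrite /conv_part big_nat_recr//= -/(conv_part _ _ _) -IH.
have -> : (fun z => (csum_part e c N.+1 z)%:C * G z) = (fun z =>
   (c N)%:C * (1 * (character (harm e N.+1) z * G z) + character (- harm e N.+1) z * G z)
     + (csum_part e c N z)%:C * G z).
  apply/funext => z; rewrite /csum_part big_nat_recr//= rmorphD mulrDl addrC.
  have -> : 2 * c N * cosj e N z = c N * (2 * cosj e N z) by rewrite mulrCA mulrA.
  by congr (_ + _); rewrite rmorphM /= cosj_character; ring.
rewrite fun_coef_lin//; last first.
  apply: ccontD => //; apply: ccontM => //; exact: ccont_cst.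
rewrite fun_coef_lin// !fun_coef_shift mul1r opprK; exact: addrC.
Qed.

Lemma conv_approx G k (M : R) : ccont G -> (forall z, square z -> normc (G z) <= M) ->
  exists K : R, forall N,
    normc (fun_coef (fun z => (F z)%:C * G z) k - conv_part (fun_coef G) k N) <= K * tailb N.
Proof.
move=> cG GM; exists (2 * (2 * r * M)) => N.
rewrite -fun_coef_cpart//.
have cf := ccont_mul cF cG.
have cN := ccont_mul (@continuous_cpart _ e c N) cG.
have -> : fun_coef (fun z => (F z)%:C * G z) k -
    fun_coef (fun z => (csum_part e c N z)%:C * G z) k =
    fun_coef (fun z => (F z - csum_part e c N z)%:C * G z) k.
  rewrite addrC -mulN1r -(fun_coef_lin (-1) k cN cf); congr fun_coef; apply/funext => z.
  by rewrite rmorphB; ring.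
rewrite -mulrA; apply: normc_torus_int.
  apply: ccontM; last exact: ccont_character.
  by apply: ccont_mul => //; apply: ctsB => //; exact: continuous_cpart.
move=> z sz; rewrite !ComplexField.Normc.normcM normc_character mulr1.
rewrite normcE /= expr0n addr0 sqrtr_sqr -mulrA [M * _]mulrC mulrA.
apply: ler_pM => //; [exact: normc_ge0|exact: cseries_approx|exact: GM].
Qed.

Lemma conv_limit G k (M : R) (x : R[i]) N0 : ccont G ->
  (forall z, square z -> normc (G z) <= M) ->
  (forall N, (N0 <= N)%N -> conv_part (fun_coef G) k N = x) ->
  fun_coef (fun z => (F z)%:C * G z) k = x.
Proof.
move=> cG GM H; have [K HK] := conv_approx k cG GM.
set y := fun_coef _ _ in HK *.
have B N : (N0 <= N)%N -> normc (y - x) <= K * tailb N by move=> N0N; rewrite -(H N N0N).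
apply/eqP; rewrite -subr_eq0; apply/eqP; apply: complexP => /=.
- by apply: (@tailb_eq0 _ _ K N0) => N /B; exact: le_trans (Re_le_normc _).
- by apply: (@tailb_eq0 _ _ K N0) => N /B; exact: le_trans (Im_le_normc _).
Qed.

Lemma sum_pick (f : nat -> R) m N : (m < N)%N ->
  \sum_(0 <= i < N) (if i == m then f i else 0) = f m.
Proof.
move=> mN; rewrite big_mkord (bigD1 (Ordinal mN))//= eqxx big1 ?addr0// => i.
by rewrite -val_eqE /= => /negbTE ->.
Qed.

Lemma fun_coef_wave k : fun_coef (fun z => (F z)%:C) k = (hat k)%:C.
Proof.
have c1 : ccont (fun _ : R * R => 1 : R[i]) by exact: ccont_cst.
have fc1 l : fun_coef (fun _ : R * R => 1 : R[i]) l = (l == 0)%:R.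
  rewrite /fun_coef -oppr_eq0 -torus_int_character.
  by apply: eq_torus_int => z'; rewrite mul1r.
have -> : (fun z => (F z)%:C) = fun z => (F z)%:C * 1 by apply/funext => z; rewrite mulr1.
apply: (@conv_limit _ _ 1 _ `|k.2|%N) => // [z _|N kN].
  by rewrite ComplexField.Normc.normc1.
transitivity (\sum_(0 <= j < N) (if (k == harm e k.2) && (`|k.2|%N == j.+1) then c j else 0))%:C.
  rewrite rmorph_sum; apply: eq_bigr => j _; rewrite !fc1 subr_eq0 addr_eq0 -harmN.
  have E1 : (k == harm e j.+1) = (k == harm e k.2) && (k.2 == j.+1).
    apply/eqP/andP => [->|[/eqP kE /eqP k2]]; first by rewrite harm2.
    by rewrite kE k2.
  have E2 : (k == harm e (- j.+1%:Z)) = (k == harm e k.2) && (k.2 == - j.+1%:Z).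
    apply/eqP/andP => [->|[/eqP kE /eqP k2]]; first by rewrite harm2.
    by rewrite kE k2.
  rewrite E1 E2; case: (k == harm e k.2) => /=; last by rewrite addr0 mulr0.
  have [->|n1] := eqVneq k.2 j.+1.
    have -> : (j.+1 == - j.+1%:Z :> int) = false by apply/negbTE; lia.
    by rewrite absz_nat eqxx addr0 mulr1.
  have [->|n2] := eqVneq k.2 (- j.+1%:Z).
    by rewrite abszN absz_nat eqxx add0r mulr1.
  have -> : (`|k.2|%N == j.+1) = false by apply/negbTE; lia.
  by rewrite addr0 mulr0.
congr (_ %:C); rewrite /hat; case: (k == harm e k.2) => /=; last by rewrite big1.
have [k0|k0] := eqVneq k.2 0; first by rewrite big1 // => j _; rewrite k0.
have km : (`|k.2|.-1 < N)%N by lia.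
rewrite -(sum_pick c km); apply: eq_bigr => j _.
by have -> : (`|k.2|%N == j.+1) = (j == `|k.2|.-1) by lia.
Qed.

End Wave.

(** * The square of a travelling wave *)

Section WaveSquare.
Context {R : realType} (e : freq).
Hypothesis e1 : e.1 != 0.
Hypothesis e2 : e.2 = 1.
Variable lam : nat -> R.
Hypothesis lam_ge : forall j, (j.+1 * j.+2)%:R <= lam j.
Variables (c : nat -> R) (r : R).
Hypothesis r1 : 1 <= r.
Hypothesis Kc : energy_le lam r c.
Implicit Types (k l : freq) (z : R * R) (G : R * R -> R[i]).

Local Notation F := (cseries e c).
Local Notation hat := (hat e c).
Local Notation iota_ := (fun n => harm e (altint n)).

Let cF : continuous F := continuous_cseries lam_ge r1 Kc.
Let r0 : 0 <= r. Proof. exact: le_trans ler01 r1. Qed.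

(** The wave and its square, as distributions; the mean value is removed from
    the square. *)
Definition wave : torus_distribution R := fdist cF.

Lemma cts_square : continuous (fun z => F z ^+ 2 - tint (fun z => F z ^+ 2)).
Proof. by apply: ctsB; [exact: ctsX|exact: cts_cst]. Qed.

Definition wave_square : torus_distribution R := fdist cts_square.

Lemma coef_wave k : coef wave k = (hat k)%:C.
Proof. by rewrite coef_fdist (fun_coef_wave e2 lam_ge r1 Kc). Qed.

Lemma sum_hat_le N : \sum_(0 <= n < N) `|hat (iota_ n)| <= 2 * r.
Proof.
apply: (@le_trans _ _ (\sum_(0 <= n < N.*2) `|hat (iota_ n)|)).
  by rewrite [leRHS](@big_cat_nat _ _ _ N)//= ?lerDl ?sumr_ge0// -addnn leq_addr.
rewrite (big_altint (fun m => `|hat (harm e m)|)).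
rewrite (eq_bigr (fun j => 2 * `|c j|)) => [|j _]; last first.
  rewrite !hat_harm// ?oppr_eq0// abszN !absz_nat /=; lra.
rewrite -mulr_sumr ler_pM2l//.
have := energy_le_tail lam_ge r1 Kc (leq0n N).
by rewrite /tailb sqrtr1 invr1 mulr1.
Qed.

Lemma hat_le k : `|hat k| <= 2 * r.
Proof.
have [->|/(hat_out) [n ->]] := eqVneq (hat k) 0.
  by rewrite normr0 mulr_ge0.
apply: le_trans (sum_hat_le n.+1).
by rewrite big_nat_recr//= lerDr sumr_ge0.
Qed.

(** The coefficients of the square are the convolution of those of the wave
    with themselves. *)
Lemma fun_coef_square k : fun_coef (fun z => (F z ^+ 2)%:C) k =
  (rsum (fun k1 => hat k1 * hat (k - k1)))%:C.
Proof.
pose a k1 := hat k1 * hat (k - k1).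
have supp k1 : a k1 != 0 -> exists n, k1 = iota_ n.
  by rewrite /a mulf_eq0 negb_or => /andP[/hat_out].
have bd N : \sum_(0 <= n < N) `|a (iota_ n)| <= 2 * r * (2 * r).
  apply: (@le_trans _ _ (\sum_(0 <= n < N) `|hat (iota_ n)| * (2 * r))).
    by apply: ler_sum => n _; rewrite normrM ler_wpM2l// hat_le.
  rewrite -mulr_suml; apply: ler_wpM2r; first exact: mulr_ge0.
  exact: sum_hat_le.
have cv := rsum_cvg (iota_inj e2) supp bd.
have sq : (fun z => (F z ^+ 2)%:C) = fun z => (F z)%:C * (F z)%:C.
  by apply/funext => z; rewrite expr2 rmorphM.
have FM z : square z -> normc ((F z)%:C : R[i]) <= 2 * r.
  by move=> _; rewrite normcE /= expr0n addr0 sqrtr_sqr; exact: (cseries_le e lam_ge z r1 Kc).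
have [K HK] := conv_approx e lam_ge r1 Kc k (ccont_real cF) FM.
have cE N : conv_part e c (fun_coef (fun z => (F z)%:C)) k N =
    (\sum_(0 <= n < N.*2) a (iota_ n))%:C.
  rewrite (big_altint (fun m => a (harm e m))) rmorph_sum; apply: eq_bigr => j _.
  rewrite !(fun_coef_wave e2 lam_ge r1 Kc) /a !hat_harm// ?oppr_eq0// abszN !absz_nat /=.
  by rewrite harmN opprK rmorphD !rmorphM /= mulrDr.
rewrite sq; set y := fun_coef _ k in HK *.
have lim2 : (fun N => \sum_(0 <= n < N.*2) a (iota_ n)) @ \oo --> rsum a.
  have h : (fun N : nat => N.*2) @ \oo --> \oo.
    apply/cvgnyPge => A; exists A => // N /= AN; rewrite -addnn.
    exact: leq_trans AN (leq_addr _ _).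
  exact: (cvg_comp _ _ h cv).
have tl : (fun N => K * tailb N) @ \oo --> (0 : R).
  rewrite -[X in _ --> X](mulr0 K); apply: cvgM; first exact: cvg_cst.
  apply/cvgrPdist_le => eps eps0; have [N HN] := tailb_le eps0.
  exists N => // n /= Nn; rewrite sub0r normrN ger0_norm; first exact: HN.
  exact: ltW (tailb_gt0 _).
have yI : Im y = 0.
  apply: (@tailb_eq0 _ _ K 0) => N _; apply: le_trans (HK N); rewrite cE.
  have IB s : Im (y - s%:C) = Im y by case: (y) => u v /=; rewrite subr0.
  by rewrite -(IB (\sum_(0 <= n < N.*2) a (iota_ n))); exact: Im_le_normc.
apply: complexP.
- apply/eqP; rewrite -subr_eq0; apply/eqP.
  have D : (fun N => Re y - \sum_(0 <= n < N.*2) a (iota_ n)) @ \oo --> Re y - rsum a.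
    by apply: cvgB => //; exact: cvg_cst.
  have Z : (fun N => Re y - \sum_(0 <= n < N.*2) a (iota_ n)) @ \oo --> (0 : R).
    apply: norm_cvg0; apply: (squeeze_cvgr _ (cvg_cst 0) tl).
    apply: nearW => N; rewrite normr_ge0 /=; apply: le_trans (HK N); rewrite cE.
    have RB s : Re (y - s%:C) = Re y - s by case: (y).
    by rewrite -RB; exact: Re_le_normc.
  by rewrite -(cvg_lim (@Rhausdorff R) D) (cvg_lim (@Rhausdorff R) Z).
- exact: yI.
Qed.

Lemma rsum0 (T : choiceType) (a : T -> R) : (forall i, a i = 0) -> rsum a = 0.
Proof.
move=> a0; rewrite /rsum !esum1 ?subrr// => i _.
- by rewrite /funrneg a0 oppr0 maxxx.
- by rewrite /funrpos a0 maxxx.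
Qed.

Lemma csum_hat k : csum (fun k1 => coef wave k1 * coef wave (k - k1)) =
  fun_coef (fun z => (F z ^+ 2)%:C) k.
Proof.
rewrite fun_coef_square /csum; congr (_ +i* _).
- by congr rsum; apply/funext => k1; rewrite !coef_wave -rmorphM.
- by apply: rsum0 => k1; rewrite !coef_wave -rmorphM.
Qed.

Hypothesis profile :
  forall j, tint (fun z => F z ^+ 2 * cosj e j z) = lam j * c j.

Lemma hat_lattice k : hat k != 0 -> k = harm e k.2 /\ k.2 != 0.
Proof. by rewrite /hat; case: ifP => [/andP[/eqP]//|_]; rewrite eqxx. Qed.

Lemma harmD m n : harm e (m + n) = harm e m + harm e n.
Proof. by rewrite /harm !mulrDr. Qed.

(** The stationary equation, read on the Fourier side. *)
Lemma fun_coef_square_lam k : k != 0 ->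
  fun_coef (fun z => (F z ^+ 2)%:C) k = (lam `|k.2|.-1 * hat k)%:C.
Proof.
move=> k0; have [kE|kE] := eqVneq k (harm e k.2); last first.
  have -> : hat k = 0 by rewrite /hat (negbTE kE).
  rewrite mulr0 fun_coef_square rsum0// => k1.
  have [->|/hat_lattice[k1E _]] := eqVneq (hat k1) 0; first by rewrite mul0r.
  have [->|/hat_lattice[k2E _]] := eqVneq (hat (k - k1)) 0; first by rewrite mulr0.
  have kS : k = harm e (k1.2 + (k - k1).2) by rewrite harmD -k1E -k2E addrC subrK.
  by move/eqP: kE; rewrite kS harm2.
have n0 : k.2 != 0.
  by apply: contra k0 => /eqP k20; rewrite kE k20 /harm !mulr0.
rewrite fun_coef_square; apply: complexP => //=.
transitivity (Re (fun_coef (fun z => (F z ^+ 2)%:C) k)); first by rewrite fun_coef_square.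
have [m k2] : exists m : nat, k.2 = m.+1%:Z \/ k.2 = - m.+1%:Z.
  exists `|k.2|.-1; lia.
have hE : hat k = c m.
  by rewrite kE hat_harm//; case: k2 => ->; rewrite ?abszN absz_nat.
have -> : `|k.2|.-1 = m by case: k2 => ->; rewrite ?abszN absz_nat.
rewrite hE -profile /fun_coef; apply: eq_tint => z.
rewrite ReM /= mul0r subr0 -/(phase (- k) z); congr (_ * _).
rewrite /cosj phaseN cosN; case: k2 => k2; rewrite kE k2 //.
by rewrite harmN phaseN cosN.
Qed.

Lemma coef_wave_square k :
  coef wave_square k = if k == 0 then 0 else (lam `|k.2|.-1 * hat k)%:C.
Proof.
rewrite coef_fdist; set m := tint _.
have c1 : ccont (fun _ : R * R => (- m)%:C : R[i]) by exact: ccont_cst.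
have cs : ccont (fun z => (F z ^+ 2)%:C) by apply: ccont_real; exact: ctsX.
have -> : (fun z => (F z ^+ 2 - m)%:C) =
    fun z => (- m)%:C * (fun=> 1) z + (F z ^+ 2)%:C.
  by apply/funext => z; rewrite mulr1 -rmorphD addrC.
rewrite fun_coef_lin//; last exact: ccont_cst.
have -> : fun_coef (fun _ : R * R => 1 : R[i]) k = (k == 0)%:R.
  rewrite /fun_coef -oppr_eq0 -torus_int_character.
  by apply: eq_torus_int => z'; rewrite mul1r.
have [->|k0] := eqVneq k 0; last by rewrite mulr0 add0r fun_coef_square_lam.
rewrite mulr1 fun_coef_square -rmorphD; congr (_%:C).
have -> : rsum (fun k1 => hat k1 * hat (0 - k1)) = m.
  transitivity (Re (fun_coef (fun z => (F z ^+ 2)%:C) 0)); first by rewrite fun_coef_square.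
  by apply: eq_tint => z; rewrite oppr0 character0 mulr1.
exact: addNr.
Qed.

Lemma hat_k1 k : k.1 = 0 -> hat k = 0.
Proof.
move=> k10; apply/eqP; apply: contraT => /hat_lattice[kE k20].
by move: k10; rewrite kE /= => /eqP; rewrite mulf_eq0 (negbTE e1) (negbTE k20).
Qed.

Lemma xne0_square_wave : xne0_square wave = wave_square.
Proof.
apply: dist_of_coef_eq => k; rewrite csum_hat coef_wave_square.
have [k10|k10] := eqVneq k.1 0; last first.
  have k0 : k != 0 by apply: contra k10 => /eqP ->.
  by rewrite (negbTE k0) fun_coef_square_lam.
by rewrite hat_k1// mulr0; case: ifP.
Qed.

Lemma xne0_proj_wave : xne0_proj wave = wave.
Proof.
apply: dist_of_coef_eq => k; rewrite coef_wave; case: eqP => // k10.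
by rewrite hat_k1.
Qed.

Lemma normc_realC (x : R) : normc (x%:C : R[i]) = `|x|.
Proof. by rewrite normcE /= expr0n addr0 sqrtr_sqr. Qed.

Lemma powR_neg_le1 (b s : R) : 1 <= b -> 0 <= s -> b `^ (- s) <= 1.
Proof. by move=> b1 s0; rewrite -[leRHS](powRr0 b) ler_powR// oppr_le0. Qed.

Lemma weighted_sum_finite (wt : freq -> R) : (forall k, 0 <= wt k <= 1) ->
  (\esum_(k in [set: freq]) (wt k * normc (coef wave k) ^+ 2)%:E < +oo)%E.
Proof.
move=> w1; apply: (@le_lt_trans _ _ (2 * r * (2 * r))%:E); last exact: ltry.
have w0 k : 0 <= wt k by have /andP[] := w1 k.
apply: (esum_range_le (iota_inj e2)) => [k|k|N].
- by rewrite mulr_ge0 ?sqr_ge0.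
- rewrite coef_wave normc_realC mulf_eq0 expf_eq0 /= normr_eq0 negb_or.
  by move=> /andP[_ /hat_out].
- apply: (@le_trans _ _ (\sum_(0 <= n < N) `|hat (iota_ n)| * (2 * r))).
    apply: ler_sum => n _; rewrite coef_wave normc_realC expr2.
    rewrite -[leRHS]mul1r; apply: ler_pM; [exact: w0|exact: mulr_ge0| |].
    + by have /andP[] := w1 (iota_ n).
    + by rewrite ler_wpM2l// hat_le.
  by rewrite -mulr_suml ler_wpM2r ?mulr_ge0// sum_hat_le.
Qed.

Lemma in_Hs_wave (sigma : R) : 0 < sigma ->
  in_Hs0 (- sigma) wave /\ in_Hs (- sigma) wave.
Proof.
move=> s0; split; apply: weighted_sum_finite => k; rewrite powR_ge0 /=;
  apply: powR_neg_le1; try exact: ltW.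
- by rewrite lerDl sqr_ge0.
- by rewrite -addrA lerDl addr_ge0 ?sqr_ge0.
Qed.

Lemma AFx_wave (s : R) : 0 <= s -> (AFx s wave < +oo)%E.
Proof.
move=> s0.
pose h k := `|hat k|.
(* drop the weight and the restriction on the frequencies: the sum becomes a
   product *)
apply: (@le_lt_trans _ _ (\esum_(k in [set: freq * freq]) (h k.1 * h k.2)%:E)%E).
  rewrite /AFx esum_mkcond; apply: le_esum => -[k l] _.
  case: ifP => _; last by rewrite lee_fin mulr_ge0 ?normr_ge0.
  rewrite lee_fin ComplexField.Normc.normcM !coef_wave !normc_realC /h /=.
  rewrite ler_piMl ?mulr_ge0//; apply: powR_neg_le1 => //.
  rewrite /bracket -[leLHS]sqrtr1 ler_wsqrtr// -addrA lerDl addr_ge0 ?sqr_ge0//.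
have -> : [set: freq * freq] = [set: freq] `*`` (fun=> [set: freq]).
  by apply/seteqP; split.
rewrite -(@esum_esum _ _ _ _ _ (fun k l => (h k * h l)%:E)); last first.
  by move=> k l _ _; rewrite lee_fin mulr_ge0 ?normr_ge0.
apply: (@le_lt_trans _ _ (2 * r * (2 * r))%:E); last exact: ltry.
apply: (@le_trans _ _ (\esum_(k in [set: freq]) (h k * (2 * r))%:E)%E).
  apply: le_esum => k _; apply: (esum_range_le (iota_inj e2)) => [l|l|N].
  - by rewrite mulr_ge0 ?normr_ge0.
  - by rewrite mulf_eq0 negb_or normr_eq0 => /andP[_]; rewrite normr_eq0 => /hat_out.
  - by rewrite -mulr_sumr ler_wpM2l ?normr_ge0// sum_hat_le.
apply: (esum_range_le (iota_inj e2)) => [l|l|N].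
- by rewrite mulr_ge0 ?normr_ge0// mulr_ge0.
- by rewrite mulf_eq0 negb_or normr_eq0 => /andP[/hat_out].
- by rewrite -mulr_suml ler_wpM2r ?mulr_ge0// sum_hat_le.
Qed.

End WaveSquare.

(** * The defect in the weak equation *)

Section LinearPart.
Context {R : realType}.
Variables (d : nat) (kappa : R).
Hypothesis hd : d = 3%N \/ d = 5%N.
Hypothesis hkappa : kappa = -1 \/ kappa = 1.
Implicit Types (k : freq) (z : R * R) (f : R * R -> R[i]).

(** The linear part of the equation, acting on test functions, with the inverse
    derivative written as an average. *)
Definition lin_op f z : R[i] :=
  (-1) ^+ (d.+1)./2 * iter d dx f z + kappa%:C * antid (dy (dy f)) z.

Lemma iter_dx n f : iter n dx f = dword (nseq n true) f.
Proof. by elim: n => //= n ->. Qed.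

Lemma smooth_antid_dyy f : smooth f -> smooth (antid (dy (dy f))).
Proof. by move=> sf; apply: smooth_antid; do 2 apply: smooth_dy. Qed.

Lemma smooth_lin_op f : smooth f -> smooth (lin_op f).
Proof.
move=> sf; apply: smooth_lin; first by rewrite iter_dx; exact: smooth_dword.
by apply: smoothZ; exact: smooth_antid_dyy.
Qed.

Lemma lin_op_lin (a : R[i]) f g : smooth f -> smooth g ->
  lin_op (fun z => a * f z + g z) = fun z => a * lin_op f z + lin_op g z.
Proof.
move=> sf sg; rewrite /lin_op !iter_dx (dword_lin _ _ sf sg).
have dyy h : dy (dy h) = dword [:: false; false] h by [].
rewrite !dyy (dword_lin _ _ sf sg) antid_lin; [|exact: smooth_dword..].
apply/funext => z.
have alg (s k x y p q : R[i]) :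
    s * (a * x + y) + k * (a * p + q) = a * (s * x + k * p) + (s * y + k * q) by ring.
exact: alg.
Qed.

(** A distribution of order zero: it is bounded by the maximum of the test
    function. *)
Definition order0 (u : torus_distribution R) := exists A : R, forall f (M : R),
  smooth f -> (forall z, normc (f z) <= M) -> normc (u f) <= A * M.

Variables u v : torus_distribution R.
Hypothesis u0 : order0 u.
Hypothesis v0 : order0 v.

(** The defect in the weak equation, as a distribution of the test function. *)
Definition residual f : R[i] :=
  if `[< smooth f >] then u (lin_op f) + v (dx f) else 0.

Lemma residual_out f : ~ smooth f -> residual f = 0.
Proof. by move=> nf; rewrite /residual asboolF. Qed.

Lemma dx_lin (a : R[i]) f g : smooth f -> smooth g ->
  dx (fun z => a * f z + g z) = fun z => a * dx f z + dx g z.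
Proof. exact: (@dword_lin _ [:: true]). Qed.

Lemma residual_lin (a : R[i]) f g : smooth f -> smooth g ->
  residual (fun z => a * f z + g z) = a * residual f + residual g.
Proof.
move=> sf sg; rewrite /residual !asboolT//; last exact: smooth_lin.
rewrite lin_op_lin// dx_lin//.
rewrite (dist_linear u a (smooth_lin_op sf) (smooth_lin_op sg)).
rewrite (dist_linear v a (smooth_dx sf) (smooth_dx sg)).
by rewrite mulrDr addrACA.
Qed.

Lemma residual_bounded : exists (N : nat) (A : R), forall f (M : R), smooth f ->
  (forall w z, (size w <= N)%N -> normc (dword w f z) <= M) ->
  normc (residual f) <= A * M.
Proof.
have [A hA] := u0; have [B hB] := v0.
exists 5%N, (A * 3 + B) => f M sf fM.
rewrite /residual asboolT//; apply: le_trans (normcD _ _) _.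
have b1 z : normc (lin_op f z) <= 3 * M.
  apply: le_trans (normcD _ _) _; rewrite !ComplexField.Normc.normcM.
  have n1 : normc ((-1) ^+ (d.+1)./2 : R[i]) = 1.
    elim: ((d.+1)./2) => [|n IH]; first by rewrite expr0 ComplexField.Normc.normc1.
    by rewrite exprS ComplexField.Normc.normcM IH normc_opp ComplexField.Normc.normc1 mulr1.
  have n2 : normc (kappa%:C : R[i]) = 1.
    by rewrite normc_realC; case: hkappa => ->; rewrite ?normrN normr1.
  rewrite n1 n2 !mul1r (_ : 3 * M = M + 2 * M); last by ring.
  apply: lerD.
    by rewrite iter_dx; apply: fM; rewrite size_nseq; case: hd => ->.
  apply: normc_antid; first by do 2 apply: smooth_dy.
  by move=> z'; exact: (fM [:: false; false]).
have b2 z : normc (dx f z) <= M by exact: (fM [:: true]).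
rewrite mulrDl -mulrA; apply: lerD.
- exact: hA (smooth_lin_op sf) b1.
- exact: hB (smooth_dx sf) b2.
Qed.

Definition residual_dist : torus_distribution R :=
  TorusDistribution residual_out residual_lin residual_bounded.

Lemma distZ (w : torus_distribution R) (a : R[i]) f : smooth f ->
  w (fun z => a * f z) = a * w f.
Proof.
move=> sf; have -> : (fun z => a * f z) = fun z => a * f z + (fun=> 0) z.
  by apply/funext => z; rewrite addr0.
by rewrite dist_linear//; [rewrite dist0 addr0|exact: smooth0].
Qed.

Lemma symbw_nseq n b k : symbw (nseq n b) k = symb b k ^+ n :> R[i].
Proof. by elim: n => [|n IH]; rewrite /symbw ?big_nil// exprS /= big_cons -IH. Qed.

Lemma lin_op_character k : lin_op (character k) = fun z =>
  ((-1) ^+ (d.+1)./2 * symb true k ^+ d + kappa%:C *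
    (symb false k ^+ 2 * (if k.1 == 0 then 0 else (symb true k)^-1))) * character k z.
Proof.
apply/funext => z; rewrite /lin_op iter_dx dword_character symbw_nseq.
rewrite -[dy (dy _)]/(dword (nseq 2 false) _) dword_character symbw_nseq.
have -> : antid (fun z => symb false k ^+ 2 * character k z) =
    fun z => symb false k ^+ 2 * antid (character k) z.
  have -> : (fun z => symb false k ^+ 2 * character k z) =
      fun z => symb false k ^+ 2 * character k z + (fun=> 0) z.
    by apply/funext => z'; rewrite addr0.
  rewrite antid_lin; [|exact: smooth_character|exact: smooth0].
  apply/funext => z'; rewrite (_ : antid (fun=> 0) z' = 0) ?addr0//.
  rewrite /antid /cwavg /wavg; apply: complexP => /=;
  by rewrite (@eq_tint _ _ (fun=> 0)) ?tint_cst// => z''; rewrite mulr0.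
by rewrite antid_character; case: ifP => _; ring.
Qed.

Lemma coef_residual k : coef residual_dist k =
  ((-1) ^+ (d.+1)./2 * symb true (- k) ^+ d + kappa%:C *
    (symb false (- k) ^+ 2 * (if k.1 == 0 then 0 else (symb true (- k))^-1))) * coef u k
  + symb true (- k) * coef v k.
Proof.
have sc := @smooth_character R (- k).
rewrite /coef /= /residual asboolT// lin_op_character (distZ _ _ sc).
rewrite -[dx _]/(dd true _) dd_character (distZ _ _ sc).
by rewrite [(- k).1 == 0]oppr_eq0.
Qed.

Lemma weak_equation_of_coef f : (forall k, coef residual_dist k = 0) -> smooth f ->
  u (fun z => (-1) ^+ (d.+1)./2 * iter d dx f z + kappa%:C * dx_inv (dy (dy f)) z)
    + v (dx f) = 0.
Proof.
move=> c0 sf; rewrite dx_invE; last by do 2 apply: smooth_dy.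
have Z : residual_dist = zero_dist by apply: dist_coef_inj => k; rewrite c0.
have : residual_dist f = 0 by rewrite Z.
by rewrite /= /residual asboolT.
Qed.

(** The dispersion relation at the frequency [k]. *)
Lemma dispersion k : k.1 != 0 ->
  (-1) ^+ (d.+1)./2 * symb true (- k) ^+ d +
    kappa%:C * (symb false (- k) ^+ 2 / symb true (- k)) =
  - (symb true (- k) * ((2 * pi * k.1%:~R) ^+ d.-1
       - kappa * (k.2%:~R / k.1%:~R) ^+ 2)%:C) :> R[i].
Proof.
move=> k10.
pose X : R := 2 * pi * k.1%:~R; pose Y : R := 2 * pi * k.2%:~R.
have p0 : 2 * pi != 0 :> R by rewrite mulf_neq0// gt_eqF// pi_gt0.
have kr0 : k.1%:~R != 0 :> R by rewrite intr_eq0.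
have X0 : X != 0 by rewrite mulf_neq0.
pose J : R[i] := 0 +i* 1.
have J2 : J * J = -1 by apply: complexP => /=; ring.
have sJ (x : R) : 0 +i* x = J * x%:C by apply: complexP => /=; ring.
have sX : symb true (- k) = - (J * X%:C) by rewrite symbN -sJ.
have sY : symb false (- k) = - (J * Y%:C) by rewrite symbN -sJ.
have q : (k.2%:~R / k.1%:~R) ^+ 2 = (Y / X) ^+ 2 :> R.
  congr (_ ^+ 2); rewrite /X /Y; move: (2 * pi) (k.1%:~R) (k.2%:~R) p0 kr0 => a x y a0 x0.
  by field; rewrite a0 x0.
rewrite sX sY q -/X.
have x0 : X%:C != 0 :> R[i] by rewrite eq_complex /= eqxx andbT.
have E (a b p : R) n : (a ^+ n - p * (b / a) ^+ 2)%:C =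
    a%:C ^+ n - p%:C * (b%:C ^+ 2 / a%:C ^+ 2) :> R[i].
  by rewrite rmorphB rmorphM /= expr_div_n fmorph_div !rmorphXn.
rewrite E.
have inv : (- (J * X%:C))^-1 = J / X%:C.
  apply: (@mulfI _ (- (J * X%:C))).
    by rewrite oppr_eq0 mulf_neq0// eq_complex /= oner_eq0 andbF.
  rewrite mulfV ?oppr_eq0 ?mulf_neq0// ?eq_complex ?oner_eq0 ?andbF//=.
  by rewrite mulNr mulrACA J2 mulfV// mulN1r opprK.
rewrite inv; move: (X%:C) (Y%:C) (kappa%:C) x0 => x y p x0.
have alg3 : (- (J * x)) ^+ 3 = J * x ^+ 3.
  have -> : (- (J * x)) ^+ 3 = - (J * J) * (J * x ^+ 3) by ring.
  by rewrite J2 opprK mul1r.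
have alg5 : (- (J * x)) ^+ 5 = - (J * x ^+ 5).
  have -> : (- (J * x)) ^+ 5 = - ((J * J) * (J * J) * (J * x ^+ 5)) by ring.
  by rewrite J2 mulrNN !mul1r.
have algy : p * ((- (J * y)) ^+ 2 * (J / x)) = - (p * J * y ^+ 2 / x).
  have -> : (- (J * y)) ^+ 2 * (J / x) = (J * J) * (J * y ^+ 2 / x) by ring.
  by rewrite J2; ring.
have fin (n : nat) : J * x ^+ n.+1 - p * J * y ^+ 2 / x =
    - (- (J * x) * (x ^+ n - p * (y ^+ 2 / x ^+ 2))).
  by rewrite exprS; field.
rewrite algy -fin; congr (_ + _).
by case: hd => -> /=; rewrite ?alg3 ?alg5 !exprS expr0; ring.
Qed.

End LinearPart.

(** * The weak equation for a travelling wave *)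

Section WeakEquation.
Context {R : realType} (e : freq).
Hypothesis e1 : e.1 != 0.
Hypothesis e2 : e.2 = 1.
Variable lam : nat -> R.
Hypothesis lam_ge : forall j, (j.+1 * j.+2)%:R <= lam j.
Variables (c : nat -> R) (r : R).
Hypothesis r1 : 1 <= r.
Hypothesis Kc : energy_le lam r c.
Hypothesis profile :
  forall j, tint (fun z => cseries e c z ^+ 2 * cosj e j z) = lam j * c j.
Variables (d : nat) (kappa : R).
Hypothesis hd : d = 3%N \/ d = 5%N.
Hypothesis hkappa : kappa = -1 \/ kappa = 1.
Hypothesis lamE : forall j,
  lam j = (2 * pi * e.1%:~R * j.+1%:R) ^+ d.-1 - kappa / e.1%:~R ^+ 2.

Local Notation u := (wave e lam_ge r1 Kc).
Local Notation v := (wave_square e lam_ge r1 Kc).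

Lemma order0_fdist (h : R * R -> R) (ch : continuous h) : order0 (fdist ch).
Proof.
have [H H0 hH] := continuous_bounded_square ch.
exists (2 * H) => f M sf fM; rewrite -mulrA.
exact: normc_mul_functional.
Qed.

Lemma weak_equation f : smooth f ->
  u (fun z => (-1) ^+ (d.+1)./2 * iter d dx f z + kappa%:C * dx_inv (dy (dy f)) z)
    + xne0_square u (dx f) = 0.
Proof.
move=> sf; rewrite (xne0_square_wave e1 e2 lam_ge r1 Kc profile).
have u0 : order0 u by exact: order0_fdist.
have v0 : order0 v by exact: order0_fdist.
apply: (@weak_equation_of_coef _ _ _ hd hkappa u v u0 v0 f _ sf) => k.
rewrite coef_residual.
rewrite (coef_wave e2) (coef_wave_square e1 e2 lam_ge r1 Kc profile).
have [h0|h0] := eqVneq (hat e c k) 0.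
  by rewrite h0 mulr0 add0r mulr0; case: ifP => _; rewrite mulr0.
have [kE k20] := hat_lattice h0.
have k0 : k != 0 by apply: contra k20 => /eqP ->.
have k10 : k.1 != 0 by rewrite kE /= mulf_neq0.
rewrite (negbTE k0) (negbTE k10) (dispersion _ hd)//.
have alg (s : R[i]) (l h : R) : - (s * l%:C) * h%:C + s * (l * h)%:C = 0.
  by rewrite rmorphM /=; ring.
suff -> : (2 * pi * k.1%:~R) ^+ d.-1 - kappa * (k.2%:~R / k.1%:~R) ^+ 2 =
    lam `|k.2|.-1 :> R by exact: alg.
have er0 : e.1%:~R != 0 :> R by rewrite intr_eq0.
have kr0 : k.2%:~R != 0 :> R by rewrite intr_eq0.
have k1E : k.1%:~R = e.1%:~R * k.2%:~R :> R by rewrite {1}kE /= intrM.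
rewrite lamE k1E; congr (_ - _).
- have [m k2] : exists m : nat, k.2 = m.+1%:Z \/ k.2 = - m.+1%:Z.
    exists `|k.2|.-1; clear -k20; lia.
  have -> : `|k.2|.-1 = m by case: k2 => ->; rewrite ?abszN absz_nat.
  case: k2 => ->; first by rewrite mulrA.
  rewrite intrN !mulrN mulrA.
  by case: hd => -> /=; rewrite ?sqrrN // -[4%N]/(2 * 2)%N !exprM sqrrN.
- move: (e.1%:~R) (k.2%:~R) er0 kr0 => x y x0 y0.
  by field; rewrite x0 y0.
Qed.

End WeakEquation.

(** * Infinitely many solutions *)

(** The coefficients of the linear part are positive for both signs of [kappa]. *)
Lemma symbol_lower_bound {R : realType} (d : nat) (kappa : R) (a j : nat) :
  d = 3%N \/ d = 5%N -> kappa = -1 \/ kappa = 1 ->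
  (j.+1 * j.+2)%:R <=
    (2 * pi * (a.+1 : int)%:~R * j.+1%:R) ^+ d.-1 - kappa / (a.+1 : int)%:~R ^+ 2.
Proof.
move=> hd hk; have aE : (a.+1 : int)%:~R = a.+1%:R :> R by [].
rewrite aE natrM -[j.+2%:R]natr1.
have a1 : 1 <= a.+1%:R :> R by rewrite ler1n.
have j1 : 1 <= j.+1%:R :> R by rewrite ler1n.
move: (a.+1%:R) (j.+1%:R) a1 j1 => x m x1 m1.
have xm : m <= x * m by rewrite ler_peMl// (le_trans ler01 m1).
have y4 : 4 * m <= 2 * pi * x * m.
  have := pi_ge2 R => p2; rewrite -mulrA.
  apply: (@le_trans _ _ (4 * (x * m))); first by rewrite ler_pM2l.
  by rewrite ler_wpM2r; [|lra|lra].
have y16 : 16 * m ^+ 2 <= (2 * pi * x * m) ^+ 2.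
  have -> : 16 * m ^+ 2 = (4 * m) ^+ 2 by ring.
  by rewrite lerXn2r ?nnegrE; [|lra|lra|].
have y2 : (2 * pi * x * m) ^+ 2 <= (2 * pi * x * m) ^+ d.-1.
  by apply: ler_weXn2l; [lra|case: hd => ->].
have k1 : kappa / x ^+ 2 <= 1.
  have x2 : 1 <= x ^+ 2 by rewrite exprn_ege1.
  rewrite ler_pdivrMr ?mul1r; last by rewrite (lt_le_trans ltr01).
  by case: hk => ->; lra.
nra.
Qed.

(** For each direction (a + 1, 1), a solution whose frequencies lie on the line
    through it. *)
Lemma exists_solution {R : realType} (d : nat) (kappa S : R) (a : nat) :
  d = 3%N \/ d = 5%N -> kappa = -1 \/ kappa = 1 -> d%:R + 1 < S ->
  exists u : torus_distribution R,
    [/\ [/\ weak_singular_solution d kappa u,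
        depends_on_y u,
        (forall p : R, 1 <= p < 2 -> in_Lp p u),
        (forall sigma : R, 0 < sigma ->
           in_Hs0 (- sigma) u /\ in_Hs (- sigma) u) &
        (AFx S u < +oo)%E],
      (exists k, coef u k != 0) &
      (forall k, coef u k != 0 -> k.1 = a.+1%:Z * k.2 /\ k.2 != 0)].
Proof.
move=> hd hk hS.
pose e : freq := (a.+1%:Z, 1).
have e1 : e.1 != 0 by [].
have e2 : e.2 = 1 by [].
pose lam (j : nat) : R := (2 * pi * e.1%:~R * j.+1%:R) ^+ d.-1 - kappa / e.1%:~R ^+ 2.
have lam_ge j : (j.+1 * j.+2)%:R <= lam j by exact: symbol_lower_bound.
have [c [r [r1 Kc [j cj] profile]]] := exists_profile e1 lam_ge.
pose u := wave e lam_ge r1 Kc.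
have cu k : coef u k = (hat e c k)%:C by exact: (coef_wave e2).
have cn : coef u (harm e j.+1) != 0.
  rewrite cu hat_harm//= eq_complex /= eqxx andbT; exact: cj.
have S0 : 0 <= S by rewrite ltW// (le_lt_trans _ hS)// addr_ge0.
exists u; split; last 2 first.
- by exists (harm e j.+1).
- move=> k; rewrite cu eq_complex /= eqxx andbT => /hat_lattice[kE k20].
  by split => //; rewrite [in LHS]kE.
split.
- split.
  + exact: real_fdist.
  + exact: (xne0_proj_wave e1 e2).
  + by exists 1 => //; exact: (AFx_wave e2).
  + exact: (weak_equation e1 e2 lam_ge r1 Kc profile hd hk (fun=> erefl)).
- exists (character (- harm e j.+1)); first exact: smooth_character.
  rewrite -[dy _]/(dd false _) dd_character distZ; last exact: smooth_character.
  rewrite mulf_neq0// symbN oppr_eq0 eq_complex /= eqxx /= mul1r.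
  by rewrite !mulf_neq0 ?intr_eq0// gt_eqF ?pi_gt0.
- by move=> p /andP[p1 _]; apply: in_Lp_fdist; exact: le_trans ler01 p1.
- exact: (in_Hs_wave e2).
- exact: (AFx_wave e2).
Qed.

Theorem theorem1p8 (R : realType) (d : nat) (kappa S : R)
    (hd : d = 3%N \/ d = 5%N) (hkappa : kappa = -1 \/ kappa = 1)
    (hS : d%:R + 1 < S) :
  infinite_set [set u : torus_distribution R |
    [/\ weak_singular_solution d kappa u,
        depends_on_y u,
        (forall p : R, 1 <= p < 2 -> in_Lp p u),
        (forall sigma : R, 0 < sigma ->
           in_Hs0 (- sigma) u /\ in_Hs (- sigma) u) &
        (AFx S u < +oo)%E]].
Proof.
have [U HU] := choice (fun a => exists_solution a hd hkappa hS).
have Uinj : injective U.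
  move=> a b Uab; have [_ [k ak] Ha] := HU a; have [_ _ Hb] := HU b.
  have [k1 k20] := Ha k ak; rewrite Uab in ak; have [k1' _] := Hb k ak.
  by move: k1'; rewrite k1 => /(mulIf k20) [].
apply: (@sub_infinite_set _ (range U)).
  by move=> _ [a _ <-]; have [? _ _] := HU a.
rewrite (eq_finite_set (inj_card_eq (in2W Uinj))); exact: infinite_nat.
Qed.
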